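(* There exists an algorithm that, given a non-negative $L$-smooth DR-submodular function $F\colon[0,1]^{\mathcal N}\to\mathbb{R}_{\ge 0}$, a meta-solvable down-closed convex body $P\subseteq[0,1]^{\mathcal N}$ of diameter $D$, and a value $\delta\in(0,1)$, returns a vector $\mathbf x\in P$ such that \[F(\mathbf x)\ \ge\ 0.401\cdot\max_{\mathbf x'\in P}F(\mathbf x')-O(\delta D^2L),\] and runs in $\mathrm{Poly}(|\mathcal N|,\delta^{-1})$ time. (The $O(\cdot)$ hides an absolute constant.)
   Context: $\mathcal N$ is a finite ground set. A function $F\colon[0,1]^{\mathcal N}\to\mathbb R$ is DR-submodular if $F(\mathbf x+z\mathbf 1_u)-F(\mathbf x)\ge F(\mathbf y+z\mathbf 1_u)-F(\mathbf y)$ for every $u\in\mathcal N$, every $\mathbf x\le\mathbf y$ in $[0,1]^{\mathcal N}$ and every $z\in[0,1-y_u]$, where $\mathbf 1_u$ is the standard basis vector of $u$. DR-submodular functions are assumed differentiable, and the algorithm may evaluate $F$ and $\nabla F$ at any point. $F$ is $L$-smooth if $\|\nabla F(\mathbf x)-\nabla F(\mathbf y)\|_2\le L\|\mathbf x-\mathbf y\|_2$ for all $\mathbf x,\mathbf y\in[0,1]^{\mathcal N}$. $P$ is down-closed if $\mathbf y\in P$ and $\mathbf 0\le\mathbf x\le\mathbf y$ imply $\mathbf x\in P$. $P$ has diameter $D$ if $\|\mathbf x-\mathbf y\|_2\le D$ for all $\mathbf x,\mathbf y\in P$. $P$ is meta-solvable if one can efficiently optimize linear functions over $P\cap Q$ for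 any polytope $Q$ defined by a polynomial number of explicitly given linear constraints. *)

(* Defs.v *)
From HB Require Import structures.
From mathcomp Require Import all_boot all_order all_algebra.
From mathcomp Require Import all_classical all_reals all_analysis.
Set Implicit Arguments.
Unset Strict Implicit.
Unset Printing Implicit Defensive.
Import Order.TTheory GRing.Theory Num.Theory.
Import numFieldNormedType.Exports.
Local Open Scope classical_set_scope.
Local Open Scope ring_scope.

(* The ground set is 'I_n.  Functions on the cube [0,1]^n are represented by
   total functions on 'rV[R]_n about whose values outside the cube nothing is
   ever assumed. *)

Section Geometry.
Context {R : realType} {n : nat}.
Implicit Types (x y u v : 'rV[R]_n) (P : set 'rV[R]_n).

Definition dot u v : R := \sum_(i < n) u 0 i * v 0 i.
Definition norm2 u : R := Num.sqrt (\sum_(i < n) u 0 i ^+ 2).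

Definition vle x y := forall i, x 0 i <= y 0 i.

Definition cube : set 'rV[R]_n := [set x | forall i, 0 <= x 0 i <= 1].

Definition dr_submodular (F : 'rV[R]_n -> R) :=
  forall (u : 'I_n) x y (z : R),
    cube x -> cube y -> vle x y -> 0 <= z <= 1 - y 0 u ->
    F (x + z *: delta_mx 0 u) - F x >= F (y + z *: delta_mx 0 u) - F y.

(* F is (Frechet) differentiable on the cube with gradient G; at boundary points
   the increments are restricted to those staying in the cube, since F is only
   meaningful there. *)
Definition gradient_on_cube (F : 'rV[R]_n -> R) (G : 'rV[R]_n -> 'rV[R]_n) :=
  forall x, cube x -> forall e : R, 0 < e ->
    exists2 d : R, 0 < d & forall y, cube y -> norm2 (y - x) < d ->
      `|F y - F x - dot (G x) (y - x)| <= e * norm2 (y - x).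

(* 0 <= L is automatic from the inequality unless n = 0. *)
Definition smooth (L : R) (G : 'rV[R]_n -> 'rV[R]_n) :=
  0 <= L /\
  forall x y, cube x -> cube y -> norm2 (G x - G y) <= L * norm2 (x - y).

(* Bodies with empty interior are allowed. *)
Definition convex_body P :=
  [/\ P !=set0, compact P & @convex_set R 'rV[R]_n P].

Definition down_closed P :=
  forall x y, P y -> vle 0 x -> vle x y -> P x.

Definition has_diameter (D : R) P :=
  forall x y, P x -> P y -> norm2 (x - y) <= D.

Definition maximizer (F : 'rV[R]_n -> R) P x :=
  P x /\ forall y, P y -> F y <= F x.

(* The pair (a, b) stands for the constraint <a, x> <= b. *)
Definition polyhedron (cs : seq ('rV[R]_n * R)) : set 'rV[R]_n :=
  [set x | forall c, c \in cs -> dot c.1 x <= c.2].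

(* An exact solver for linear optimization over P `&` Q, for Q given by an
   explicit list of linear constraints; None reports that P `&` Q is empty.
   Unbounded Q are harmless: for P in the cube, P `&` Q is unchanged when the
   constraints of the cube are added to Q. *)
Definition meta_solver P
    (solve : seq ('rV[R]_n * R) -> 'rV[R]_n -> option 'rV[R]_n) :=
  forall cs w,
    match solve cs w with
    | Some x => maximizer (dot w) (P `&` polyhedron cs) x
    | None => P `&` polyhedron cs = set0
    end.

End Geometry.

(* Algorithms are programs of a uniform real RAM with three oracles.  The memory
   has nat cells indexed by nat, used for counters and addresses, and real cells
   indexed by (row, column); both admit indirect addressing.  There is no
   multiplication of nats and no conversion from reals to nats, and the only
   constants are nats.  Real operations are exact. *)

Inductive nexp :=
| NLit of nat
| NMem of nexp
| NAdd of nexp & nexp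
| NSub of nexp & nexp.

Inductive rexp :=
| RNat of nexp
| RMem of nexp & nexp
| RAdd of rexp & rexp
| RSub of rexp & rexp
| RMul of rexp & rexp
| RDiv of rexp & rexp.

Inductive bexp :=
| BNle of nexp & nexp
| BRle of rexp & rexp
| BNot of bexp
| BAnd of bexp & bexp.

(* In the oracle instructions a vector is named by the row holding it.
     QueryF x i j          cell (i, j) := F x
     QueryGrad x y         y := gradient of F at x
     Solve a m w x f       maximize <w, .> over P subject to the m constraints
                           held in rows a, ..., a + m - 1, right-hand sides in
                           column n; nat cell f := 1 and x := a maximizer, or
                           f := 0 if infeasible. *)
Inductive cmd :=
| Skip
| NSet of nexp & nexp
| RSet of nexp & nexp & rexp
| Seq of cmd & cmd
| If of bexp & cmd & cmd
| While of bexp & cmd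
| QueryF of nexp & nexp & nexp
| QueryGrad of nexp & nexp
| Solve of nexp & nexp & nexp & nexp & nexp.

Section Semantics.
Context {R : realType}.

Record state := State { nmem : nat -> nat; rmem : nat -> nat -> R }.
Implicit Types s : state.

Definition nset s a k : state :=
  State (fun a' => if a' == a then k else nmem s a') (rmem s).

Definition rset s i j (r : R) : state :=
  State (nmem s)
    (fun i' j' => if (i' == i) && (j' == j) then r else rmem s i' j').

Fixpoint neval s (e : nexp) : nat :=
  match e with
  | NLit k => k
  | NMem a => nmem s (neval s a)
  | NAdd a b => (neval s a + neval s b)%N
  | NSub a b => (neval s a - neval s b)%N
  end.

Fixpoint reval s (e : rexp) : R :=
  match e with
  | RNat a => (neval s a)%:R
  | RMem i j => rmem s (neval s i) (neval s j)
  | RAdd a b => reval s a + reval s b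
  | RSub a b => reval s a - reval s b
  | RMul a b => reval s a * reval s b
  | RDiv a b => reval s a / reval s b
  end.

Fixpoint beval s (e : bexp) : bool :=
  match e with
  | BNle a b => (neval s a <= neval s b)%N
  | BRle a b => reval s a <= reval s b
  | BNot a => ~~ beval s a
  | BAnd a b => beval s a && beval s b
  end.

Context {n : nat}.

Definition get_row s (i : nat) : 'rV[R]_n := \row_(j < n) rmem s i j.

Definition set_row s (i : nat) (v : 'rV[R]_n) : state :=
  State (nmem s)
    (fun i' j' => if i' == i then
                    if insub j' is Some j then v 0 j else rmem s i' j'
                  else rmem s i' j').

Definition get_constraints s (a m : nat) : seq ('rV[R]_n * R) :=
  [seq (get_row s i, rmem s i n) | i <- iota a m].

Variables (F : 'rV[R]_n -> R) (G : 'rV[R]_n -> 'rV[R]_n).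
Variable solve : seq ('rV[R]_n * R) -> 'rV[R]_n -> option 'rV[R]_n.

Definition do_solve s (a m w x f : nat) : state :=
  if solve (get_constraints s a m) (get_row s w) is Some v
  then nset (set_row s x v) f 1 else nset s f 0.

(* exec c s t s' : started in s, the command c halts in s' after t time units.
   An assignment or a test costs one unit (the expressions of a fixed program
   have bounded size); an oracle call costs the size of its input. *)
Inductive exec : cmd -> state -> nat -> state -> Prop :=
| ExecSkip s : exec Skip s 1 s
| ExecNSet a e s : exec (NSet a e) s 1 (nset s (neval s a) (neval s e))
| ExecRSet i j e s :
    exec (RSet i j e) s 1 (rset s (neval s i) (neval s j) (reval s e))
| ExecSeq c1 c2 s1 s2 s3 t1 t2 :
    exec c1 s1 t1 s2 -> exec c2 s2 t2 s3 -> exec (Seq c1 c2) s1 (t1 + t2) s3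
| ExecIf b c1 c2 s s' t :
    exec (if beval s b then c1 else c2) s t s' -> exec (If b c1 c2) s t.+1 s'
| ExecWhileEnd b c s : ~~ beval s b -> exec (While b c) s 1 s
| ExecWhileStep b c s1 s2 s3 t1 t2 :
    beval s1 b -> exec c s1 t1 s2 -> exec (While b c) s2 t2 s3 ->
    exec (While b c) s1 (t1 + t2).+1 s3
| ExecQueryF x i j s :
    exec (QueryF x i j) s n.+1
      (rset s (neval s i) (neval s j) (F (get_row s (neval s x))))
| ExecQueryGrad x y s :
    exec (QueryGrad x y) s n.+1
      (set_row s (neval s y) (G (get_row s (neval s x))))
| ExecSolve a m w x f s :
    exec (Solve a m w x f) s ((neval s m).+1 * n.+1)
      (do_solve s (neval s a) (neval s m) (neval s w) (neval s x) (neval s f)).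

Lemma exec_det c s t1 s1 t2 s2 :
  exec c s t1 s1 -> exec c s t2 s2 -> t1 = t2 /\ s1 = s2.
Proof.
move=> E1; elim: E1 t2 s2 => {c s t1 s1}.
- by move=> s t2 s2 E; inversion E.
- by move=> a e s t2 s2 E; inversion E.
- by move=> i j e s t2 s2 E; inversion E.
- move=> c1 c2 s1 s2 s3 t1 t2 _ IH1 _ IH2 t s E.
  inversion E as [| | |? ? ? ? ? ? ? E1 E2| | | | | |]; subst.
  by case: (IH1 _ _ E1) => ? ?; subst; case: (IH2 _ _ E2) => -> ->.
- move=> b c1 c2 s s' t _ IH t2 s2 E.
  inversion E as [| | | |? ? ? ? ? ? E1| | | | |]; subst.
  by case: (IH _ _ E1) => -> ->.
- move=> b c s nb t2 s2 E.
  inversion E as [| | | | | |? ? ? ? ? ? ? hb| | |]; subst => //.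
  by rewrite hb in nb.
- move=> b c s1 s2 s3 t1 t2 hb _ IH1 _ IH2 t s E.
  inversion E as [| | | | |? ? ? nb|? ? ? ? ? ? ? _ E1 E2| | |]; subst.
    by rewrite hb in nb.
  by case: (IH1 _ _ E1) => ? ?; subst; case: (IH2 _ _ E2) => -> ->.
- by move=> x i j s t2 s2 E; inversion E.
- by move=> x y s t2 s2 E; inversion E.
- by move=> a m w x f s t2 s2 E; inversion E.
Qed.

End Semantics.
Arguments state : clear implicits.

(* Input convention: nat cell 0 holds n, real cell (0, 0) holds delta, and all
   other cells are 0.  The output vector is read off row 0. *)
Definition init_state {R : realType} (n : nat) (delta : R) : state R :=
  State (fun a => if a == 0%N then n else 0%N)
    (fun i j => if (i == 0%N) && (j == 0%N) then delta else 0).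

Definition output {R : realType} (n : nat) (s : state R) : 'rV[R]_n :=
  get_row s 0.

(* Main.v *)
Require Import Defs.
From mathcomp Require Import all_boot all_order all_algebra.
From mathcomp Require Import all_classical all_reals all_analysis.
From mathcomp Require Import ring lra zify.
Set Implicit Arguments.
Unset Strict Implicit.
Unset Printing Implicit Defensive.
Import Order.TTheory GRing.Theory Num.Theory.
Import numFieldNormedType.Exports.
Local Open Scope classical_set_scope.
Local Open Scope ring_scope.

(** Write [z (+) o] and [z (.) o] for the coordinatewise probabilistic sum and product ([vadd],
    [vmul]), and let [o] be a maximizer.  A Frank-Wolfe local optimum [z] of [F] on a convex set
    containing [o] satisfies [F (z (+) o) + F (z (.) o) <= 2 F z] up to the error.  Double greedy on
    the box [[0, z]] turns a large [F z] or [F (z (.) o)] into a good solution; it is compared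
    with a measured continuous greedy which avoids [z] during its first 11/30 and ignores it
    afterwards, after Buchbinder and Feldman.  That greedy moves along points [x] of [P] which
    are local optima among the points whose gain reaches a threshold computed from guessed
    values; [o] is such a point.  Either every [x] has [F (x (+) o)] almost as large as
    [F (z (+) o)], which keeps [F (o (+) y)] large along the run and makes the better of the two
    solutions worth 0.401 [F o], or some [x] lowers [F (x (+) o)] by [F o / m] and the search
    restarts from [x].  As [F (z (+) o) <= 2 F o], a search of constant depth [2 m + 1] through
    all iterates and all guesses suffices, and it takes polynomial time. *)

(** * First-order bounds for DR-submodular functions *)

(** The obstacle is that [o] is unknown: [F (vadd x o)] cannot be evaluated, so the program cannot
    tell which case occurs. It therefore recurses on every iterate and keeps the best point seen;
    the comparison of [F (vadd x o)] with the guessed level [A] happens only in the analysis. The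
    requirement on the gain is linear in [x], hence one half-space cutting [P], which the solver
    accepts; as [o] meets it, local optima of the cut body may still be compared with [o]. Two kinds
    of loss are kept apart. With the switch at 11/30 and double greedy weight 11/5 the combined
    bound is about 0.40101 [F o]. Losses proportional to [F o] (duality gaps, rounded guesses, the
    drop that triggers a restart) are paid from this margin of about 10^-5, which is why [1/m] is at
    most 10^-6 and why [m] can be an absolute constant: the depth only fixes the degree of the
    running time. Losses from discretization and smoothness are multiples of [L D^2 / T] and form
    the additive term. *)

Section Vectors.
Context {R : realType} {n : nat}.
Implicit Types (x y u v w : 'rV[R]_n).

Definition vmul x y : 'rV[R]_n := \row_j (x 0 j * y 0 j).
Definition vadd x y : 'rV[R]_n := \row_j (x 0 j + y 0 j - x 0 j * y 0 j).
Definition upd x (k : 'I_n) (t : R) : 'rV[R]_n :=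
  \row_j (if j == k then t else x 0 j).

Lemma sqr_norm2 u : norm2 u ^+ 2 = \sum_(i < n) u 0 i ^+ 2.
Proof. by rewrite sqr_sqrtr // sumr_ge0 // => i _; exact: sqr_ge0. Qed.

Lemma norm2_ge0 u : 0 <= norm2 u.
Proof. exact: sqrtr_ge0. Qed.

Lemma norm2_le u v : (forall i, `|u 0 i| <= `|v 0 i|) -> norm2 u <= norm2 v.
Proof.
move=> h; apply: ler_wsqrtr; apply: ler_sum => i _.
by rewrite -[X in X <= _]real_normK ?num_real // -[leRHS]real_normK ?num_real //
  lerXn2r ?nnegrE.
Qed.

Lemma norm2Z (a : R) u : norm2 (a *: u) = `|a| * norm2 u.
Proof.
rewrite /norm2 -sqrtr_sqr -sqrtrM ?sqr_ge0 // mulr_sumr; congr Num.sqrt.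
by apply: eq_bigr => i _; rewrite mxE exprMn.
Qed.

Lemma norm2N u : norm2 (- u) = norm2 u.
Proof. by rewrite -scaleN1r norm2Z normrN normr1 mul1r. Qed.

Lemma dotDr u v w : dot u (v + w) = dot u v + dot u w.
Proof. by rewrite /dot -big_split; apply: eq_bigr => i _; rewrite mxE mulrDr. Qed.

Lemma dotDl u v w : dot (u + v) w = dot u w + dot v w.
Proof. by rewrite /dot -big_split; apply: eq_bigr => i _; rewrite mxE mulrDl. Qed.

Lemma dotZr (a : R) u v : dot u (a *: v) = a * dot u v.
Proof. by rewrite /dot mulr_sumr; apply: eq_bigr => i _; rewrite mxE mulrCA. Qed.

Lemma dotZl (a : R) u v : dot (a *: u) v = a * dot u v.
Proof. by rewrite /dot mulr_sumr; apply: eq_bigr => i _; rewrite mxE mulrA. Qed.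

Lemma dotNr u v : dot u (- v) = - dot u v.
Proof. by rewrite -scaleN1r dotZr mulN1r. Qed.

Lemma dotNl u v : dot (- u) v = - dot u v.
Proof. by rewrite -scaleN1r dotZl mulN1r. Qed.

Lemma dotBr u v w : dot u (v - w) = dot u v - dot u w.
Proof. by rewrite dotDr dotNr. Qed.

Lemma dotBl u v w : dot (u - v) w = dot u w - dot v w.
Proof. by rewrite dotDl dotNl. Qed.

Lemma dot0r u : dot u 0 = 0.
Proof. by rewrite -(scale0r (0 : 'rV[R]_n)) dotZr mul0r. Qed.

Lemma dot_vmul u v w : dot u (vmul v w) = dot (vmul u v) w.
Proof. by apply: eq_bigr => i _; rewrite !mxE mulrA. Qed.

Lemma norm2_eq0_row u : norm2 u = 0 -> u = 0.
Proof.
move=> h; have := sqr_norm2 u; rewrite h expr0n /= => /esym/eqP.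
rewrite psumr_eq0 => [/allP h0|i _]; last exact: sqr_ge0.
by apply/rowP => i; rewrite mxE; apply/eqP; rewrite -sqrf_eq0; exact: h0 i (mem_index_enum i).
Qed.

Lemma dot_le u v : dot u v <= norm2 u * norm2 v.
Proof.
have [u0|un0] := eqVneq (norm2 u) 0.
  rewrite u0 mul0r (norm2_eq0_row u0) -(scale0r (0 : 'rV[R]_n)) dotZl mul0r //.
have [v0|vn0] := eqVneq (norm2 v) 0.
  by rewrite v0 mulr0 (norm2_eq0_row v0) dot0r.
have up : 0 < norm2 u by rewrite lt_neqAle eq_sym un0 norm2_ge0.
have vp : 0 < norm2 v by rewrite lt_neqAle eq_sym vn0 norm2_ge0.
have : 0 <= \sum_(i < n) (norm2 v * u 0 i - norm2 u * v 0 i) ^+ 2.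
  by apply: sumr_ge0 => i _; exact: sqr_ge0.
have -> : \sum_(i < n) (norm2 v * u 0 i - norm2 u * v 0 i) ^+ 2 =
    norm2 v ^+ 2 * (\sum_(i < n) u 0 i ^+ 2) +
    norm2 u ^+ 2 * (\sum_(i < n) v 0 i ^+ 2) -
    norm2 u * norm2 v * dot u v *+ 2.
  rewrite /dot !mulr_sumr -sumrMnl -sumrN -!big_split /=.
  by apply: eq_bigr => i _; ring.
rewrite -!sqr_norm2 => h.
have {h} : 0 <= (norm2 u * norm2 v) * (norm2 u * norm2 v - dot u v) by lra.
by rewrite pmulr_rge0 ?mulr_gt0 // subr_ge0.
Qed.

Lemma dot_ge u v : - (norm2 u * norm2 v) <= dot u v.
Proof. by rewrite lerNl -dotNr -(norm2N v) dot_le. Qed.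

End Vectors.

(** * Tangent and concavity inequalities along monotone directions *)

Section Submodular.
Context {R : realType} {n : nat}.
Variables (F : 'rV[R]_n -> R) (G : 'rV[R]_n -> 'rV[R]_n) (L : R).
Hypothesis F_ge0 : forall x, cube x -> 0 <= F x.
Hypothesis F_dr : dr_submodular F.
Hypothesis F_grad : gradient_on_cube F G.
Hypothesis G_smooth : smooth L G.
Implicit Types (x y u v w z : 'rV[R]_n).

(** Coordinates are added one at a time: [vk k] keeps the first [k] entries of [v], and each new
    entry is one instance of the axiom at the ordered points [x + vk k] and [y + vk k]. *)
Lemma dr_increment x y v : cube x -> cube (y + v) -> vle x y -> vle 0 v ->
  F (y + v) - F y <= F (x + v) - F x.
Proof.
move=> cx cyv xy v0.
pose vk k : 'rV[R]_n := \row_j (if (j < k)%N then v 0 j else 0).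
have cvk k : cube (x + vk k) /\ cube (y + vk k).
  split=> i; have /andP[x0 x1] := cx i; have := cyv i; have := xy i;
    have := v0 i; rewrite !mxE; case: ifP => _; lra.
have key k : (k <= n)%N -> F (y + vk k) - F y <= F (x + vk k) - F x.
  elim: k => [_|k IH kn].
    have -> : vk 0 = 0 by apply/rowP => j; rewrite !mxE.
    by rewrite !addr0 !subrr.
  have {IH} := IH (ltnW kn).
  have E : vk k.+1 = vk k + v 0 (Ordinal kn) *: delta_mx 0 (Ordinal kn).
    apply/rowP => j; rewrite !mxE eqxx /= ltnS.
    have [->|jk] := eqVneq j (Ordinal kn); first by rewrite leqnn ltnn mulr1 add0r.
    have -> : (j <= k)%N = (j < k)%N by rewrite ltn_neqAle; move: jk; rewrite -val_eqE /= => ->.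
    by rewrite mulr0 addr0.
  have := F_dr (u := Ordinal kn) (x := x + vk k) (y := y + vk k)
    (z := v 0 (Ordinal kn)) (proj1 (cvk k)) (proj2 (cvk k)).
  have xy' : vle (x + vk k) (y + vk k).
    by move=> i; rewrite !mxE lerD2r; exact: xy.
  have zz : 0 <= v 0 (Ordinal kn) <= 1 - (y + vk k) 0 (Ordinal kn).
    rewrite !mxE /= ltnn; have := cyv (Ordinal kn); have := v0 (Ordinal kn).
    by rewrite !mxE; lra.
  by move=> /(_ xy' zz); rewrite E !addrA; lra.
have := key n (leqnn n).
by have -> : vk n = v by apply/rowP => j; rewrite mxE ltn_ord.
Qed.

Lemma cube_between x y z : cube x -> cube y -> vle x z -> vle z y -> cube z.
Proof. by move=> cx cy xz zy i; have := cx i; have := cy i; have := xz i; have := zy i; lra. Qed.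

Lemma exists_div_lt (a d : R) : 0 <= a -> 0 < d -> exists k : nat, a / k.+1%:R < d.
Proof.
move=> a0 d0; exists (Num.bound (a / d)).
have := archi_boundP (divr_ge0 a0 (ltW d0)) => h.
rewrite ltr_pdivrMr ?ltr0Sn // -ltr_pdivrMl // mulrC.
by apply: lt_le_trans h _; rewrite ler_nat.
Qed.

(** When [v] is cut into [k.+1] equal pieces, each piece gains at most what the first one does, by
    [dr_increment]; differentiability at [x] controls the first piece. *)
Lemma grad_up x v : cube x -> cube (x + v) -> vle 0 v ->
  F (x + v) - F x <= dot (G x) v.
Proof.
move=> cx cxv v0.
apply/ler_addgt0Pr => e e0.
have n0 := norm2_ge0 v.
(* The [+ 1] covers [v = 0]. *)
have e1 : 0 < e / (norm2 v + 1) by apply: divr_gt0 => //; lra.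
have [d d0 hd] := F_grad cx e1.
have [k hk] := exists_div_lt n0 d0.
set K : R := k.+1%:R in hk; have K0 : 0 < K by rewrite ltr0Sn.
have cj j : (j <= k.+1)%N -> cube (x + (j%:R / K) *: v).
  move=> jk; apply: (cube_between cx cxv) => i; rewrite !mxE; have := v0 i; rewrite mxE => vi.
    by rewrite lerDl mulr_ge0 // divr_ge0 // ltW.
  rewrite lerD2l ler_piMl // ler_pdivrMr // mul1r ler_nat //.
have tele j : (j <= k.+1)%N ->
    F (x + (j%:R / K) *: v) - F x <= j%:R * (F (x + K^-1 *: v) - F x).
  elim: j => [_|j IH jk]; first by rewrite !mul0r scale0r addr0 subrr.
  have := IH (ltnW jk).
  have E : x + (j.+1%:R / K) *: v = (x + (j%:R / K) *: v) + K^-1 *: v.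
    by rewrite -addrA -scalerDl -[j.+1]addn1 natrD mulrDl mul1r.
  have := @dr_increment x (x + (j%:R / K) *: v) (K^-1 *: v) cx.
  rewrite -E => /(_ (cj _ jk)).
  have h1 : vle x (x + (j%:R / K) *: v).
    by move=> i; rewrite !mxE lerDl mulr_ge0 ?divr_ge0 ?(ltW K0) //; have := v0 i; rewrite mxE.
  have h2 : vle 0 (K^-1 *: v).
    by move=> i; rewrite !mxE mulr_ge0 ?invr_ge0 ?(ltW K0) //; have := v0 i; rewrite mxE.
  move=> /(_ h1 h2) h3 h4; have Ej : j.+1%:R = j%:R + 1 :> R; [by rewrite natr1|rewrite [X in _ <= X * _]Ej; lra].
have := tele k.+1 (leqnn _); rewrite divff ?gt_eqF // scale1r => h.
apply: (le_trans h).
have cK : cube (x + K^-1 *: v) by have := cj 1%N isT; rewrite mul1r.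
have := hd _ cK; rewrite addrC addKr norm2Z gtr0_norm ?invr_gt0 // mulrC => /(_ hk).
rewrite dotZr ler_norml => /andP[_ hu].
rewrite -/K -(ler_pM2l (x := K^-1)) ?invr_gt0 // mulKf ?gt_eqF // mulrDr ?mulrN.
have e2 : e / (norm2 v + 1) * norm2 v <= e.
  by rewrite mulrAC ler_pdivrMr ?ltr_wpDl // ler_pM2l // lerDl.
move: hu e2; set q := e / _ => hu e2.
have e3 : q * (norm2 v / K) <= K^-1 * e.
  by rewrite mulrA [leRHS]mulrC ler_pM2r ?invr_gt0.
by move: hu e3; set q1 := q * _; set q2 := K^-1 * e; set q3 := K^-1 * dot _ _; lra.
Qed.

(** Increments grow as the base point descends from [x], so each of the equal pieces removed loses
    at least as much as the one adjacent to [x]. *)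
Lemma grad_down x v : cube x -> cube (x - v) -> vle 0 v ->
  F (x - v) - F x <= - dot (G x) v.
Proof.
move=> cx cxv v0.
apply/ler_addgt0Pr => e e0.
have n0 := norm2_ge0 v.
have e1 : 0 < e / (norm2 v + 1) by apply: divr_gt0 => //; lra.
have [d d0 hd] := F_grad cx e1.
have [k hk] := exists_div_lt n0 d0.
set K : R := k.+1%:R in hk; have K0 : 0 < K by rewrite ltr0Sn.
have cj j : (j <= k.+1)%N -> cube (x - (j%:R / K) *: v).
  move=> jk; apply: (cube_between cxv cx) => i; rewrite !mxE; have := v0 i; rewrite mxE => vi.
    rewrite lerD2l lerN2 ler_piMl // ler_pdivrMr // mul1r ler_nat //.
  by rewrite gerDl oppr_le0 mulr_ge0 // divr_ge0 // ltW.
have tele j : (j <= k.+1)%N ->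
    F (x - (j%:R / K) *: v) - F x <= j%:R * (F (x - K^-1 *: v) - F x).
  elim: j => [_|j IH jk]; first by rewrite !mul0r scale0r subr0 subrr.
  have := IH (ltnW jk).
  have E : x - (j%:R / K) *: v = (x - (j.+1%:R / K) *: v) + K^-1 *: v.
    rewrite -[j.+1]addn1 natrD mulrDl mul1r scalerDl opprD addrA addrNK //.
  have := @dr_increment (x - (j.+1%:R / K) *: v) (x - K^-1 *: v) (K^-1 *: v) (cj _ jk).
  rewrite -E subrK => /(_ cx).
  have h1 : vle (x - (j.+1%:R / K) *: v) (x - K^-1 *: v).
    move=> i; rewrite !mxE lerD2l lerN2 -[j.+1]addn1 natrD mulrDl mul1r mulrDl lerDr.
    by rewrite mulr_ge0 ?divr_ge0 ?(ltW K0) //; have := v0 i; rewrite mxE.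
  have h2 : vle 0 (K^-1 *: v).
    by move=> i; rewrite !mxE mulr_ge0 ?invr_ge0 ?(ltW K0) //; have := v0 i; rewrite mxE.
  move=> /(_ h1 h2) h3 h4; have Ej : j.+1%:R = j%:R + 1 :> R; [by rewrite natr1|rewrite [X in _ <= X * _]Ej; lra].
have := tele k.+1 (leqnn _); rewrite divff ?gt_eqF // scale1r => h.
apply: (le_trans h).
have cK : cube (x - K^-1 *: v) by have := cj 1%N isT; rewrite mul1r.
have := hd _ cK; rewrite addrC addKr norm2N norm2Z gtr0_norm ?invr_gt0 // mulrC => /(_ hk).
rewrite dotNr dotZr ler_norml => /andP[_ hu].
rewrite -/K -(ler_pM2l (x := K^-1)) ?invr_gt0 // mulKf ?gt_eqF // mulrDr ?mulrN.
have e2 : e / (norm2 v + 1) * norm2 v <= e.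
  by rewrite mulrAC ler_pdivrMr ?ltr_wpDl // ler_pM2l // lerDl.
move: hu e2; set q := e / _ => hu e2.
have e3 : q * (norm2 v / K) <= K^-1 * e.
  by rewrite mulrA [leRHS]mulrC ler_pM2r ?invr_gt0.
by move: hu e3; set q1 := q * _; set q2 := K^-1 * e; set q3 := K^-1 * dot _ _; lra.
Qed.

(* Upper tangent at the intermediate point, in both directions. *)
Lemma concave_up x v (t : R) : cube x -> cube (x + v) -> vle 0 v -> 0 <= t <= 1 ->
  (1 - t) * F x + t * F (x + v) <= F (x + t *: v).
Proof.
move=> cx cxv v0 /andP[t0 t1].
have vi i : 0 <= v 0 i by have := v0 i; rewrite mxE.
have cp : cube (x + t *: v).
  by apply: (cube_between cx cxv) => i; rewrite !mxE; have := vi i; nra.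
have E1 : (x + t *: v) + (1 - t) *: v = x + v.
  by rewrite -addrA -scalerDl [t + _]addrC subrK scale1r.
have E2 : (x + t *: v) - t *: v = x by rewrite addrK.
have := @grad_up (x + t *: v) ((1 - t) *: v) cp; rewrite E1 => /(_ cxv).
have h1 : vle 0 ((1 - t) *: v) by move=> i; rewrite !mxE; have := vi i; nra.
have := @grad_down (x + t *: v) (t *: v) cp; rewrite E2 => /(_ cx).
have h2 : vle 0 (t *: v) by move=> i; rewrite !mxE; have := vi i; nra.
move=> /(_ h2) + /(_ h1); rewrite !dotZr; nra.
Qed.

(** [grad_down] at the upper endpoint bounds the gain below by the tangent there, and the Lipschitz
    gradient moves that tangent to [x]. Avoiding an integral costs a factor: [L] instead of
    [L / 2]. *)
Lemma smooth_up x v : cube x -> cube (x + v) -> vle 0 v ->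
  dot (G x) v - L * norm2 v ^+ 2 <= F (x + v) - F x.
Proof.
move=> cx cxv v0.
have h : F x - F (x + v) <= - dot (G (x + v)) v.
  by have := @grad_down (x + v) v cxv; rewrite addrK; apply.
have [L0 hL] := G_smooth.
have := hL _ _ cxv cx; rewrite [x + v - x]addrC addKr => h1.
have := dot_ge (G (x + v) - G x) v; rewrite dotBl.
have := norm2_ge0 v; have := norm2_ge0 (G (x + v) - G x); nra.
Qed.

(* The displacement is split into its positive and its negative part. *)
Lemma smooth_step x y : cube x -> cube y ->
  dot (G x) (y - x) - 2 * L * norm2 (y - x) ^+ 2 <= F y - F x.
Proof.
move=> cx cy; set v := y - x.
pose p : 'rV[R]_n := \row_j (if 0 <= v 0 j then v 0 j else 0).
pose q : 'rV[R]_n := \row_j (if 0 <= v 0 j then 0 else - v 0 j).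
have pq : p - q = v by apply/rowP => j; rewrite !mxE; case: ifP => _; ring.
have vE j : v 0 j = y 0 j - x 0 j by rewrite !mxE.
have cp : cube (x + p).
  by move=> j; have := cx j; have := cy j; rewrite 2!mxE vE; case: ifP => ?; lra.
have p0 : vle 0 p by move=> j; rewrite 2!mxE; case: ifP.
have q0 : vle 0 q.
  by move=> j; rewrite 2!mxE; case: ifPn => //; rewrite -ltNge => /ltW; rewrite oppr_ge0.
have np : norm2 p <= norm2 v.
  by apply: norm2_le => i; rewrite mxE; case: ifP; rewrite ?normr0.
have nq : norm2 q <= norm2 v.
  by apply: norm2_le => i; rewrite mxE; case: ifP; rewrite ?normr0 ?normrN.
have Ey : y = (x + p) - q by rewrite -addrA pq /v addrC subrK.
have Ey' : y + q = x + p by rewrite Ey subrK.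
have h1 := smooth_up cx cp p0.
have h2 : F (y + q) - F y <= dot (G y) q by apply: grad_up => //; rewrite Ey'.
rewrite Ey' in h2.
have [L0 hL] := G_smooth.
have h3 := hL _ _ cy cx; rewrite -/v in h3.
have := dot_le (G y - G x) q; rewrite dotBl => h4.
have -> : dot (G x) v = dot (G x) p - dot (G x) q by rewrite -pq dotBr.
have := norm2_ge0 p; have := norm2_ge0 q; have := norm2_ge0 v.
have := norm2_ge0 (G y - G x) => g0 nv nq0 np0.
have h5 : norm2 (G y - G x) * norm2 q <= L * norm2 v * norm2 v.
  by apply: ler_pM => //; rewrite (le_trans h3).
have h6 : norm2 p ^+ 2 <= norm2 v ^+ 2 by rewrite lerXn2r ?nnegrE.
nra.
Qed.

End Submodular.

(** * Estimates on probabilistic sums and products, and existence of a maximizer *)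

Section Bounds.
Context {R : realType} {n : nat}.
Variables (F : 'rV[R]_n -> R) (G : 'rV[R]_n -> 'rV[R]_n) (L : R).
Hypothesis F_ge0 : forall x, cube x -> 0 <= F x.
Hypothesis F_dr : dr_submodular F.
Hypothesis F_grad : gradient_on_cube F G.
Hypothesis G_smooth : smooth L G.
Implicit Types (x y u v w z o : 'rV[R]_n).

Lemma cube0 : cube (0 : 'rV[R]_n).
Proof. by move=> i; rewrite mxE lexx ler01. Qed.

Lemma cube_vadd x y : cube x -> cube y -> cube (vadd x y).
Proof. by move=> cx cy i; rewrite mxE; have := cx i; have := cy i; nra. Qed.

Lemma cube_vmul x y : cube x -> cube y -> cube (vmul x y).
Proof. by move=> cx cy i; rewrite mxE; have := cx i; have := cy i; nra. Qed.

Lemma vaddC x y : vadd x y = vadd y x.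
Proof. by apply/rowP => i; rewrite !mxE; ring. Qed.

(** The direction [o - z] is [u - v] with [z + u = vadd z o] and [z - v = vmul z o]. Both are
    monotone moves from [z], so the two tangent bounds apply separately and add up. *)
Lemma local_opt_bound z o (g : R) : cube z -> cube o -> dot (G z) (o - z) <= g ->
  F (vadd z o) + F (vmul z o) <= 2 * F z + g.
Proof.
move=> cz co hg.
pose u : 'rV[R]_n := \row_j (o 0 j * (1 - z 0 j)).
pose v : 'rV[R]_n := \row_j (z 0 j * (1 - o 0 j)).
have Eu : vadd z o = z + u by apply/rowP => j; rewrite !mxE; ring.
have Ev : vmul z o = z - v by apply/rowP => j; rewrite !mxE; ring.
have Eo : o - z = u - v by apply/rowP => j; rewrite !mxE; ring.
have u0 : vle 0 u by move=> j; rewrite !mxE; have := cz j; have := co j; nra.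
have v0 : vle 0 v by move=> j; rewrite !mxE; have := cz j; have := co j; nra.
have h1 : F (z + u) - F z <= dot (G z) u.
  by apply: grad_up => //; rewrite -Eu; exact: cube_vadd.
have h2 : F (z - v) - F z <= - dot (G z) v.
  by apply: grad_down => //; rewrite -Ev; exact: cube_vmul.
by move: hg; rewrite Eu Ev Eo dotBr; lra.
Qed.

(** [vadd x y] lies the fraction [m] of the way from [x] to [x + v], where [v] is [y / m] scaled to
    the room left by [x]; concavity and [F (x + v) >= 0] finish. The case [m = 0] is apart because
    of the division. *)
Lemma vadd_lower x y (m : R) : cube x -> 0 <= m <= 1 ->
  (forall i, 0 <= y 0 i <= m) -> (1 - m) * F x <= F (vadd x y).
Proof.
move=> cx /andP[m0 m1] hy.
have [m00|mn0] := eqVneq m 0.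
  have -> : vadd x y = x.
    apply/rowP => i; rewrite mxE; have := hy i; rewrite m00 => h.
    have -> : y 0 i = 0 by apply: le_anti; rewrite andbC.
    by ring.
  by rewrite m00 subr0 mul1r.
have mp : 0 < m by rewrite lt_neqAle eq_sym mn0.
pose v : 'rV[R]_n := \row_j (y 0 j / m * (1 - x 0 j)).
have yi i : 0 <= y 0 i / m <= 1.
  have /andP[a b] := hy i; rewrite divr_ge0 ?(ltW mp) //=.
  by rewrite ler_pdivrMr // mul1r.
have Ev : vadd x y = x + m *: v.
  by apply/rowP => j; rewrite !mxE; field; exact: mn0.
have v0 : vle 0 v by move=> j; rewrite !mxE; have := cx j; have := yi j; nra.
have cxv : cube (x + v) by move=> j; rewrite !mxE; have := cx j; have := yi j; nra.
have := concave_up F_dr F_grad cx cxv v0 (t := m); rewrite m0 m1 => /(_ isT).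
by rewrite Ev; have := F_ge0 cxv; nra.
Qed.

(* Feldman-style bound: [y] avoids [z], so [o + v] and [vadd o z] are almost disjoint
   above [o]. *)
Lemma avoid_lower o y z (m : R) : cube o -> cube z -> 0 <= m <= 1 ->
  (forall i, 0 <= y 0 i <= m * (1 - z 0 i)) ->
  F o - m * F (vadd o z) <= F (vadd o y).
Proof.
move=> co cz /andP[m0 m1] hy.
have [m00|mn0] := eqVneq m 0.
  have -> : vadd o y = o.
    apply/rowP => i; rewrite mxE; have := hy i; rewrite m00 mul0r => h.
    have -> : y 0 i = 0 by apply: le_anti; rewrite andbC.
    by ring.
  by rewrite m00 mul0r subr0.
have mp : 0 < m by rewrite lt_neqAle eq_sym mn0.
pose v : 'rV[R]_n := \row_j (y 0 j / m * (1 - o 0 j)).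
have yi i : 0 <= y 0 i / m <= 1 - z 0 i.
  have /andP[a b] := hy i; rewrite divr_ge0 ?(ltW mp) //=.
  by rewrite ler_pdivrMr // mulrC.
have Ev : vadd o y = o + m *: v.
  by apply/rowP => j; rewrite !mxE; field; exact: mn0.
have v0 : vle 0 v by move=> j; rewrite !mxE; have := co j; have := yi j; nra.
have cov : cube (o + v).
  by move=> j; rewrite !mxE; have := co j; have := yi j; have := cz j; nra.
have cq : cube (vadd o z + v).
  by move=> j; rewrite !mxE; have := co j; have := yi j; have := cz j; nra.
have oq : vle o (vadd o z) by move=> j; rewrite !mxE; have := co j; have := cz j; nra.
have := concave_up F_dr F_grad co cov v0 (t := m); rewrite m0 m1 => /(_ isT).
have := dr_increment F_dr co cq oq v0; have := F_ge0 cq.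
rewrite Ev; nra.
Qed.

(** Adding [vmul z o] back gains at most what it gains at [0], hence at most [F (vmul z o)]. *)
Lemma remove_lower o y z : cube o -> cube y -> cube z ->
  F (vadd o y) - F (vmul z o) <= F (vadd o y - vmul z o).
Proof.
move=> co cy cz.
have d0 : vle 0 (vmul z o) by move=> j; rewrite !mxE; have := co j; have := cz j; nra.
have cd : cube (vadd o y - vmul z o).
  move=> j; rewrite !mxE; have := co j; have := cz j; have := cy j.
  by set a := o 0 j; set b := z 0 j; set c := y 0 j; nra.
have h0 : vle 0 (vadd o y - vmul z o) by move=> j; have := cd j; rewrite [in X in _ -> X]mxE => /andP[].
have := dr_increment F_dr cube0 (y := vadd o y - vmul z o) (v := vmul z o).
rewrite subrK add0r => /(_ (cube_vadd co cy) h0 d0).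
have := F_ge0 cube0; lra.
Qed.

(** The new join is [vadd o y + h *: v], on the segment from [vadd o y] to [vadd (vadd o x) y].
    Concavity applies there, and [vadd_lower] removes [y] from the far end at the factor [1 - m]. *)
Lemma join_step o y x (h m : R) : cube o -> cube y -> cube x -> 0 <= h <= 1 ->
  0 <= m <= 1 -> (forall i, y 0 i <= m) ->
  (1 - h) * F (vadd o y) + h * ((1 - m) * F (vadd o x)) <=
    F (vadd o (\row_j (y 0 j + h * (x 0 j * (1 - y 0 j))))).
Proof.
move=> co cy cx /andP[h0 h1] m01 ym.
pose v : 'rV[R]_n := \row_j (x 0 j * (1 - y 0 j) * (1 - o 0 j)).
have Ev : vadd o (\row_j (y 0 j + h * (x 0 j * (1 - y 0 j)))) = vadd o y + h *: v.
  by apply/rowP => j; rewrite !mxE; ring.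
have Ex : vadd o y + v = vadd (vadd o x) y by apply/rowP => j; rewrite !mxE; ring.
have v0 : vle 0 v.
  move=> j; rewrite !mxE; have /andP[a1 a2] := co j; have /andP[b1 b2] := cx j.
  by have /andP[c1 c2] := cy j; rewrite !mulr_ge0 // subr_ge0.
have cv : cube (vadd o y + v) by rewrite Ex; do 2 apply: cube_vadd => //.
have := concave_up F_dr F_grad (cube_vadd co cy) cv v0 (t := h); rewrite h0 h1 => /(_ isT).
have : (1 - m) * F (vadd o x) <= F (vadd o y + v).
  rewrite Ex; apply: vadd_lower => //; first exact: cube_vadd.
  by move=> i; rewrite ym andbT; have /andP[] := cy i.
rewrite Ev; nra.
Qed.

Lemma gain_step y d (h : R) (D : R) : cube y -> 0 <= h <= 1 -> vle 0 d ->
  cube (y + d) -> norm2 d <= D ->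
  F y + h * dot (G y) d - L * h ^+ 2 * D ^+ 2 <= F (y + h *: d).
Proof.
move=> cy /andP[h0 h1] d0 cyd dD.
have c1 : cube (y + h *: d).
  apply: (cube_between cy cyd) => i; have := d0 i; rewrite !mxE; nra.
have d1 : vle 0 (h *: d) by move=> i; have := d0 i; rewrite !mxE; nra.
have := smooth_up F_dr F_grad G_smooth cy c1 d1.
rewrite dotZr norm2Z ger0_norm // exprMn.
have [L0 _] := G_smooth.
have h2 : norm2 d ^+ 2 <= D ^+ 2 by rewrite lerXn2r // ?nnegrE ?norm2_ge0 // (le_trans _ dD) // norm2_ge0.
have : L * (h ^+ 2 * norm2 d ^+ 2) <= L * h ^+ 2 * D ^+ 2.
  by rewrite -mulrA ler_wpM2l // ler_wpM2l // sqr_ge0.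
lra.
Qed.

(** [c] is 1 while [z] is avoided and 0 afterwards. Masking the gradient amounts to masking [o], and
    the masked move takes [y] exactly to [vadd o y - c *: vmul z o]. *)
Lemma gain_lower y o z (c : R) : cube y -> cube o -> cube z -> (c = 0 \/ c = 1) ->
  (forall i, c * z 0 i + y 0 i <= 1) ->
  F (vadd o y) - c * F (vmul z o) - F y <=
    dot (\row_j (G y 0 j * (1 - y 0 j - c * z 0 j))) o.
Proof.
move=> cy co cz hc hz.
pose m : 'rV[R]_n := \row_j (1 - y 0 j - c * z 0 j).
have -> : \row_j (G y 0 j * (1 - y 0 j - c * z 0 j)) = vmul (G y) m.
  by apply/rowP => j; rewrite !mxE.
rewrite -dot_vmul.
have v0 : vle 0 (vmul m o).
  by move=> j; rewrite !mxE; have := co j; have := hz j; nra.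
have E : y + vmul m o = vadd o y - c *: vmul z o by apply/rowP => j; rewrite !mxE; ring.
have cyv : cube (y + vmul m o).
  move=> j; have := co j; have := hz j; have := cy j; have := cz j.
  by rewrite !mxE; case: hc => ->; nra.
have := grad_up F_dr F_grad cy cyv v0; rewrite {1}E.
case: hc => ->; first by rewrite scale0r subr0 mul0r subr0; lra.
by rewrite scale1r mul1r; have := remove_lower co cy cz; lra.
Qed.

Lemma coord_le_mx_norm v j : `|v 0 j| <= `|v|.
Proof.
by rewrite [leRHS]/Num.norm /= mx_normrE; apply/bigmax_geP; right => /=; exists (0, j).
Qed.

(** Serves the extreme value theorem in [maximizer_exists], which produces the optimum that the
    theorem compares with. *)
Lemma F_continuous : {within cube, continuous F}.
Proof.
apply/subspace_continuousP => x cx.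
apply/cvgrPdist_lt => e e0.
have [d d0 hd] := F_grad cx (ltr01).
pose M : R := norm2 (G x) + 1.
have M0 : 0 < M by rewrite /M ltr_wpDl ?norm2_ge0.
(* A crude factor between [norm2] and the sup norm, positive also for [n = 0]. *)
pose c : R := n.+1%:R.
have c0 : 0 < c by rewrite ltr0Sn.
pose r := Num.min d (e / (M * 2)) / c.
have r0 : 0 < r by rewrite /r divr_gt0 // lt_min d0 divr_gt0 // mulr_gt0.
have Hr : \forall y \near x, `|x - y| < r.
  by have := nbhsx_ballx x r r0; rewrite mx_norm_ball.
rewrite near_withinE; near=> y => cy.
have yr : `|x - y| < r by near: y; exact: Hr.
have nyr : norm2 (y - x) < Num.min d (e / (M * 2)).
  have : norm2 (y - x) <= c * `|x - y|.
    rewrite -[leRHS]ger0_norm ?mulr_ge0 ?(ltW c0) // -sqrtr_sqr; apply: ler_wsqrtr.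
    have hi (i : 'I_n) : (y - x) 0 i ^+ 2 <= `|x - y| ^+ 2.
      rewrite -[leLHS]real_normK ?num_real // lerXn2r ?nnegrE //.
      by rewrite distrC; exact: coord_le_mx_norm.
    apply: le_trans (_ : \sum_(i < n) `|x - y| ^+ 2 <= _); first exact: ler_sum.
    rewrite sumr_const card_ord exprMn -[leLHS]mulr_natl ler_wpM2r ?sqr_ge0 //.
    by rewrite /c -natrX ler_nat; nia.
  move=> h; apply: (le_lt_trans h); rewrite mulrC -ltr_pdivlMr //.
have [nd ne] : norm2 (y - x) < d /\ norm2 (y - x) < e / (M * 2).
  by move: nyr; rewrite lt_min => /andP.
have := hd y cy nd; rewrite mul1r => h.
have h2 := dot_le (G x) (y - x); have h3 := dot_ge (G x) (y - x).
have h4 : M * norm2 (y - x) < e.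
  move: ne; rewrite ltr_pdivlMr ?mulr_gt0 // => ne.
  by have := norm2_ge0 (y - x); nra.
rewrite distrC; apply: le_lt_trans h4.
move: h h2 h3; rewrite !ler_norml /M mulrDl mul1r.
set a := norm2 (G x) * _; set b := norm2 _; set p := dot _ _.
by move=> /andP[ha hb] h2 h3; rewrite /from_subspace; apply/andP; split; lra.
Unshelve. all: by end_near. Qed.

Lemma maximizer_exists (P : set 'rV[R]_n) : P `<=` cube -> P !=set0 -> compact P ->
  exists o, maximizer F P o.
Proof.
move=> Pc P0 cP.
have [|o oP ho] := EVT_max_rV P0 cP (f := F).
  exact: continuous_subspaceW F_continuous.
exists o; split; first by rewrite inE in oP.
by move=> y Py; apply: ho; rewrite inE.
Qed.

End Bounds.

(** * Double greedy on a box *)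

Section CoordinateStep.
Context {R : realType}.
Variables (f g p : R -> R) (c e : R).
Hypothesis f_conc : forall s t a, 0 <= s <= c -> 0 <= t <= c -> 0 <= a <= 1 ->
  a * f s + (1 - a) * f t <= f (a * s + (1 - a) * t).
Hypothesis g_conc : forall s t a, 0 <= s <= c -> 0 <= t <= c -> 0 <= a <= 1 ->
  a * g s + (1 - a) * g t <= g (a * s + (1 - a) * t).
Hypothesis incr : forall s t, 0 <= s -> s <= t -> t <= c ->
  g t - g s <= p t - p s <= f t - f s.

(* Weighting the two approximate maximizers by their gains makes both potential losses of
   [p] equal to [da * db / (da + db)]. *)
Lemma double_greedy_coordinate (ta tb q r : R) :
  0 <= ta <= c -> 0 <= tb <= c -> 0 <= q <= c -> 0 <= r -> 0 <= e ->
  f 0 <= f ta -> f c <= f ta -> f tb <= f ta ->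
  (forall s, 0 <= s <= c -> f s <= f ta + e) ->
  g c <= g tb -> g ta <= g tb ->
  (forall s, 0 <= s <= c -> g s <= g tb + e) ->
  let da := f ta - f 0 in let db := g tb - g c in
  let t := (da * ta + db * tb) / (da + db) in
  0 <= t <= c /\
  f 0 + r ^+ 2 * g c + 2 * r * p q <= f t + r ^+ 2 * g t + 2 * r * p t + 2 * r * e.
Proof.
move=> hta htb hq r0 e0 f0 fc fab fe gc gab ge da db t.
have c0 : 0 <= c by lra.
have da0 : 0 <= da by rewrite subr_ge0.
have db0 : 0 <= db by rewrite subr_ge0.
(* If [tb <= ta], concavity between [0] and [ta] keeps [f tb] above [f 0]; otherwise the gain of [g]
   from [ta] to [tb] passes to [f] by [incr]. The next claim is the mirror image. *)
have ftb : f 0 <= f tb.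
  have [h|h] := lerP tb ta; last by have := incr (s := ta) (t := tb); rewrite (ltW h); lra.
  have [ta0|tan] := eqVneq ta 0; first by have -> : tb = 0; [apply: le_anti; lra|].
  have tap : 0 < ta by rewrite lt_neqAle eq_sym tan; lra.
  have hr : 0 <= tb / ta <= 1 by rewrite divr_ge0 ?ler_pdivrMr //= ?mul1r //; lra.
  have := @f_conc ta 0 (tb / ta) hta; rewrite lexx c0 => /(_ isT hr).
  by rewrite mulr0 addr0 divfK //; move: hr; set a := tb / ta; nra.
have gta : g c <= g ta.
  have [h|h] := lerP tb ta; last by have := incr (s := ta) (t := tb); rewrite (ltW h); lra.
  have [tac|tan] := eqVneq tb c; first by have -> : ta = c; [apply: le_anti; lra|].
  have tap : 0 < c - tb by rewrite subr_gt0 lt_neqAle tan; lra.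
  have hr : 0 <= (ta - tb) / (c - tb) <= 1.
    by rewrite divr_ge0 ?ler_pdivrMr //= ?mul1r //; lra.
  have hc : 0 <= c <= c by rewrite c0 lexx.
  have := @g_conc c tb _ hc htb hr.
  have -> : (ta - tb) / (c - tb) * c + (1 - (ta - tb) / (c - tb)) * tb = ta.
    by field; exact: lt0r_neq0.
  by move: hr; set a := _ / _; nra.
(* Here division by zero makes [t = 0]. Both gains vanish, so [f] never exceeds [f 0 + e], and by
   [incr] neither does [p] exceed [p 0 + e]. *)
have [s0|sn] := eqVneq (da + db) 0.
  have t0 : t = 0 by rewrite /t s0 invr0 mulr0.
  have da' : da = 0 by apply: le_anti; lra.
  have h1 := incr (s := 0) (t := c); rewrite lexx in h1.
  have h2 := incr (s := 0) (t := q); rewrite lexx in h2.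
  have h3 := fe q hq.
  rewrite t0 lexx c0; split=> //; rewrite /da in da'.
  have h4 : g c <= g 0 by lra.
  have h5 : p q - p 0 <= e by lra.
  by have := sqr_ge0 r; nra.
have sp : 0 < da + db by rewrite lt_neqAle eq_sym sn; lra.
pose a := da / (da + db).
have ha : 0 <= a <= 1 by rewrite divr_ge0 ?ler_pdivrMr //= ?mul1r //; lra.
have tE : t = a * ta + (1 - a) * tb by rewrite /t /a; field.
have aE1 : (1 - a) * da = da * db / (da + db) by rewrite /a; field.
have aE2 : a * db = da * db / (da + db) by rewrite /a; field.
(* The gains of [f] and [g] minus the loss of [p], with weights [1], [r ^+ 2] and [2 * r], form a
   perfect square. *)
have aE3 : a * da + r ^+ 2 * ((1 - a) * db) - 2 * r * (da * db / (da + db)) =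
   (da - r * db) ^+ 2 / (da + db) by rewrite /a; field.
have ht : 0 <= t <= c by rewrite tE; apply/andP; split; nra.
have gain : 0 <= (da - r * db) ^+ 2 / (da + db) by rewrite divr_ge0 ?sqr_ge0 // ltW.
split=> //.
have hf := f_conc hta htb ha; rewrite -tE in hf.
have hg := g_conc hta htb ha; rewrite -tE in hg.
set w := da * db / (da + db) in aE1 aE2 aE3.
(* If [q] is above [t], the loss of [p] is charged to [f], otherwise to [g]; both deficits are at
   most [w], up to [e]. *)
have hp : p q - p t <= w + e.
  have [tq|qt] := lerP t q.
    have := incr (s := t) (t := q); have := fe q hq; rewrite -aE1 /da; nra.
  have := incr (s := q) (t := t); rewrite (ltW qt); have := ge q hq; rewrite -aE2 /db; nra.
have h1 : f 0 + a * da <= f t by rewrite /da; nra.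
have h2 : g c + (1 - a) * db <= g t by rewrite /db; nra.
have := sqr_ge0 r.
have h3 : r ^+ 2 * (g c + (1 - a) * db) <= r ^+ 2 * g t by rewrite ler_wpM2l ?sqr_ge0.
have h4 : 2 * r * (p q - p t) <= 2 * r * (w + e) by rewrite ler_wpM2l // mulr_ge0.
lra.
Qed.

End CoordinateStep.

Section DoubleGreedy.
Context {R : realType} {n : nat}.
Variables (F : 'rV[R]_n -> R) (G : 'rV[R]_n -> 'rV[R]_n) (L : R).
Hypothesis F_ge0 : forall x, cube x -> 0 <= F x.
Hypothesis F_dr : dr_submodular F.
Hypothesis F_grad : gradient_on_cube F G.
Hypothesis G_smooth : smooth L G.
Implicit Types (x y u v w z o : 'rV[R]_n).

Lemma upd_shift x k (s t : R) : upd x k t = upd x k s + (t - s) *: delta_mx 0 k.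
Proof. by apply/rowP => j; rewrite !mxE eqxx; case: eqVneq => ? /=; ring. Qed.

Lemma cube_upd x k (t : R) : cube x -> 0 <= t <= 1 -> cube (upd x k t).
Proof. by move=> cx ht j; rewrite mxE; case: ifP. Qed.

Lemma norm2_delta (k : 'I_n) : norm2 (delta_mx 0 k : 'rV[R]_n) = 1.
Proof.
rewrite /norm2 (bigD1 k) //= big1 => [|i ik]; rewrite !mxE !eqxx ?expr1n ?addr0 ?sqrtr1 //.
by rewrite (negbTE ik) expr0n.
Qed.

Lemma line_concave x k (c s t a : R) : cube x -> c <= 1 ->
  0 <= s <= c -> 0 <= t <= c -> 0 <= a <= 1 ->
  a * F (upd x k s) + (1 - a) * F (upd x k t) <= F (upd x k (a * s + (1 - a) * t)).
Proof.
move=> cx c1.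
have main (s' t' a' : R) : 0 <= s' <= c -> 0 <= t' <= c -> 0 <= a' <= 1 -> s' <= t' ->
  a' * F (upd x k s') + (1 - a') * F (upd x k t') <= F (upd x k (a' * s' + (1 - a') * t')).
  move=> hs ht ha st.
  have c2 : cube (upd x k s' + (t' - s') *: delta_mx 0 k).
    by rewrite -upd_shift; apply: cube_upd => //; lra.
  have h1 : vle 0 ((t' - s') *: delta_mx 0 k : 'rV[R]_n).
    by move=> j; rewrite !mxE eqxx mulr_ge0 ?ler0n ?subr_ge0.
  have c3 : cube (upd x k s') by apply: cube_upd => //; lra.
  have := concave_up F_dr F_grad c3 c2 h1 (t := 1 - a').
  rewrite scalerA -upd_shift.
  have -> : (1 - a') * (t' - s') = (a' * s' + (1 - a') * t') - s' by ring.
  rewrite -upd_shift; lra.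
move=> hs ht ha; have [st|ts] := lerP s t; first exact: main.
have := main t s (1 - a) ht hs _ (ltW ts).
have -> : 1 - (1 - a) = a by ring.
rewrite [_ * t + _]addrC [_ * F _ + _]addrC; apply; lra.
Qed.

Lemma line_incr x y k (s t : R) : cube x -> cube y -> vle x y -> 0 <= s -> s <= t -> t <= 1 ->
  F (upd y k t) - F (upd y k s) <= F (upd x k t) - F (upd x k s).
Proof.
move=> cx cy xy s0 st t1; rewrite !(upd_shift _ k s t).
apply: F_dr; try (apply: cube_upd => //; lra).
  by move=> j; rewrite !mxE; case: ifP.
by rewrite mxE eqxx; lra.
Qed.

(* Between two grid points at which the slope changes sign, the slope is at most [L] times
   the grid spacing. *)
Lemma grid_max x k (c M : R) (T : nat) : cube x -> 0 <= c <= 1 -> (0 < T)%N ->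
  (forall i, (i <= T)%N -> F (upd x k (c * i%:R / T%:R)) <= M) ->
  forall s, 0 <= s <= c -> F (upd x k s) <= M + L * (c / T%:R) ^+ 2.
Proof.
move=> cx c01 T0 hM s hs.
have [L0 hL] := G_smooth.
have Tp : 0 < T%:R :> R by rewrite ltr0n.
have e0 : 0 <= L * (c / T%:R) ^+ 2 by rewrite mulr_ge0 ?sqr_ge0.
have [->|sc] := eqVneq s c.
  by have := hM T (leqnn _); rewrite mulfK ?gt_eqF //; lra.
have sltc : s < c by rewrite lt_neqAle sc; lra.
have cp : 0 < c by lra.
pose i := Num.truncn (s * T%:R / c).
have q0 : 0 <= s * T%:R / c by rewrite divr_ge0 ?mulr_ge0 //; lra.
have /andP[i1 i2] := truncn_itv q0; rewrite -/i in i1 i2.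
have p1 : c * i%:R / T%:R <= s.
  by rewrite ler_pdivrMr // mulrC -ler_pdivlMr.
have p2 : s < c * i.+1%:R / T%:R.
  by rewrite ltr_pdivlMr // [ltRHS]mulrC -ltr_pdivrMr.
have iT : (i < T)%N.
  rewrite -(ltr_nat R); apply: (le_lt_trans i1).
  by rewrite ltr_pdivrMr // mulrC ltr_pM2l.
have M1 := hM i (ltnW iT); have M2 := hM i.+1 iT.
set p := c * i%:R / T%:R in p1 M1; set p' := c * i.+1%:R / T%:R in p2 M2.
have pp : p' - p = c / T%:R by rewrite /p /p' -[i.+1]addn1 natrD; field; rewrite gt_eqF.
have p0 : 0 <= p by rewrite /p divr_ge0 ?mulr_ge0 ?ler0n //; lra.
have p'c : p' <= c.
  by rewrite /p' ler_pdivrMr // ler_wpM2l ?ler_nat //; lra.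
have ca : cube (upd x k p) by apply: cube_upd => //; lra.
have cb : cube (upd x k p') by apply: cube_upd => //; lra.
have cs : cube (upd x k s) by apply: cube_upd => //; lra.
have dpos (a : R) : 0 <= a -> vle 0 (a *: delta_mx 0 k : 'rV[R]_n).
  by move=> a0 j; rewrite !mxE eqxx mulr_ge0 ?ler0n.
have h1 : F (upd x k s) - F (upd x k p) <= (s - p) * dot (G (upd x k p)) (delta_mx 0 k).
  rewrite (upd_shift x k p s) -dotZr; apply: grad_up => //; first by rewrite -upd_shift.
  by apply: dpos; rewrite subr_ge0.
have E2 : upd x k s = upd x k p' - (p' - s) *: delta_mx 0 k.
  by rewrite -scaleNr opprB -upd_shift.
have h2 : F (upd x k s) - F (upd x k p') <= - ((p' - s) * dot (G (upd x k p')) (delta_mx 0 k)).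
  rewrite E2 -dotZr; apply: grad_down => //; first by rewrite -E2.
  by apply: dpos; lra.
have h3 : dot (G (upd x k p)) (delta_mx 0 k) - dot (G (upd x k p')) (delta_mx 0 k) <= L * (c / T%:R).
  rewrite -dotBl; apply: le_trans (dot_le _ _) _; rewrite norm2_delta mulr1.
  apply: le_trans (hL _ _ ca cb) _; rewrite (upd_shift x k p' p) addrC addKr norm2Z norm2_delta mulr1.
  by rewrite ler_wpM2l // distrC pp ger0_norm // divr_ge0 //; lra.
move: h1 h2 h3; set a := dot _ _; set b := dot _ _ => h1 h2 h3.
(* If the slope is nonpositive at the left grid point or nonnegative at the right one, that grid
   value dominates. Otherwise [a > 0 > b] differ by at most [L * (c / T%:R)], which then bounds
   [a]. *)
have [a0|a0] := lerP a 0; first by nra.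
have [b0|b0] := lerP 0 b; first by nra.
have h4 : a * (s - p) <= (L * (c / T%:R)) * (c / T%:R).
  by apply: ler_pM; lra.
by rewrite expr2 mulrA; lra.
Qed.

(* State of the double greedy procedure in the box [[0, z]] once the first [k] coordinates
   are settled; the last vector interpolates between them and the comparison point [o]. *)
Definition settled (k : nat) x z : 'rV[R]_n := \row_j (if (j < k)%N then x 0 j else z 0 j).

Definition double_greedy_state z (k : nat) x y :=
  (forall j : 'I_n, 0 <= x 0 j <= z 0 j) /\ (x = settled k x 0) /\ (y = settled k x z).

Lemma double_greedy_init z : cube z -> double_greedy_state z 0 0 z.
Proof.
move=> cz; split; first by move=> j; rewrite mxE lexx; have /andP[] := cz j.
by split; apply/rowP => j; rewrite !mxE.
Qed.

(** No step of the procedure depends on [r], so one run satisfies the bound for every [r >= 0]. At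
    the end the three points coincide and the weights sum to [(1 + r) ^+ 2]. *)
Definition double_greedy_potential (r : R) z o (k : nat) x y :=
  F x + r ^+ 2 * F y + 2 * r * F (settled k x (vmul z o)).

Lemma double_greedy_step z o x y (k : 'I_n) (T : nat) (ta tb r : R) :
  cube z -> cube o -> (0 < T)%N -> 0 <= r ->
  double_greedy_state z k x y ->
  (exists2 i, (i <= T)%N & ta = z 0 k * i%:R / T%:R) ->
  (exists2 i, (i <= T)%N & tb = z 0 k * i%:R / T%:R) ->
  (forall i, (i <= T)%N -> F (upd x k (z 0 k * i%:R / T%:R)) <= F (upd x k ta)) ->
  (forall i, (i <= T)%N -> F (upd y k (z 0 k * i%:R / T%:R)) <= F (upd y k tb)) ->
  let da := F (upd x k ta) - F x in let db := F (upd y k tb) - F y in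
  let t := (da * ta + db * tb) / (da + db) in
  double_greedy_state z k.+1 (upd x k t) (upd y k t) /\
  double_greedy_potential r z o k x y <=
    double_greedy_potential r z o k.+1 (upd x k t) (upd y k t) +
      2 * r * (L * (z 0 k / T%:R) ^+ 2).
Proof.
move=> cz co T0 r0 [hx [xE yE]] [ia iaT taE] [ib ibT tbE] Ha Hb.
have [L0 _] := G_smooth.
have xk : x 0 k = 0 by rewrite xE !mxE ltnn.
have yk : y 0 k = z 0 k by rewrite yE !mxE ltnn.
have x0 : upd x k 0 = x by apply/rowP => j; rewrite mxE; case: eqVneq => // ->.
have yz : upd y k (z 0 k) = y by apply/rowP => j; rewrite mxE; case: eqVneq => // ->.
have cx : cube x by move=> j; have := hx j; have := cz j; lra.
have cy : cube y by rewrite yE => j; rewrite mxE; case: ifP.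
set w := settled k x (vmul z o).
have cw : cube w by move=> j; rewrite mxE; case: ifP => // _; apply: cube_vmul.
have xw : vle x w.
  move=> j; rewrite [in X in X <= _]xE !mxE; case: ifP => // _.
  by have := cz j; have := co j; nra.
have wy : vle w y.
  by move=> j; rewrite yE !mxE; case: ifP => // _; have := cz j; have := co j; nra.
pose q := z 0 k * o 0 k.
have wq : upd w k q = w.
  by apply/rowP => j; rewrite !mxE; case: eqVneq => // ->; rewrite ltnn.
have zk := cz k; have ok := co k.
have Tp : 0 < T%:R :> R by rewrite ltr0n.
have grid i : (i <= T)%N -> 0 <= z 0 k * i%:R / T%:R <= z 0 k.
  move=> iT; rewrite divr_ge0 ?mulr_ge0 ?ler0n //=; last by lra.
  by rewrite ler_pdivrMr // ler_wpM2l ?ler_nat //; lra.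
have hta : 0 <= ta <= z 0 k by rewrite taE grid.
have htb : 0 <= tb <= z 0 k by rewrite tbE grid.
have hq : 0 <= q <= z 0 k by rewrite /q; apply/andP; split; nra.
have e0 : 0 <= L * (z 0 k / T%:R) ^+ 2 by rewrite mulr_ge0 ?sqr_ge0.
have g0 : z 0 k * 0%:R / T%:R = 0 by rewrite mulr0 mul0r.
have gT : z 0 k * T%:R / T%:R = z 0 k by rewrite mulfK ?gt_eqF.
have f0 := Ha 0%N isT; rewrite g0 in f0.
have fT := Ha T (leqnn _); rewrite gT in fT.
have gg := Hb T (leqnn _); rewrite gT in gg.
have fb := Ha ib ibT; rewrite -tbE in fb.
have ga := Hb ia iaT; rewrite -taE in ga.
have z1 : z 0 k <= 1 by case/andP: zk.
have [|ht hp] := @double_greedy_coordinate R (fun t => F (upd x k t)) (fun t => F (upd y k t))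
  (fun t => F (upd w k t)) (z 0 k) (L * (z 0 k / T%:R) ^+ 2)
  (fun s t a => @line_concave x k _ s t a cx z1)
  (fun s t a => @line_concave y k _ s t a cy z1)
  _ ta tb q r hta htb hq r0 e0 f0 fT fb (grid_max cx zk T0 Ha) gg ga (grid_max cy zk T0 Hb).
  move=> s t s0 st tz; apply/andP; split; apply: line_incr => //; lra.
move: ht hp; rewrite /= x0 yz.
set t := _ / _ => ht hp.
split.
  split; first by move=> j; rewrite mxE; case: eqVneq => // ->.
  split; apply/rowP => j; rewrite !mxE ltnS leq_eqVlt -val_eqE; case: eqVneq => //= jk.
    by rewrite xE !mxE; case: ifP.
  by rewrite yE !mxE; case: ifP.
rewrite /double_greedy_potential -/w.
have -> : settled k.+1 (upd x k t) (vmul z o) = upd w k t.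
  by apply/rowP => j; rewrite !mxE ltnS leq_eqVlt -val_eqE; case: eqVneq.
by move: hp; rewrite wq.
Qed.

Lemma double_greedy_final z o x y (r : R) :
  double_greedy_state z n x y ->
  double_greedy_potential r z o n x y = (1 + r) ^+ 2 * F x.
Proof.
move=> [_ [_ yE]].
have sE v : settled n x v = x by apply/rowP => j; rewrite mxE ltn_ord.
by rewrite /double_greedy_potential yE !sE; ring.
Qed.

End DoubleGreedy.

(** * The constant 0.401 *)

Section Exponential.
Context {R : realType}.

(** Since [N > 0], every term after the one of index [N] is at most half its predecessor, so a
    partial sum plus twice the next term does not increase. *)
Lemma exp_partial (x : R) (N : nat) : 0 <= x <= 1 -> (0 < N)%N ->
  \sum_(0 <= k < N) x ^+ k / k`!%:R <= expR x <=
    \sum_(0 <= k < N) x ^+ k / k`!%:R + 2 * (x ^+ N / N`!%:R).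
Proof.
move=> /andP[x0 x1] N0; set S := \sum_(0 <= k < N) _.
have t0 k : 0 <= x ^+ k / k`!%:R by rewrite divr_ge0 ?exprn_ge0 ?ler0n.
have tS k : x ^+ k.+1 / k.+1`!%:R = x ^+ k / k`!%:R * (x / k.+1%:R).
  by rewrite exprSr factS mulnC natrM invfM mulrACA.
have mono M : (N <= M)%N ->
    S <= \sum_(0 <= k < M) x ^+ k / k`!%:R /\
    \sum_(0 <= k < M) x ^+ k / k`!%:R + 2 * (x ^+ M / M`!%:R) <=
      S + 2 * (x ^+ N / N`!%:R).
  elim: M => [|M IH]; first by rewrite leqn0 => /eqP NE; rewrite NE in N0.
  rewrite leq_eqVlt ltnS => /orP[/eqP <-|NM]; first by [].
  have [IH1 IH2] := IH NM; rewrite big_nat_recr //= tS.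
  have h : x / M.+1%:R <= 2^-1.
    rewrite ler_pdivrMr ?ltr0Sn //; apply: (le_trans x1).
    by rewrite ler_pdivlMl // mulr1 ler_nat ltnS (leq_trans N0).
  have := t0 M; move: h IH1 IH2; set a := \sum_(_ <= _ < _) _; set b := _ / M`!%:R.
  by set c := x / _ => hc h1 h2 h3; split; nra.
have cv := is_cvg_series_exp_coeff x.
apply/andP; split.
  by apply: limr_ge cv _; exists N => // M /mono[].
apply: limr_le cv _; exists N => // M /mono[_]; apply: le_trans.
by rewrite lerDl mulr_ge0.
Qed.

Lemma inv_enclose (u q a b c d : R) : 0 < u -> q * u = 1 -> c <= u -> u <= d ->
  0 <= a -> a * d <= 1 -> 0 <= b -> 1 <= b * c -> a <= q <= b.
Proof.
move=> u0 qu cu ud a0 ad b0 bc.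
apply/andP; split; rewrite -(ler_pM2r u0) qu.
  by apply: le_trans ad; rewrite ler_wpM2l.
by apply: (le_trans bc); rewrite ler_wpM2l.
Qed.

(** Both exponents used later, 19/30 and 1, are multiples of 1/30, so one sharp enclosure serves as
    a base. Decimals are written in groups of three digits: the lower bound reads 0.967216100. *)
Lemma expR_m30_bounds :
  967 / 1000 + 216 / (1000 * 1000) + 100 / (1000 * 1000 * 1000) <= expR (- (30%:R^-1 : R)) <=
  967 / 1000 + 216 / (1000 * 1000) + 101 / (1000 * 1000 * 1000).
Proof.
have hx : 0 <= (30%:R^-1 : R) <= 1 by lra.
have := @exp_partial _ 5 hx isT.
rewrite /= !big_nat_recr //= big_geq // !factS fact0 !muln1 add0r.
rewrite !exprS expr0 expRN => /andP[h1 h2].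
have u0 : 0 < expR (30%:R^-1 : R) by exact: expR_gt0.
have l0 : 1 + 33 / 1000 + 895 / (1000 * 1000) + 113 / (1000 * 1000 * 1000) <= expR (30%:R^-1) :> R by lra.
have l1 : expR (30%:R^-1) <= 1 + 33 / 1000 + 895 / (1000 * 1000) + 114 / (1000 * 1000 * 1000) :> R by lra.
by apply: (inv_enclose u0 _ l0 l1); [exact: mulVf (lt0r_neq0 u0)|clear; lra..].
Qed.

Lemma mul_enclose (a b c d x y l u : R) : 0 <= a -> 0 <= c ->
  a <= x <= b -> c <= y <= d -> l <= a * c -> b * d <= u -> l <= x * y <= u.
Proof. nra. Qed.

(** Powers of [q = expR (- 30%:R^-1)] by repeated squaring, each product being enclosed again
    between short decimals before it is reused. *)
Lemma expR_m19_m30_bounds :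
  (530 / 1000 + 819 / (1000 * 1000) <= expR (- (19 / 30) : R) <= 530 / 1000 + 820 / (1000 * 1000))
  /\ (367 / 1000 + 879 / (1000 * 1000) <= expR (- 1 : R) <= 367 / 1000 + 880 / (1000 * 1000)).
Proof.
have h1 := expR_m30_bounds; set q := expR _ in h1.
have h2 : 935 / 1000 + 506 / (1000 * 1000) + 984 / (1000 * 1000 * 1000) <= q * q <=
  935 / 1000 + 506 / (1000 * 1000) + 988 / (1000 * 1000 * 1000).
  by apply: (mul_enclose _ _ h1 h1); clear; lra.
have h3 : 904 / 1000 + 837 / (1000 * 1000) + 415 / (1000 * 1000 * 1000) <= q * q * q <=
  904 / 1000 + 837 / (1000 * 1000) + 423 / (1000 * 1000 * 1000).
  by apply: (mul_enclose _ _ h2 h1); clear; lra.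
have h4 : 875 / 1000 + 173 / (1000 * 1000) + 315 / (1000 * 1000 * 1000) <= q * q * (q * q) <=
  875 / 1000 + 173 / (1000 * 1000) + 328 / (1000 * 1000 * 1000).
  by apply: (mul_enclose _ _ h2 h2); clear; lra.
have h8 : 765 / 1000 + 928 / (1000 * 1000) + 330 / (1000 * 1000 * 1000) <=
    q * q * (q * q) * (q * q * (q * q)) <=
  765 / 1000 + 928 / (1000 * 1000) + 358 / (1000 * 1000 * 1000).
  by apply: (mul_enclose _ _ h4 h4); clear; lra.
have h16 : 586 / 1000 + 646 / (1000 * 1000) + 205 / (1000 * 1000 * 1000) <=
    q ^+ 16 <=
  586 / 1000 + 646 / (1000 * 1000) + 255 / (1000 * 1000 * 1000).
  rewrite (_ : q ^+ 16 = (q * q * (q * q) * (q * q * (q * q))) * (q * q * (q * q) * (q * q * (q * q)))); last by ring.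
  by apply: (mul_enclose _ _ h8 h8); clear; lra.
have h19 : 530 / 1000 + 819 / (1000 * 1000) + 430 / (1000 * 1000 * 1000) <=
    q ^+ 19 <=
  530 / 1000 + 819 / (1000 * 1000) + 500 / (1000 * 1000 * 1000).
  rewrite (_ : q ^+ 19 = q ^+ 16 * (q * q * q)); last by ring.
  by apply: (mul_enclose _ _ h16 h3); clear; lra.
have h11 : 693 / 1000 + 40 / (1000 * 1000) <= q ^+ 11 <= 693 / 1000 + 41 / (1000 * 1000).
  rewrite (_ : q ^+ 11 = (q * q * (q * q) * (q * q * (q * q))) * (q * q * q)); last by ring.
  by apply: (mul_enclose _ _ h8 h3); clear; lra.
have e19 : expR (- (19 / 30)) = q ^+ 19 by rewrite /q -expRM_natl; congr expR; clear; lra.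
have e30 : expR (- 1) = q ^+ 19 * q ^+ 11 by rewrite -exprD /q -expRM_natl; congr expR; clear; lra.
split; first by rewrite e19; move: h19; clear; set y := q ^+ 19; lra.
by rewrite e30; apply: (mul_enclose _ _ h19 h11); clear; lra.
Qed.

(** Above, [1 - h <= exp(-h)]. Below, [1 / (1 - h) = 1 + h / (1 - h) <= exp(h / (1 - h))]; the
    excess in the exponent after [k] factors is [k h * h / (1 - h)], at most [2 * h]. *)
Lemma pow_bounds (h : R) (k : nat) : 0 < h <= 2^-1 -> k%:R * h <= 1 ->
  expR (- (k%:R * h)) - 2 * h <= (1 - h) ^+ k <= expR (- (k%:R * h)).
Proof.
move=> /andP[h0 h2] kh.
have t0 : 0 < 1 - h by lra.
apply/andP; split; last first.
  rewrite -mulrN expRM_natl lerXn2r ?nnegrE ?expR_ge0 ?(ltW t0) //.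
  exact: expR_ge1Dx.
have low : expR (- (h / (1 - h))) <= 1 - h.
  rewrite expRN -[leRHS]invrK lef_pV2 ?posrE ?expR_gt0 ?invr_gt0 //.
  apply: le_trans (expR_ge1Dx _); rewrite le_eqVlt; apply/orP; left; apply/eqP.
  by field; rewrite gt_eqF.
apply: (@le_trans _ _ (expR (- (h / (1 - h))) ^+ k)); last first.
  by rewrite lerXn2r ?nnegrE ?expR_ge0 ?(ltW t0).
rewrite -expRM_natl.
have -> : k%:R * - (h / (1 - h)) = - (k%:R * h) + - (k%:R * h * (h / (1 - h))).
  by field; rewrite gt_eqF.
rewrite expRD.
have e1 : expR (- (k%:R * h)) <= 1 by rewrite expR_le1 oppr_le0 mulr_ge0 ?ler0n ?(ltW h0).
have e0 := expR_ge0 (- (k%:R * h)).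
have e2 := expR_ge1Dx (- (k%:R * h * (h / (1 - h)))).
have e3 : h / (1 - h) <= 2 * h by rewrite ler_pdivrMr //; nra.
have e4 : 0 <= h / (1 - h) by rewrite divr_ge0 ?(ltW h0) ?(ltW t0).
have e5 : 0 <= k%:R * h by rewrite mulr_ge0 ?ler0n ?(ltW h0).
have e6 : k%:R * h * (h / (1 - h)) <= 2 * h by nra.
nra.
Qed.

End Exponential.

Section RatioCombination.
Context {R : realType}.

(* Convex combination of the two bounds with weight [lambda = 0.19657] on the box
   candidate, at double greedy ratio [r = 11/5]; the two weights are chosen so that the
   coefficients of [a] and [b] are nonnegative. *)
Lemma ratio_combination (O a b Fz Fw Fy p A X eta eps h E al be : R) :
  0 <= O -> 0 <= a <= 2 * O -> 0 <= b -> 0 <= E -> 0 <= h <= eps ->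
  eps <= 1 / (1000 * 1000) ->
  530 / 1000 + 818 / (1000 * 1000) <= al <= 530 / 1000 + 820 / (1000 * 1000) ->
  367 / 1000 + 878 / (1000 * 1000) <= be <= 367 / 1000 + 880 / (1000 * 1000) ->
  (11 / 5) ^+ 2 * Fz + 2 * (11 / 5) * b <= (1 + 11 / 5) ^+ 2 * Fw + 2 * (11 / 5) * E ->
  a + b <= 2 * Fz + (eps * O + 2 * E) ->
  0 <= eta <= eps * O ->
  O - a - b - eta <= p -> a - eps * O - eta <= A ->
  al * O - (al - be) * a - al * eta <= al * X ->
  p * (al - be) + 11 / 30 * (be * A) + 19 / 30 * (al * X) +
    be * A * (361 / 1800 - 19 / 60 * h) <= Fy + E ->
  401 / 1000 * O - 10 * E <= Fw \/ 401 / 1000 * O - 10 * E <= Fy.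
Proof.
move=> O0 /andP[a0 a2] b0 E0 /andP[h0 he] e1 /andP[al1 al2] /andP[be1 be2].
move=> hw hz /andP[n0 eO] hp hA hX hy.
have eO1 : eps * O <= 1 / (1000 * 1000) * O by apply: ler_wpM2r.
have d0 : 0 <= al - be by move: al1 be2; clear; lra.
have d1 : al - be <= 1 by move: al2 be1; clear; lra.
have be0 : 0 <= be by move: be1; clear; lra.
have be01 : be <= 1 by move: be2; clear; lra.
have al0 : 0 <= al by move: al1; clear; lra.
have al01 : al <= 1 by move: al2; clear; lra.
(* The total coefficient of [be * A]: 11/30 from the first phase, and [(19/30) * (19/30 - h) / 2]
   from the second, where 361/1800 is half the square of 19/30. *)
pose K := 11 / 30 + 361 / 1800 - 19 / 60 * h.
have K0 : 0 <= K by rewrite /K; move: he e1; clear; lra.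
have K1 : K <= 1 by rewrite /K; move: h0; clear; lra.
have h1 : (O - a - b - eta) * (al - be) <= p * (al - be) by apply: ler_wpM2r.
have h2 : be * (a - eps * O - eta) * K <= be * A * K.
  by apply: ler_wpM2r => //; apply: ler_wpM2l.
(* [P1], [P2], [P3] collect [O], [b] and [a] in the greedy bound, the others are errors. Here 49/30
   is 1 + 19/30, from [p] and [X], and 3961/1800 is 49/30 + 11/30 + 361/1800. *)
pose P1 := O * (49 / 30 * al - be); pose P2 := b * (al - be).
pose P3 := a * (49 / 30 * al - 3961 / 1800 * be); pose P4 := be * a * h.
pose P5 := be * (eps * O + eta) * K; pose P6 := eta * (al - be); pose P7 := al * eta.
have hFy : P1 - P2 - P3 - 19 / 60 * P4 - P5 - P6 - 19 / 30 * P7 <= Fy + E.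
  apply: le_trans hy; move: h1 h2 hX; rewrite /P1 /P2 /P3 /P4 /P5 /P6 /P7 /K; clear; lra.
have q1 : O * (499 / 1000 + 122 / (1000 * 1000)) <= P1.
  by apply: ler_wpM2l => //; move: al1 be2; clear; lra.
have q2 : P2 <= b * (162 / 1000 + 942 / (1000 * 1000)).
  by apply: ler_wpM2l => //; move: al2 be1; clear; lra.
have q3 : P3 <= a * (57 / 1000 + 471 / (1000 * 1000)).
  by apply: ler_wpM2l => //; move: al2 be1; clear; lra.
have eo0 : 0 <= eps * O by apply: le_trans n0 eO.
have q4 : P4 <= 2 * (eps * O).
  rewrite /P4 [eps * O]mulrC mulrA; apply: ler_pM => //; first by apply: mulr_ge0.
  by apply: le_trans a2; apply: ler_piMl.
have q5 : P5 <= 2 * (eps * O).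
  rewrite /P5 -mulrA -[leRHS]mul1r; apply: ler_pM => //.
    by apply: mulr_ge0 => //; apply: addr_ge0.
  rewrite -[leRHS]mulr1; apply: ler_pM => //; first by apply: addr_ge0.
  by move: eO; clear; lra.
have q6 : P6 <= eps * O by rewrite /P6 -[leRHS]mulr1; apply: ler_pM.
have q7 : P7 <= eps * O by rewrite /P7 -[leRHS]mul1r; apply: ler_pM.
have [hFw|hFw] := lerP (401 / 1000 * O - 10 * E) Fw; [by left|right].
move: hFw hFy q1 q2 q3 q4 q5 q6 q7 eO1 hw hz O0 a0 b0 E0.
move: P1 P2 P3 P4 P5 P6 P7 (eps * O) => P1 P2 P3 P4 P5 P6 P7 eo; clear.
rewrite !expr2.
move=> hFw hFy q1 q2 q3 q4 q5 q6 q7 eO1 hw hz O0 a0 b0 E0.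
lra.
Qed.

End RatioCombination.

(** * Measured continuous greedy *)

Section Greedy.
Context {R : realType} {n : nat}.
Variables (F : 'rV[R]_n -> R) (G : 'rV[R]_n -> 'rV[R]_n) (L D : R) (P : set 'rV[R]_n).
Hypothesis F_ge0 : forall x, cube x -> 0 <= F x.
Hypothesis F_dr : dr_submodular F.
Hypothesis F_grad : gradient_on_cube F G.
Hypothesis G_smooth : smooth L G.
Hypothesis P_cube : P `<=` cube.
Hypothesis P_body : convex_body P.
Hypothesis P_down : down_closed P.
Hypothesis P_diam : has_diameter D P.
Implicit Types (x y u v w z o : 'rV[R]_n).

Lemma body_combination x y (t : R) : P x -> P y -> 0 <= t <= 1 ->
  P (t *: x + (1 - t) *: y).
Proof.
move=> Px Py ht; have [_ _ Pc] := P_body.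
have := @Pc x y (Itv01 (proj1 (andP ht)) (proj2 (andP ht))).
by rewrite !inE; apply.
Qed.

Lemma body0 : P 0.
Proof.
have [[x Px] _ _] := P_body.
by apply: (P_down Px) => // j; rewrite mxE; have /andP[] := P_cube Px j.
Qed.

Lemma body_norm x : P x -> norm2 x <= D.
Proof. by move=> Px; have := P_diam Px body0; rewrite subr0. Qed.

Lemma diam_ge0 : 0 <= D.
Proof. exact: le_trans (norm2_ge0 _) (body_norm body0). Qed.

Variables (o z : 'rV[R]_n) (T s : nat) (p A X : R).
Hypothesis Po : P o.
Hypothesis Pz : P z.
Hypothesis T_gt0 : (0 < T)%N.

Local Notation h := (T%:R^-1 : R).
Local Notation th := (1 - T%:R^-1 : R).
Local Notation err := (L * D ^+ 2 * h).

Definition avoid (i : nat) : R := if (i < s)%N then 1 else 0.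
(** What [o] can guarantee from [y]. In the first phase it is [F o - b - (1 - th ^+ i) * a] weakened
    by [p <= F o - a - b] and [A <= a], with [a], [b] the values at [vadd z o] and [vmul z o]; in
    the second it is [join_bound i]. *)
Definition threshold (i : nat) : R :=
  if (i < s)%N then p + th ^+ i * A
  else th ^+ (i - s) * X + (i - s)%:R * h * th ^+ i * A.
Definition direction (i : nat) y : 'rV[R]_n :=
  \row_j (G y 0 j * (1 - y 0 j - avoid i * z 0 j)).
Definition advance (i : nat) y x : 'rV[R]_n :=
  \row_j (y 0 j + h * (x 0 j * (1 - y 0 j - avoid i * z 0 j))).

(** The first clause keeps [y] in [P] by down-closedness up to time [T]. The second is what
    [join_step] uses; the third is what [avoid_lower] uses, and it leaves room for masking [z]. *)
Definition greedy_shape (i : nat) y :=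
  [/\ exists2 q, P q & forall j, 0 <= y 0 j <= i%:R * h * q 0 j,
      forall j, y 0 j <= 1 - th ^+ i &
      (i <= s)%N -> forall j, y 0 j <= (1 - th ^+ i) * (1 - z 0 j)].

(** An explicit sub-solution of [v (i+1) = th * v i + h * threshold i], the progress of one step;
    its continuous form is [p (1 - e^-t) + t e^-t A]. In the second phase the thresholds themselves
    grow linearly in [A], whence the term [k (k - 1) / 2]. *)
Definition value_phase1 (i : nat) : R := p * (1 - th ^+ i) + i%:R * h * th ^+ i * A.
Definition value_phase2 (k : nat) : R :=
  th ^+ k * value_phase1 s + k%:R * h * th ^+ k * X +
  h ^+ 2 * th ^+ (s + k) * A * (k%:R * (k%:R - 1) / 2).
Definition value_bound (i : nat) : R :=
  if (i <= s)%N then value_phase1 i else value_phase2 (i - s).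
Definition join_bound (i : nat) : R :=
  th ^+ (i - s) * X + (i - s)%:R * h * th ^+ i * A.
Definition greedy_value (i : nat) y :=
  value_bound i - i%:R * h * err <= F y /\
  ((s <= i)%N -> join_bound i <= F (vadd o y)).

Let hT : 0 < T%:R :> R. Proof. by rewrite ltr0n. Qed.
Let h01 : 0 < h <= 1.
Proof. by rewrite invr_gt0 hT /= invf_le1 // ler1n. Qed.
Let th01 : 0 <= th <= 1.
Proof. have := h01; lra. Qed.

Lemma theta_pow01 i : 0 <= th ^+ i <= 1.
Proof. by have /andP[a b] := th01; rewrite exprn_ge0 //= exprn_ile1. Qed.

Lemma avoid01 i : avoid i = 0 \/ avoid i = 1.
Proof. by rewrite /avoid; case: ifP; [right|left]. Qed.

Lemma greedy_shape_body i y : greedy_shape i y -> (i <= T)%N -> P y.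
Proof.
move=> [[q Pq hq] _ _] iT; apply: (P_down Pq) => j; first by rewrite mxE; have /andP[] := hq j.
have /andP[_ hj] := hq j; apply: (le_trans hj).
rewrite ler_piMl //; first by have /andP[] := P_cube Pq j.
by rewrite ler_pdivrMr // mul1r ler_nat.
Qed.

Lemma greedy_shape_room i y : greedy_shape i y ->
  forall j, avoid i * z 0 j + y 0 j <= 1.
Proof.
move=> [_ y1 y2] j; rewrite /avoid; case: ifP => [/ltnW /y2 /(_ j)|_].
  by have := theta_pow01 i; have := P_cube Pz j; nra.
by have := y1 j; have := theta_pow01 i; lra.
Qed.

Lemma greedy_shape0 : greedy_shape 0 0.
Proof.
split; first by exists 0; [exact: body0 | move=> j; rewrite !mxE mulr0 lexx].
  by move=> j; rewrite mxE expr0 subrr.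
by move=> _ j; rewrite mxE expr0 subrr mul0r.
Qed.

Lemma greedy_shape_next i y x : (i < T)%N -> greedy_shape i y -> P x ->
  greedy_shape i.+1 (advance i y x).
Proof.
move=> iT Hy Px; have := greedy_shape_room Hy; have := greedy_shape_body Hy (ltnW iT).
move: Hy => [[q Pq hq] y1 y2] Py room.
have cx := P_cube Px; have cz := P_cube Pz; have cy := P_cube Py.
have a01 : 0 <= avoid i <= 1 by case: (avoid01 i) => ->; lra.
have Hh := h01.
pose S : R := i.+1%:R; have S0 : 0 < S by rewrite ltr0Sn.
have SE : S = i%:R + 1 by rewrite /S natr1.
split.
(* Weight [i / (i + 1)] on [q] makes [(i + 1) h] times the average equal to [i h q + h x]. *)
- pose t := i%:R / S.
  have t01 : 0 <= t <= 1 by rewrite /t divr_ge0 ?ler0n ?(ltW S0) //= ler_pdivrMr // mul1r SE; lra.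
  exists (t *: q + (1 - t) *: x); first exact: body_combination.
  move=> j; rewrite !mxE.
  have -> : S * h * (t * q 0 j + (1 - t) * x 0 j) = i%:R * h * q 0 j + h * x 0 j.
    by rewrite /t; field; rewrite (lt0r_neq0 hT) addrC natr1 (lt0r_neq0 S0).
  have := room j; have := hq j; have := cx j; have := cz j; have := cy j => c1 c2 c3 c4 c5.
  have m0 : 0 <= 1 - y 0 j - avoid i * z 0 j by lra.
  have m1 : 1 - y 0 j - avoid i * z 0 j <= 1 by nra.
  have x0 : 0 <= x 0 j * (1 - y 0 j - avoid i * z 0 j) by nra.
  have x1 : x 0 j * (1 - y 0 j - avoid i * z 0 j) <= x 0 j by nra.
  have h0 : 0 <= h by lra.
  move: x0 x1; set m := x 0 j * _ => x0 x1.
  have hm0 : 0 <= h * m by rewrite mulr_ge0.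
  have hm1 : h * m <= h * x 0 j by rewrite ler_wpM2l.
  have /andP[y0 yq] := c4.
  by rewrite addr_ge0 //= lerD.
- move=> j; rewrite mxE exprS.
  have := room j; have := y1 j; have := cx j; have := cz j; have := cy j => c1 c2 c3 c4 c5.
  have m0 : 0 <= 1 - y 0 j - avoid i * z 0 j by lra.
  have m1 : 1 - y 0 j - avoid i * z 0 j <= 1 - y 0 j by nra.
  have x1 : x 0 j * (1 - y 0 j - avoid i * z 0 j) <= 1 - y 0 j by nra.
  have hm1 : h * (x 0 j * (1 - y 0 j - avoid i * z 0 j)) <= h * (1 - y 0 j).
    by rewrite ler_wpM2l //; lra.
  have := ler_wpM2l (proj1 (andP th01)) c4; nra.
- move=> is' j; rewrite mxE exprS.
  have := y2 (ltnW is') j; have := room j; have := cx j; have := cz j; have := cy j.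
  rewrite /avoid is' mul1r => c1 c2 c3 c4 c5.
  have x1 : x 0 j * (1 - y 0 j - z 0 j) <= 1 - y 0 j - z 0 j by nra.
  have hm1 : h * (x 0 j * (1 - y 0 j - z 0 j)) <= h * (1 - y 0 j - z 0 j).
    by rewrite ler_wpM2l //; lra.
  have := ler_wpM2l (proj1 (andP th01)) c5; nra.
Qed.

Local Notation a := (F (vadd z o)).
Local Notation b := (F (vmul z o)).

Hypothesis A_ge0 : 0 <= A.
Hypothesis X_ge0 : 0 <= X.
Hypothesis p_le : p <= F o - a - b.
Hypothesis A_le : A <= a.
Hypothesis X_le : X <= F o - (1 - th ^+ s) * a.

Lemma greedy_avoid i y : greedy_shape i y -> (i <= T)%N -> (i <= s)%N ->
  F o - (1 - th ^+ i) * a <= F (vadd o y).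
Proof.
move=> Hy iT is'; have Py := greedy_shape_body Hy iT.
move: Hy => [_ _ y2]; rewrite vaddC.
apply: (avoid_lower F_ge0 F_dr F_grad (P_cube Po) (P_cube Pz)).
  by have := theta_pow01 i; lra.
by move=> j; rewrite y2 // andbT; have /andP[] := P_cube Py j.
Qed.

(** Makes [o] satisfy the constraint of step [i]: the cut body is nonempty, and its local optima can
    be compared with [o]. *)
Lemma greedy_feasible i y : (i < T)%N -> greedy_shape i y -> greedy_value i y ->
  threshold i - F y <= dot (direction i y) o.
Proof.
move=> iT Hy [_ Hj]; have Py := greedy_shape_body Hy (ltnW iT).
have := gain_lower F_ge0 F_dr F_grad (P_cube Py) (P_cube Po) (P_cube Pz) (avoid01 i)
  (greedy_shape_room Hy).
apply: le_trans; rewrite lerD2r /threshold /avoid.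
case: ifPn => [is'|]; last by rewrite -leqNgt => /Hj; rewrite mul0r subr0.
have := greedy_avoid Hy (ltnW iT) (ltnW is').
have := theta_pow01 i; rewrite mul1r; have := A_le; have := p_le; nra.
Qed.

Lemma threshold_step i : (i < T)%N ->
  value_bound i.+1 <= th * value_bound i + h * threshold i.
Proof.
move=> iT; have Hh := h01; have h0 : 0 <= h by lra.
have t01 := th01; have q01 := theta_pow01.
rewrite /value_bound /threshold; case: (ltnP i s) => [is'|si].
  rewrite (ltnW is') /value_phase1 exprS -[i.+1]addn1 natrD.
  have /andP[q0 q1] := q01 i.
  have e : th * th ^+ i <= th ^+ i by rewrite ler_piMl //; lra.
  have := ler_wpM2r A_ge0 (ler_wpM2l h0 e); set q := th ^+ i; lra.
have -> : (i.+1 - s = (i - s).+1)%N by rewrite subSn.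
set k := (i - s)%N; have iE : i = (s + k)%N by rewrite subnKC.
(* At [i = s] the two closed forms agree. *)
have -> : (if (i <= s)%N then value_phase1 i else value_phase2 k) = value_phase2 k.
  case: ifP => // is'; have k0 : k = 0%N by apply/eqP; rewrite subn_eq0.
  rewrite k0 /value_phase2 iE k0 addn0 expr0; lra.
rewrite /value_phase2 iE addnS !exprS -[k.+1]addn1 natrD.
have /andP[q0 q1] := q01 k; have /andP[r0 r1] := q01 (s + k)%N.
have e1 : th * th ^+ k <= th ^+ k by rewrite ler_piMl //; lra.
have e2 : th * th ^+ (s + k) <= th ^+ (s + k) by rewrite ler_piMl //; lra.
have f1 := ler_wpM2r X_ge0 (ler_wpM2l h0 e1).
have kh0 : 0 <= h * (h * k%:R) by rewrite !mulr_ge0 ?ler0n.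
have f2 := ler_wpM2r A_ge0 (ler_wpM2l kh0 e2).
move: f1 f2; set q := th ^+ k; set r := th ^+ (s + k); set v := value_phase1 s; lra.
Qed.

Lemma greedy_value0 y : y = 0 -> greedy_value 0 y.
Proof.
move=> ->; split.
  rewrite mul0r mul0r subr0 /value_bound leq0n /value_phase1 expr0 subrr mulr0 !mul0r addr0.
  exact/F_ge0/cube0.
rewrite leqn0 => /eqP s0; rewrite /join_bound s0 subn0 expr0 mul1r !mul0r addr0.
have -> : vadd o 0 = o by apply/rowP => j; rewrite !mxE; ring.
by have := X_le; rewrite s0 expr0 subrr mul0r subr0.
Qed.

(** The favourable case [A <= F (vadd x o)] is used to maintain the join bound in the second phase;
    the progress of [F y] itself comes from the gain constraint on [x]. *)
Lemma greedy_value_next i y x : (i < T)%N -> greedy_shape i y -> greedy_value i y ->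
  P x -> threshold i - F y <= dot (direction i y) x -> A <= F (vadd x o) ->
  greedy_value i.+1 (advance i y x).
Proof.
move=> iT Hy [Hv Hj] Px Hx HA; have Py := greedy_shape_body Hy (ltnW iT).
have Hh := h01; have h0 : 0 <= h by lra. have t01 := th01.
have cx := P_cube Px; have cz := P_cube Pz; have cy := P_cube Py.
have room := greedy_shape_room Hy.
have a01 : 0 <= avoid i <= 1 by case: (avoid01 i) => ->; lra.
split; last first.
  rewrite leq_eqVlt ltnS => /orP[/eqP sE|si].
    have Hy' := greedy_shape_next iT Hy Px.
    have := greedy_avoid Hy' iT (eq_leq (esym sE)); apply: le_trans.
    have := X_le; rewrite sE /join_bound sE subnn expr0 mul1r !mul0r addr0.
    by [].
  have := Hj si; rewrite /join_bound subSn // => Hj'.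
  have -> : advance i y x = \row_j (y 0 j + h * (x 0 j * (1 - y 0 j))).
    by apply/rowP => j; rewrite !mxE /avoid ltnNge si /= mul0r subr0.
  have h1 : 0 <= h <= 1 by lra.
  have m1 : 0 <= 1 - th ^+ i <= 1 by have := theta_pow01 i; lra.
  have y1 : forall j, y 0 j <= 1 - th ^+ i by case: Hy.
  have := join_step F_ge0 F_dr F_grad (P_cube Po) cy cx h1 m1 y1.
  apply: le_trans; rewrite (vaddC o x).
  have /andP[q0 q1] := theta_pow01 i.
  have -> : 1 - (1 - th ^+ i) = th ^+ i by ring.
  have g1 : h * (th ^+ i * A) <= h * (th ^+ i * F (vadd x o)).
    by rewrite ler_wpM2l // ler_wpM2l.
  have g2 := ler_wpM2l (proj1 (andP t01)) Hj'.
  have e : th * th ^+ i <= th ^+ i by rewrite ler_piMl //; lra.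
  have g3 := ler_wpM2r A_ge0 (ler_wpM2l h0 e).
  rewrite !exprS -[(i - s).+1]addn1 natrD.
  by move: g1 g2 g3; set q := th ^+ i; set r := th ^+ (i - s); lra.
pose d : 'rV[R]_n := \row_j (x 0 j * (1 - y 0 j - avoid i * z 0 j)).
have yd : advance i y x = y + h *: d by apply/rowP => j; rewrite !mxE.
have dE : dot (direction i y) x = dot (G y) d.
  by apply: eq_bigr => j _; rewrite !mxE; ring.
have m0 j : 0 <= 1 - y 0 j - avoid i * z 0 j by have := room j; lra.
have m1 j : 1 - y 0 j - avoid i * z 0 j <= 1 - y 0 j.
  by have := cz j; nra.
have d0 : vle 0 d by move=> j; rewrite !mxE; have := m0 j; have := cx j; nra.
have dx j : d 0 j <= x 0 j.
  by rewrite mxE; have := m0 j; have := m1 j; have := cy j; have := cx j; nra.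
have cyd : cube (y + d).
  move=> j; have := d0 j; rewrite !mxE; have := m0 j; have := m1 j; have := cy j; have := cx j; nra.
have nd : norm2 d <= D.
  apply: le_trans (body_norm Px); apply: norm2_le => j.
  have h1 := d0 j; rewrite mxE in h1.
  by rewrite !ger0_norm ?dx //; apply: le_trans (dx j).
have h1 : 0 <= h <= 1 by lra.
have := gain_step F_dr F_grad G_smooth cy h1 d0 cyd nd.
rewrite -yd -dE => hF.
have hd := ler_wpM2l h0 Hx.
have hs := threshold_step iT.
have [L0 _] := G_smooth.
have e0 : 0 <= err by rewrite mulr_ge0 // mulr_ge0 // sqr_ge0.
have E2 : L * h ^+ 2 * D ^+ 2 = h * err by ring.
have hv := ler_wpM2l (proj1 (andP t01)) Hv.
have e1 : th * (i%:R * h * err) <= i%:R * h * err.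
  by apply: ler_piMl; [do 2 apply: mulr_ge0 => //; exact: ler0n|lra].
rewrite -natr1.
move: hF hd hs hv e1; rewrite E2; set er := err.
set ih := i%:R * h * er; set hF' := h * er.
have -> : (i%:R + 1) * h * er = ih + hF' by rewrite /ih /hF'; ring.
lra.
Qed.

Lemma greedy_final y : (s <= T)%N -> greedy_value T y ->
  value_phase2 (T - s) <= F y + err.
Proof.
move=> sT [Hv _]; move: Hv; rewrite mulfV ?gt_eqF // mul1r.
have -> : value_bound T = value_phase2 (T - s).
  rewrite /value_bound; case: ifP => // Ts.
  have TE : T = s by apply/eqP; rewrite eqn_leq Ts.
  by rewrite TE subnn /value_phase2 addn0 expr0; lra.
by rewrite lerBlDr.
Qed.

End Greedy.

(** * Running time and correctness of commands *)

Section CostModel.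
Variables (n : nat) (B : nat -> nat).

(* [B b] bounds the content of the cell [b] whenever it limits a loop; every other loop is
   charged [B 1] iterations, and [Solve] is charged for at most one constraint. *)
Fixpoint cost (c : cmd) : nat :=
  match c with
  | Skip | NSet _ _ | RSet _ _ _ => 1
  | Seq c1 c2 => cost c1 + cost c2
  | If _ c1 c2 => (cost c1 + cost c2).+1
  | While b c1 =>
      let k := match b with
               | BNot (BNle (NMem (NLit a)) _) => B a
               | _ => B 1
               end in
      k * (cost c1).+1 + 1
  | QueryF _ _ _ | QueryGrad _ _ => n.+1
  | Solve _ _ _ _ _ => 2 * n.+1
  end.

End CostModel.

(** The induction is on the text of the program, so the degree depends on the program alone. Degrees
    are added at [Seq] and [If], which is crude, and a loop raises the degree by one. *)
Lemma cost_poly (c : cmd) : exists A k : nat, forall n B M,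
  (forall b, (B b <= M)%N) -> (n < M)%N -> (cost n B c <= A * M ^ k)%N.
Proof.
have M1 M n : (n < M)%N -> (0 < M)%N by case: M.
elim: c => [|e1 e2|e1 e2 e3|c1 [A1 [k1 IH1]] c2 [A2 [k2 IH2]]|b c1 [A1 [k1 IH1]] c2 [A2 [k2 IH2]]
  |b c [A [k IH]]|e1 e2 e3|e1 e2|e1 e2 e3 e4 e5] /=.
1-3: by exists 1, 0 => n B M _ _.
- exists (A1 + A2), (k1 + k2) => n B M hB nM; rewrite mulnDl leq_add //.
    apply: leq_trans (IH1 _ _ _ hB nM) _; rewrite leq_mul2l leq_pexp2l ?leq_addr ?orbT //.
    exact: M1 nM.
  apply: leq_trans (IH2 _ _ _ hB nM) _; rewrite leq_mul2l leq_pexp2l ?leq_addl ?orbT //.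
  exact: M1 nM.
- exists (A1 + A2 + 1), (k1 + k2) => n B M hB nM; rewrite -addn1 !mulnDl mul1n leq_add //.
    rewrite leq_add //.
      apply: leq_trans (IH1 _ _ _ hB nM) _; rewrite leq_mul2l leq_pexp2l ?leq_addr ?orbT //.
      exact: M1 nM.
    apply: leq_trans (IH2 _ _ _ hB nM) _; rewrite leq_mul2l leq_pexp2l ?leq_addl ?orbT //.
    exact: M1 nM.
  by rewrite expn_gt0 (M1 _ _ nM).
- exists (A + 2), k.+1 => n B M hB nM; have h := IH n B M hB nM.
  set q := (match b with BNot _ => _ | _ => _ end); have qM : (q <= M)%N.
    by rewrite /q; repeat match goal with |- context [match ?x with _ => _ end] => destruct x end;
      exact: hB.
  have Mp := M1 _ _ nM; have Mk : (0 < M ^ k)%N by rewrite expn_gt0 Mp.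
  rewrite expnS; apply: (@leq_trans (M * (A * M ^ k).+1 + 1)); first by rewrite leq_add2r leq_mul.
  have : (M <= M * M ^ k)%N by rewrite leq_pmulr.
  by rewrite mulnS; nia.
- by exists 1, 1 => n B M _ nM; rewrite mul1n expn1.
- by exists 1, 1 => n B M _ nM; rewrite mul1n expn1.
- by exists 2, 1 => n B M _ nM; rewrite expn1 leq_mul2l.
Qed.

(** The guard is written as a negated [BNle] with cell [b] first, the form in which [cost]
    recognizes [b] as the bound. *)
Definition For (c b : nat) (body : cmd) : cmd :=
  Seq (NSet (NLit c) (NLit 0))
    (While (BNot (BNle (NMem (NLit b)) (NMem (NLit c))))
       (Seq body (NSet (NLit c) (NAdd (NMem (NLit c)) (NLit 1))))).

Section WeakestPrecondition.
Context {R : realType} {n : nat}.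
Variables (F : 'rV[R]_n -> R) (G : 'rV[R]_n -> 'rV[R]_n).
Variable solve : seq ('rV[R]_n * R) -> 'rV[R]_n -> option 'rV[R]_n.
Variable B : nat -> nat.
Implicit Types (s : state R) (Q : state R -> Prop).

(** Total correctness together with running time, so that every rule below also accounts for
    [cost]. *)
Definition wp (c : cmd) Q s : Prop :=
  exists t s', [/\ exec F G solve c s t s', (t <= cost n B c)%N & Q s'].

Lemma wp_mono c Q Q' s : (forall s', Q s' -> Q' s') -> wp c Q s -> wp c Q' s.
Proof. by move=> h [t [s' [e le q]]]; exists t, s'; split=> //; exact: h. Qed.

Lemma wp_skip Q s : Q s -> wp Skip Q s.
Proof. by exists 1%N, s; split=> //; exact: ExecSkip. Qed.

Lemma wp_nset a e Q s : Q (nset s (neval s a) (neval s e)) -> wp (NSet a e) Q s.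
Proof. by move=> h; exists 1%N; eexists; split; [exact: ExecNSet| |]. Qed.

Lemma wp_rset i j e Q s :
  Q (rset s (neval s i) (neval s j) (reval s e)) -> wp (RSet i j e) Q s.
Proof. by move=> h; exists 1%N; eexists; split; [exact: ExecRSet| |]. Qed.

Lemma wp_seq c1 c2 Q s : wp c1 (wp c2 Q) s -> wp (Seq c1 c2) Q s.
Proof.
move=> [t1 [s1 [e1 l1 [t2 [s2 [e2 l2 q]]]]]]; exists (t1 + t2)%N, s2; split=> //.
  exact: ExecSeq e1 e2.
exact: leq_add.
Qed.

Lemma wp_if b c1 c2 Q s :
  (beval s b -> wp c1 Q s) -> (~~ beval s b -> wp c2 Q s) -> wp (If b c1 c2) Q s.
Proof.
move=> h1 h2; have [hb|hb] := boolP (beval s b).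
  have [t [s' [e l q]]] := h1 hb; exists t.+1, s'; split=> //.
    by apply: ExecIf; rewrite hb.
  by rewrite /= ltnS (leq_trans l) // leq_addr.
have [t [s' [e l q]]] := h2 hb; exists t.+1, s'; split=> //.
  by apply: ExecIf; rewrite (negbTE hb).
by rewrite /= ltnS (leq_trans l) // leq_addl.
Qed.

Lemma wp_queryF x i j Q s :
  Q (rset s (neval s i) (neval s j) (F (get_row s (neval s x)))) -> wp (QueryF x i j) Q s.
Proof. by move=> h; exists n.+1; eexists; split; [exact: ExecQueryF| |]. Qed.

Lemma wp_queryG x y Q s :
  Q (set_row s (neval s y) (G (get_row s (neval s x)))) -> wp (QueryGrad x y) Q s.
Proof. by move=> h; exists n.+1; eexists; split; [exact: ExecQueryGrad| |]. Qed.

Lemma wp_solve a m w x f Q s : (neval s m <= 1)%N ->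
  Q (do_solve solve s (neval s a) (neval s m) (neval s w) (neval s x) (neval s f)) ->
  wp (Solve a m w x f) Q s.
Proof.
move=> m1 h; exists ((neval s m).+1 * n.+1)%N.
exists (do_solve solve s (neval s a) (neval s m) (neval s w) (neval s x) (neval s f)).
split; [exact: ExecSolve| |exact: h].
by rewrite /= leq_mul2r ltnS m1 orbT.
Qed.

(* A loop whose guard fails as soon as the variant [k] has reached [K]. *)
Lemma wp_while b body (K : nat) (I : nat -> state R -> Prop) Q s :
  (K <= match b with BNot (BNle (NMem (NLit a)) _) => B a | _ => B 1 end)%N ->
  I 0%N s ->
  (forall k s, (k < K)%N -> I k s -> beval s b -> wp body (I k.+1) s) ->
  (forall s, I K s -> ~~ beval s b) ->
  (forall k s, (k <= K)%N -> I k s -> ~~ beval s b -> Q s) ->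
  wp (While b body) Q s.
Proof.
move=> KB I0 step stop post.
suff main k d s0 : (k + d = K)%N -> I k s0 ->
    exists t s', [/\ exec F G solve (While b body) s0 t s',
      (t <= d * (cost n B body).+1 + 1)%N & Q s'].
  have [t [s' [e l q]]] := main 0%N K s erefl I0; exists t, s'; split=> //.
  by apply: (leq_trans l); rewrite /= leq_add2r leq_mul2r KB orbT.
elim: d k s0 => [|d IH] k s0 kd Ik.
  rewrite addn0 in kd; subst k; exists 1%N, s0; split=> //.
    by apply: ExecWhileEnd; exact: stop.
  by apply: (post K) => //; exact: stop.
have [hb|hb] := boolP (beval s0 b); last first.
  exists 1%N, s0; split; [exact: ExecWhileEnd|by rewrite addn1|].
  by apply: (post k) => //; rewrite -kd leq_addr.
have kK : (k < K)%N by rewrite -kd addnS ltnS leq_addr.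
have [t1 [s1 [e1 l1 I1]]] := step k s0 kK Ik hb.
have [|t2 [s2 [e2 l2 q]]] := IH k.+1 s1 _ I1; first by rewrite addSnnS.
exists (t1 + t2).+1, s2; split=> //; first exact: ExecWhileStep e1 e2.
by rewrite mulSn; move: l1 l2; set m := (d * _)%N; lia.
Qed.

Lemma wp_for c b body (K : nat) (I : nat -> state R -> Prop) Q s :
  (K <= B b)%N ->
  (forall k s, I k s -> nmem s b = K /\ nmem s c = k) ->
  I 0%N (nset s c 0) ->
  (forall k s, (k < K)%N -> I k s ->
     wp body (fun s' => nmem s' c = k /\ I k.+1 (nset s' c k.+1)) s) ->
  (forall s, I K s -> Q s) ->
  wp (For c b body) Q s.
Proof.
move=> KB Ib I0 step post; apply/wp_seq/wp_nset => /=.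
apply: (@wp_while _ _ K I) => //= [k s1 kK Ik _|s1 Ik|k s1 kK Ik].
- apply: wp_seq; apply: wp_mono (step _ _ kK Ik) => s' [ck h].
  by apply: wp_nset; rewrite /= ck addn1.
- by have [-> ->] := Ib _ _ Ik; rewrite leqnn.
- have [-> ->] := Ib _ _ Ik; rewrite negbK => Kk; apply: post.
  by have -> : K = k by apply/eqP; rewrite eqn_leq Kk.
Qed.

End WeakestPrecondition.

(** * Reading, writing and framing of memory states *)

Section States.
Context {R : realType} {n : nat}.
Implicit Types (s : state R) (v : 'rV[R]_n).

Lemma state_eq s1 s2 : nmem s1 =1 nmem s2 -> rmem s1 =2 rmem s2 -> s1 = s2.
Proof.
case: s1 s2 => [a b] [a' b'] /= h1 h2; congr State; apply/funext => i //.
by apply/funext => j.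
Qed.

Lemma get_row_nset s a k i : get_row (n := n) (nset s a k) i = get_row s i.
Proof. by []. Qed.

Lemma get_row_set_row s i v : get_row (set_row s i v) i = v.
Proof. by apply/rowP => j; rewrite mxE /= eqxx valK. Qed.

Lemma get_row_set_row_neq s (i i' : nat) v : i' != i ->
  get_row (n := n) (set_row s i v) i' = get_row s i'.
Proof. by move=> h; apply/rowP => j; rewrite !mxE /= (negbTE h). Qed.

Lemma get_row_rset_neq s (i : nat) j (i' : nat) (r : R) : i' != i ->
  get_row (n := n) (rset s i j r) i' = get_row s i'.
Proof. by move=> h; apply/rowP => k; rewrite !mxE /= (negbTE h). Qed.

Lemma get_row_rset_out s i (r : R) i' : get_row (n := n) (rset s i n r) i' = get_row s i'.
Proof.
by apply/rowP => k; rewrite !mxE /= (ltn_eqF (ltn_ord k)) andbF.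
Qed.

Lemma get_row_rset s i (j : 'I_n) (r : R) :
  get_row (rset s i j r) i = upd (get_row s i) j r.
Proof. by apply/rowP => k; rewrite !mxE /= eqxx. Qed.

Lemma rmem_set_row_neq s (i : nat) v (i' : nat) j : i' != i -> rmem (set_row s i v) i' j = rmem s i' j.
Proof. by move=> /negbTE /= ->. Qed.

Lemma get_row_eq s s' i : (forall j, rmem s' i j = rmem s i j) ->
  get_row (n := n) s' i = get_row s i.
Proof. by move=> h; apply/rowP => j; rewrite !mxE. Qed.

Definition same (N Q : pred nat) s s' :=
  (forall a, ~~ N a -> nmem s' a = nmem s a) /\
  (forall i, ~~ Q i -> forall j, rmem s' i j = rmem s i j).

Lemma same_trans N Q s1 s2 s3 : same N Q s1 s2 -> same N Q s2 s3 -> same N Q s1 s3.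
Proof.
move=> [a b] [c d]; split=> [i h|i h j]; first by rewrite c ?a.
by rewrite d ?b.
Qed.

Lemma same_sub (N Q N' Q' : pred nat) s s' : (forall a, N a -> N' a) ->
  (forall a, Q a -> Q' a) ->
  same N Q s s' -> same N' Q' s s'.
Proof.
move=> hN hQ [a b]; split=> [i h|i h].
  by apply: a; apply: contra h => /hN.
by apply: b; apply: contra h => /hQ.
Qed.

Lemma same_nset (N Q : pred nat) s s' a k : N a -> same N Q s s' -> same N Q s (nset s' a k).
Proof.
move=> Na [h1 h2]; split=> // a' Na' /=; case: eqP => [E|_]; last exact: h1.
by rewrite E Na in Na'.
Qed.

Lemma same_rset (N Q : pred nat) s s' i j (r : R) : Q i -> same N Q s s' ->
  same N Q s (rset s' i j r).
Proof.
move=> Qi [h1 h2]; split=> // i' Qi' j' /=; case: eqP => [E|_]; last exact: h2.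
by rewrite E Qi in Qi'.
Qed.

Lemma same_set_row (N Q : pred nat) s s' i v : Q i -> same N Q s s' ->
  same N Q s (set_row s' i v).
Proof.
move=> Qi [h1 h2]; split=> // i' Qi' j'; rewrite rmem_set_row_neq ?h2 //.
by apply: contra Qi' => /eqP ->.
Qed.

End States.

(* Cells: 0 holds [n], 1 the [N] of [setup], 2 the number [T] of greedy steps, 3 the length of
   the first phase, 4 and 5 loop bounds; 6 to 15 are scratch.  Row 0 is the best point found,
   row 1 holds [delta] and the unit [eta] of the guesses, row 10 scalars, row 11 the constraint
   passed to the oracle, rows 12 to 19 scratch vectors.  Cells and rows from 20 on belong to
   the levels of the search tree. *)
Notation cellN a := (NMem (NLit a)).
Notation cellR i j := (RMem (NLit i) (NLit j)).
Notation entry i := (RMem (NLit i) (NMem (NLit 6))).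

Definition vset (i : nat) (e : rexp) : cmd := For 6 0 (RSet (NLit i) (cellN 6) e).
Definition vsum (p q : nat) (e : rexp) : cmd :=
  Seq (RSet (NLit p) (NLit q) (RNat (NLit 0)))
    (For 6 0 (RSet (NLit p) (NLit q) (RAdd (cellR p q) e))).
Definition vcopy (r r' : nat) : cmd := vset r' (entry r).
Definition theta_pow (p q : nat) (e : nexp) : cmd :=
  Seq (NSet (NLit 12) e)
    (Seq (RSet (NLit p) (NLit q) (RNat (NLit 1)))
      (For 11 12 (RSet (NLit p) (NLit q)
        (RMul (cellR p q) (RSub (RNat (NLit 1)) (RDiv (RNat (NLit 1)) (RNat (cellN 2)))))))).

Section VectorPrograms.
Context {R : realType} {n : nat}.
Variables (F : 'rV[R]_n -> R) (G : 'rV[R]_n -> 'rV[R]_n).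
Variable solve : seq ('rV[R]_n * R) -> 'rV[R]_n -> option 'rV[R]_n.
Variable B : nat -> nat.
Hypothesis B0 : (n <= B 0)%N.
Implicit Types (s : state R) (Q : state R -> Prop).
Local Notation wp := (wp F G solve B).

(** When entry [j] is computed, the entries of row [i] from [j] on are still the old ones, so [e]
    may read the very row that is being overwritten. *)
Lemma wp_vset (i : nat) e (v : 'rV[R]_n) Q s : nmem s 0 = n ->
  (forall (j : 'I_n) s1, (forall a : nat, a != 6%N -> nmem s1 a = nmem s a) -> nmem s1 6 = j ->
    (forall i' j' : nat, (i' != i) || (j <= j')%N -> rmem s1 i' j' = rmem s i' j') ->
    reval s1 e = v 0 j) ->
  Q (nset (set_row s i v) 6 n) -> wp (vset i e) Q s.
Proof.
move=> s0 He HQ.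
pose I k s1 := [/\ nmem s1 6 = k, (forall a : nat, a != 6%N -> nmem s1 a = nmem s a) &
  forall i' j' : nat, rmem s1 i' j' =
    if (i' == i) && (j' < k)%N then rmem (set_row s i v) i' j' else rmem s i' j'].
apply: (@wp_for _ _ _ _ _ _ _ _ _ n I) => //.
- by move=> k s1 [h6 ho _]; rewrite ho.
- split=> //.
  + by move=> a ha /=; rewrite (negbTE ha).
  + by move=> i' j'; rewrite ltn0 andbF.
- move=> k s1 kn [h6 ho hr]; apply: wp_rset; rewrite /= h6; split=> //.
  split=> //.
    by move=> a ha /=; rewrite (negbTE ha) ho.
  move=> i' j'.
  rewrite (He (Ordinal kn)) //; last first.
    move=> i2 j2 h; rewrite hr; case: ifP => // /andP[/eqP E jk].
    by move: h; rewrite E eqxx /= leqNgt jk.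
  have [->|ii] := eqVneq i' i; last by rewrite /= hr (negbTE ii).
  have [->|jk] := eqVneq j' k.
    by rewrite ltnSn /= !eqxx (insubT (fun j => j < n)%N kn).
  have -> : (j' < k.+1)%N = (j' < k)%N by rewrite ltnS leq_eqVlt (negbTE jk).
  by rewrite /= (negbTE jk) andbF hr eqxx /= eqxx.
- move=> s1 [h6 ho hr]; rewrite (_ : s1 = nset (set_row s i v) 6 n) //.
  apply: state_eq => [a|i' j'] /=; first by case: eqVneq => [->|/ho].
  rewrite hr; case: eqVneq => // -> /=.
  by case: ltnP => nj /=; rewrite ?eqxx // insubF // ltnNge nj.
Qed.

Lemma wp_vsum (p q : nat) e (f : 'I_n -> R) Q s : nmem s 0 = n ->
  (forall (j : 'I_n) s1, (forall a : nat, a != 6%N -> nmem s1 a = nmem s a) -> nmem s1 6 = j ->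
    (forall i' j' : nat, ~~ ((i' == p) && (j' == q)) -> rmem s1 i' j' = rmem s i' j') ->
    reval s1 e = f j) ->
  Q (nset (rset s p q (\sum_j f j)) 6 n) -> wp (vsum p q e) Q s.
Proof.
move=> s0 He HQ; apply/wp_seq/wp_rset => /=.
pose I k s1 := [/\ nmem s1 6 = k, (forall a : nat, a != 6%N -> nmem s1 a = nmem s a),
  (forall i' j' : nat, ~~ ((i' == p) && (j' == q)) -> rmem s1 i' j' = rmem s i' j') &
  rmem s1 p q = \sum_(j < n | (j < k)%N) f j].
apply: (@wp_for _ _ _ _ _ _ _ _ _ n I) => //.
- by move=> k s1 [h6 ho _]; rewrite ho.
- split=> //; [by move=> a ha /=; rewrite (negbTE ha)|by move=> i' j' h /=; rewrite (negbTE h)|].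
  by rewrite /= !eqxx big_pred0.
- move=> k s1 kn [h6 ho hr hs]; apply: wp_rset; rewrite /= h6; split=> //.
  split=> //.
  - by move=> a ha /=; rewrite (negbTE ha) ho.
  - by move=> i' j' h /=; rewrite (negbTE h) hr.
  rewrite /= !eqxx /= hs (He (Ordinal kn)) // [RHS](bigD1 (Ordinal kn)) //= addrC.
  congr (_ + _); apply: eq_bigl => j.
  by rewrite ltnS ltn_neqAle andbC -val_eqE.
- move=> s1 [h6 ho hr hs]; rewrite (_ : s1 = nset (rset s p q (\sum_j f j)) 6 n) //.
  apply: state_eq => [a|i' j'] /=; first by case: eqVneq => [->|/ho].
  case: ifP => [/andP[/eqP -> /eqP ->]|/negbT /hr //].
  by rewrite hs; apply: eq_bigl => j; rewrite ltn_ord.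
Qed.

Lemma wp_vcopy (r r' : nat) Q s : nmem s 0 = n -> r != r' ->
  Q (nset (set_row s r' (get_row s r : 'rV[R]_n)) 6 n) -> wp (vcopy r r') Q s.
Proof.
move=> s0 rr; apply: wp_vset => // j s1 ho h6 hr /=.
by rewrite h6 hr ?rr // mxE.
Qed.

Lemma wp_theta_pow (T : nat) p q e Q s : nmem s 2 = T -> (neval s e <= B 12)%N ->
  Q (nset (nset (rset s p q ((1 - T%:R^-1) ^+ neval s e)) 12 (neval s e)) 11 (neval s e)) ->
  wp (theta_pow p q e) Q s.
Proof.
move=> s2 eB HQ; apply/wp_seq/wp_nset/wp_seq/wp_rset => /=.
set k0 := neval s e in eB HQ *.
pose I k s1 := s1 = nset (nset (rset s p q ((1 - T%:R^-1) ^+ k)) 12 k0) 11 k.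
apply: (@wp_for _ _ _ _ _ _ _ _ _ k0 I) => //.
- by move=> k s1 ->.
- move=> k s1 kk ->; apply: wp_rset => /=; split=> //; rewrite /I.
  apply: state_eq => [a|i j] /=; first by case: eqP.
  have [h|h] := boolP ((i == p) && (j == q)); last by [].
  by rewrite !eqxx /= s2 exprSr; congr (_ * (_ - _)); exact: mul1r.
- by move=> s1 ->.
Qed.

End VectorPrograms.

(** * The programs *)

(** Row 14 is the iterate, 12 its gradient, 13 the linear maximizer; cells (10, 0) and (10, 1) hold
    the current and the smallest gap. The test on cell 9 forces the first iterate to be stored. *)
Definition local_search_step (zt : nat) : cmd :=
  Seq (QueryGrad (NLit 14) (NLit 12))
  (Seq (Solve (NLit 11) (cellN 8) (NLit 12) (NLit 13) (NLit 7))
  (Seq (vsum 10 0 (RMul (entry 12) (RSub (entry 13) (entry 14))))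
  (Seq (If (BNot (BAnd (BNle (NLit 1) (cellN 9)) (BRle (cellR 10 1) (cellR 10 0))))
         (Seq (RSet (NLit 10) (NLit 1) (cellR 10 0)) (vcopy 14 zt)) Skip)
       (vset 14 (RAdd (entry 14) (RDiv (RSub (entry 13) (entry 14)) (RNat (cellN 2)))))))).

(* Frank-Wolfe on the body cut by the constraint in row 11, keeping in row [zt] the iterate
   with the smallest duality gap.  If the cut body is empty, cell 8 is reset to 0 and the
   constraint is dropped. *)
Definition local_search (zt : nat) : cmd :=
  Seq (NSet (NLit 8) (NLit 1))
  (Seq (Solve (NLit 11) (cellN 8) (NLit 12) (NLit 14) (NLit 7))
  (Seq (If (BNle (cellN 7) (NLit 0))
         (Seq (NSet (NLit 8) (NLit 0))
              (Solve (NLit 11) (cellN 8) (NLit 12) (NLit 14) (NLit 7))) Skip)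
       (For 9 4 (local_search_step zt)))).

(** * Convergence of the Frank-Wolfe local search *)

Section LocalSearch.
Context {R : realType} {n : nat}.
Variables (F : 'rV[R]_n -> R) (G : 'rV[R]_n -> 'rV[R]_n) (L D : R) (P : set 'rV[R]_n).
Variable solve : seq ('rV[R]_n * R) -> 'rV[R]_n -> option 'rV[R]_n.
Variable B : nat -> nat.
Hypothesis F_ge0 : forall x, cube x -> 0 <= F x.
Hypothesis F_dr : dr_submodular F.
Hypothesis F_grad : gradient_on_cube F G.
Hypothesis G_smooth : smooth L G.
Hypothesis P_cube : P `<=` cube.
Hypothesis P_body : convex_body P.
Hypothesis P_down : down_closed P.
Hypothesis P_diam : has_diameter D P.
Hypothesis P_solve : meta_solver P solve.
Variables (T m : nat) (O : R).
Hypothesis T_gt0 : (0 < T)%N.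
Hypothesis m_gt0 : (0 < m)%N.
Hypothesis F_le : forall x, P x -> F x <= O.
Hypothesis B0 : (n <= B 0)%N.
Hypothesis B4 : (T * m <= B 4)%N.
Implicit Types (s : state R) (Q : state R -> Prop) (x y z v w : 'rV[R]_n).
Local Notation wp := (wp F G solve B).
Local Notation h := (T%:R^-1 : R).
Local Notation err := (L * D ^+ 2 * h).

Definition cut s : seq ('rV[R]_n * R) := get_constraints s 11 1.

Lemma get_constraints_eq s s' k : (forall j, rmem s' 11 j = rmem s 11 j) -> (k <= 1)%N ->
  get_constraints (n := n) s' 11 k = get_constraints s 11 k.
Proof.
move=> E; have Er : get_row (n := n) s' 11 = get_row s 11 by apply: get_row_eq.
by case: k => [|[|k]] //= _; rewrite /get_constraints /= Er E.
Qed.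

Lemma polyhedron_combination cs x y (t : R) : polyhedron cs x -> polyhedron cs y ->
  0 <= t <= 1 -> polyhedron cs (x + t *: (y - x)).
Proof.
move=> hx hy ht c cc; have := hx c cc; have := hy c cc.
by rewrite /= dotDr dotZr dotBr; nra.
Qed.

Lemma frank_wolfe_step x v : P x -> P v ->
  P (x + h *: (v - x)) /\
  F x + h * dot (G x) (v - x) - 2 * h * err <= F (x + h *: (v - x)).
Proof.
move=> Px Pv.
have T0 : 0 < T%:R :> R by rewrite ltr0n.
have h01 : 0 <= h <= 1 by rewrite invr_ge0 (ltW T0) /= invf_le1 // ler1n.
have Py : P (x + h *: (v - x)).
  have -> : x + h *: (v - x) = h *: v + (1 - h) *: x.
    by rewrite scalerBr scalerBl scale1r addrCA.
  exact: (body_combination P_body Pv Px h01).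
split=> //; have := smooth_step F_dr F_grad G_smooth (P_cube Px) (P_cube Py).
rewrite [X in dot _ X]addrC addKr dotZr [X in norm2 X]addrC addKr norm2Z exprMn.
have [L0 _] := G_smooth.
have hn : norm2 (v - x) ^+ 2 <= D ^+ 2.
  by rewrite lerXn2r ?nnegrE ?norm2_ge0 ?(le_trans (norm2_ge0 (v - x))) ?P_diam.
rewrite ger0_norm; last by case/andP: h01.
have : 2 * L * (h ^+ 2 * norm2 (v - x) ^+ 2) <= 2 * h * err.
  have -> : 2 * h * err = 2 * L * (h ^+ 2 * D ^+ 2) by ring.
  by rewrite ler_wpM2l ?mulr_ge0 // ler_wpM2l ?sqr_ge0.
lra.
Qed.

Definition stationary (g : R) cs x :=
  [/\ P x, polyhedron cs x & forall v, P v -> polyhedron cs v -> dot (G x) (v - x) <= g].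

Definition ls_cells : pred nat := fun a => (6 <= a < 16)%N.
Definition ls_rows (zt : nat) : pred nat :=
  fun i => ((10 <= i < 15)%N && (i != 11%N)) || (i == zt).

(** In the last clause each of the [k] steps gains at least [h] times the smallest gap minus its
    smoothness error, starting from a nonnegative value. *)
Definition ls_inv zt s0 cs (k : nat) s :=
  [/\ same ls_cells (ls_rows zt) s0 s, nmem s 9 = k, (nmem s 8 <= 1)%N,
      get_constraints s 11 (nmem s 8) = cs &
      [/\ P (get_row s 14), polyhedron cs (get_row s 14 : 'rV[R]_n),
          (0 < k)%N -> stationary (rmem s 10 1) cs (get_row s zt) &
          k%:R * h * rmem s 10 1 - k%:R * (2 * h * err) <= F (get_row s 14)]].

Lemma wp_local_search_step zt s0 cs k s : (20 <= zt)%N -> nmem s 0 = n -> nmem s 2 = T ->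
  ls_inv zt s0 cs k s ->
  wp (local_search_step zt) (fun s' => nmem s' 9 = k /\ ls_inv zt s0 cs k.+1 (nset s' 9 k.+1)) s.
Proof.
move=> zt20 sn sT [hsame h9 h8 hcs [Px Qx hst hF]].
have ztn i : (i < 20)%N -> (zt == i) = false by move=> hi; apply: gtn_eqF; lia.
have zti i : (i < 20)%N -> (i == zt) = false by move=> hi; apply: ltn_eqF; lia.
set x : 'rV[R]_n := get_row s 14 in Px Qx hF *.
apply/wp_seq/wp_queryG/wp_seq/wp_solve => //=; rewrite -/x.
set s1 := set_row s 12 (G x).
have -> : do_solve solve s1 11 (nmem s 8) 12 13 7 =
    if solve cs (G x) is Some v then nset (set_row s1 13 v) 7 1 else nset s1 7 0.
  rewrite /do_solve get_row_set_row -hcs.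
  by rewrite (@get_constraints_eq s s1) // => j; rewrite rmem_set_row_neq.
have := P_solve cs (G x).
case: (solve cs (G x)) => [v [[Pv Qv] hv]|he]; last first.
  by have : (P `&` polyhedron cs) x by []; rewrite he.
set s2 := nset (set_row s1 13 v) 7 1.
pose gap := dot (G x) (v - x).
apply: wp_seq; apply: (@wp_vsum _ _ _ _ _ _ B0 _ _ _ (fun j => G x 0 j * (v - x) 0 j)) => //=.
  by move=> j s' hN h6 hR; rewrite h6 !hR //= ?valK !mxE.
rewrite -/(dot (G x) (v - x)) -/gap.
set s3 := nset (rset s2 10 0 gap) 6 n.
have same3 : same ls_cells (ls_rows zt) s0 s3.
  apply: same_nset => //; apply: same_rset => //; apply: same_nset => //.
  by apply: same_set_row => //; apply: same_set_row.
have gap_stat : stationary gap cs x.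
  by split=> // w Pw Qw; rewrite /gap !dotBr lerD2r; exact: hv.
have x14 : get_row s3 14 = x by apply/rowP => j; rewrite !mxE.
have v13 : get_row s3 13 = v by apply/rowP => j; rewrite mxE /= valK.
have zs3 : get_row (n := n) s3 zt = get_row s zt.
  by apply/rowP => j; rewrite !mxE /= !ztn.
pose J s4 := [/\ same ls_cells (ls_rows zt) s0 s4, nmem s4 9 = k /\ nmem s4 8 = nmem s 8,
  get_row s4 14 = x /\ get_row s4 13 = v, stationary (rmem s4 10 1) cs (get_row s4 zt) &
  rmem s4 10 1 <= gap /\ k%:R * rmem s4 10 1 <= k%:R * rmem s 10 1].
apply: wp_seq; apply: (@wp_mono _ _ _ _ _ _ _ J).
  move=> s4 [same4 [e9 e8] [e14 e13] st4 [b1 b2]].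
  have eN a : ~~ ls_cells a -> nmem s4 a = nmem s a.
    by move=> ha; rewrite (proj1 same4) // (proj1 hsame).
  have e11 j : rmem s4 11 j = rmem s 11 j.
    have r11 : ~~ ls_rows zt 11 by rewrite /ls_rows /= eq_sym ztn.
    by rewrite (proj2 same4) // (proj2 hsame).
  have [Px' hF'] := frank_wolfe_step Px Pv.
  apply: (@wp_vset _ _ _ _ _ _ B0 _ _ (x + h *: (v - x))) => //=; first by rewrite eN.
    move=> j s' hN h6 hR; rewrite h6 !hR ?leqnn ?orbT // hN // eN // sT.
    by rewrite -e14 -e13 !mxE mulrC.
  set s5 := nset (nset _ 6 n) 9 k.+1.
  have hE : get_constraints (n := n) s5 11 (nmem s5 8) = cs.
    by rewrite -hcs /= e8; apply: get_constraints_eq => // j; rewrite /= e11.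
  have r5 : get_row s5 14 = x + h *: (v - x) by rewrite get_row_nset get_row_nset get_row_set_row.
  split=> //; split=> //=; rewrite ?e8 //.
    by apply: same_nset => //; apply: same_nset => //; apply: same_set_row.
  rewrite r5; split=> //.
  - apply: polyhedron_combination => //.
    have T0 : 0 < T%:R :> R by rewrite ltr0n.
    by rewrite invr_ge0 (ltW T0) /= invf_le1 // ler1n.
  - move=> _; rewrite get_row_nset get_row_nset get_row_set_row_neq ?ztn //.
  - apply: le_trans hF'.
    have h0 : 0 <= h by rewrite invr_ge0 ler0n.
    have := ler_wpM2l h0 b1; have := ler_wpM2l h0 b2; move: hF; rewrite -natr1 -/gap.
    by rewrite /=; set e := err; set q := rmem s4 _ _; set q' := rmem s _ _; lra.
apply: wp_if => /=.
  rewrite -/s3 h9 => hb; apply/wp_seq/wp_rset => /=.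
  apply: (@wp_vcopy _ _ _ _ _ _ B0) => //=; first by rewrite eq_sym ztn.
  rewrite (_ : get_row _ 14 = x) //; split => //.
  - apply: same_nset => //; apply: same_set_row; first by rewrite /ls_rows eqxx orbT.
    exact: same_rset.
  - by rewrite !get_row_nset !get_row_set_row_neq ?zti.
  - by rewrite get_row_nset get_row_set_row /= zti.
  - rewrite /= zti //=; split=> //.
    have [->|k0] := posnP k; first by rewrite !mul0r.
    by move: hb; rewrite k0 /= -ltNge => /ltW hb; rewrite ler_wpM2l.
rewrite -/s3 h9 negbK => /andP[k0 hb]; apply: wp_skip; split=> //.
by rewrite zs3; exact: hst.
Qed.

(** Wrong guesses may make the cut body empty; the search then runs on [P] itself, so membership in
    [P] always holds and only stationarity is conditional. *)
Lemma wp_local_search zt s (Q : state R -> Prop) : (20 <= zt)%N ->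
  nmem s 0 = n -> nmem s 2 = T -> nmem s 4 = (T * m)%N ->
  (forall s', same ls_cells (ls_rows zt) s s' -> P (get_row s' zt) ->
    (P `&` polyhedron (cut s) !=set0 ->
       stationary (m%:R^-1 * O + 2 * err) (cut s) (get_row s' zt)) -> Q s') ->
  wp (local_search zt) Q s.
Proof.
move=> zt20 sn sT sK HQ.
pose J s1 := [/\ same ls_cells (ls_rows zt) s s1, (nmem s1 8 <= 1)%N,
   P (get_row s1 14),
   polyhedron (get_constraints s1 11 (nmem s1 8)) (get_row s1 14 : 'rV[R]_n) &
   P `&` polyhedron (cut s) !=set0 -> nmem s1 8 = 1%N].
have P0 : P !=set0 by case: P_body.
apply/wp_seq/wp_nset/wp_seq/wp_solve => //.
have -> : do_solve solve (nset s 8 1) 11 1 12 14 7 =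
    if solve (cut s) (get_row s 12) is Some v
    then nset (set_row (nset s 8 1) 14 v) 7 1 else nset (nset s 8 1) 7 0 by [].
apply: wp_seq; apply: (@wp_mono _ _ _ _ _ _ _ J).
  move=> s1 [same1 h8 Px Qx hne].
  have e1 a : ~~ ls_cells a -> nmem s1 a = nmem s a by apply: (proj1 same1).
  set cs := get_constraints s1 11 (nmem s1 8) in Qx.
  apply: (@wp_for _ _ _ _ _ _ _ _ _ (T * m)%N (ls_inv zt s cs)) => //.
  - by move=> k s2 [[hN _] h9 _ _ _]; rewrite hN.
  - split=> //; first exact: same_nset.
    by split=> //; rewrite !mul0r subr0; exact: F_ge0 (P_cube _).
  - move=> k s2 kK I; apply: wp_local_search_step => //.
      by case: I => [[hN _] _ _ _ _]; rewrite hN.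
    by case: I => [[hN _] _ _ _ _]; rewrite hN.
  - move=> s2 [same2 h9 h82 hcs [Px2 Qx2 hst hF]].
    have K0 : (0 < T * m)%N by rewrite muln_gt0 T_gt0.
    have [Pz Qz hz] := hst K0.
    apply: HQ => // hne'; have := hne hne'.
    move=> e8; have csE : cs = cut s.
      rewrite /cs e8; apply: get_constraints_eq => // j.
      by apply: (proj2 same1); rewrite /ls_rows /= ltn_eqF //; apply: leq_trans zt20.
    rewrite csE in Qz hz; split=> // v Pv Qv; apply: (le_trans (hz v Pv Qv)).
    (* After [T * m] steps of length [1 / T] the telescoped gain reads
       [m * gap - 2 * m * err <= F x <= O]. *)
    have := le_trans hF (F_le Px2).
    have T0 : T%:R != 0 :> R by rewrite pnatr_eq0 -lt0n.
    have mp : 0 < m%:R :> R by rewrite ltr0n.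
    have -> : (T * m)%:R / T%:R = m%:R :> R by rewrite natrM; field.
    have -> : (T * m)%:R * (2 / T%:R * err) = m%:R * (2 * err) by rewrite natrM; field.
    rewrite -mulrBr mulrC -ler_pdivlMr // mulrC; lra.
have := P_solve (cut s) (get_row s 12).
case: (solve (cut s) (get_row s 12)) => [v [[Pv Qv] hv]|he].
  apply: wp_if => //= _; apply: wp_skip; split=> //.
  - apply: same_nset => //; apply: same_set_row => //; exact: same_nset.
  - by rewrite get_row_nset get_row_set_row.
  - by rewrite get_row_nset get_row_set_row.
apply: wp_if => //= _; apply/wp_seq/wp_nset/wp_solve => //.
have -> : do_solve solve (nset (nset (nset s 8 1) 7 0) 8 0) 11 0 12 14 7 =
    if solve [::] (get_row s 12) is Some v
    then nset (set_row (nset (nset (nset s 8 1) 7 0) 8 0) 14 v) 7 1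
    else nset (nset (nset (nset s 8 1) 7 0) 8 0) 7 0 by [].
have := P_solve [::] (get_row s 12).
case: (solve [::] (get_row s 12)) => [v [[Pv Qv] hv]|he']; last first.
  case: P0 => x Px; have : (P `&` polyhedron [::]) x by split=> // c; rewrite in_nil.
  by rewrite he'.
split=> //.
- by apply: same_nset => //; apply: same_set_row => //; do 3 apply: same_nset => //.
- by rewrite get_row_nset get_row_set_row.
- by rewrite he => -[].
Qed.

End LocalSearch.

(* Columns of row 10: [val] and [arg] receive the maximum and a maximizer over the grid;
   6 and 7 are scratch. *)
Definition grid_argmax (zr r val arg : nat) : cmd :=
  Seq (RSet (NLit r) (cellN 10) (RNat (NLit 0)))
  (Seq (QueryF (NLit r) (NLit 10) (NLit val))
  (Seq (RSet (NLit 10) (NLit arg) (RNat (NLit 0)))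
  (For 13 2
    (Seq (RSet (NLit 10) (NLit 6)
      (RDiv (RMul (RMem (NLit zr) (cellN 10)) (RAdd (RNat (cellN 13)) (RNat (NLit 1))))
        (RNat (cellN 2))))
    (Seq (RSet (NLit r) (cellN 10) (cellR 10 6))
    (Seq (QueryF (NLit r) (NLit 10) (NLit 7))
      (If (BRle (cellR 10 7) (cellR 10 val)) Skip
        (Seq (RSet (NLit 10) (NLit val) (cellR 10 7))
             (RSet (NLit 10) (NLit arg) (cellR 10 6)))))))))).

(** Columns 4 and 5 of row 10 keep the values before the grid searches overwrite the coordinate; 0
    to 3 are the two maxima and maximizers, 8 the weighted average. If both gains vanish, division
    by zero yields 0, the choice that [double_greedy_coordinate] analyses. *)
Definition double_greedy_body (zr : nat) : cmd :=
  Seq (QueryF (NLit 15) (NLit 10) (NLit 4))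
  (Seq (QueryF (NLit 16) (NLit 10) (NLit 5))
  (Seq (grid_argmax zr 15 0 1)
  (Seq (grid_argmax zr 16 2 3)
  (Seq (RSet (NLit 10) (NLit 8)
     (RDiv (RAdd (RMul (RSub (cellR 10 0) (cellR 10 4)) (cellR 10 1))
                 (RMul (RSub (cellR 10 2) (cellR 10 5)) (cellR 10 3)))
           (RAdd (RSub (cellR 10 0) (cellR 10 4)) (RSub (cellR 10 2) (cellR 10 5)))))
  (Seq (RSet (NLit 15) (cellN 10) (cellR 10 8))
       (RSet (NLit 16) (cellN 10) (cellR 10 8))))))).

Definition double_greedy (zr : nat) : cmd :=
  Seq (vset 15 (RNat (NLit 0)))
  (Seq (vcopy zr 16) (For 10 0 (double_greedy_body zr))).

(** * Correctness of the double greedy program *)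

Section DoubleGreedyProgram.
Context {R : realType} {n : nat}.
Variables (F : 'rV[R]_n -> R) (G : 'rV[R]_n -> 'rV[R]_n) (L D : R) (P : set 'rV[R]_n).
Variable solve : seq ('rV[R]_n * R) -> 'rV[R]_n -> option 'rV[R]_n.
Variable B : nat -> nat.
Hypothesis F_ge0 : forall x, cube x -> 0 <= F x.
Hypothesis F_dr : dr_submodular F.
Hypothesis F_grad : gradient_on_cube F G.
Hypothesis G_smooth : smooth L G.
Hypothesis P_cube : P `<=` cube.
Hypothesis P_body : convex_body P.
Hypothesis P_down : down_closed P.
Hypothesis P_diam : has_diameter D P.
Variables (T : nat).
Hypothesis T_gt0 : (0 < T)%N.
Hypothesis B0 : (n <= B 0)%N.
Hypothesis B2 : (T <= B 2)%N.
Implicit Types (s : state R) (Q : state R -> Prop) (x y z v w : 'rV[R]_n).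
Local Notation wp := (wp F G solve B).
Local Notation h := (T%:R^-1 : R).
Local Notation err := (L * D ^+ 2 * h).

Definition grid_frame (r val arg u : nat) s s' :=
  (forall a : nat, a != 13%N -> nmem s' a = nmem s a) /\
  (forall i j : nat, ~~ ((i == 10%N) && (j \in [:: val; arg; 6%N; 7%N])) ->
     ~~ ((i == r) && (j == u)) -> rmem s' i j = rmem s i j).

Lemma grid_frame_upd (r val arg : nat) (u : 'I_n) s s' (t : R) : r != 10%N ->
  grid_frame r val arg u s s' ->
  upd (get_row s' r) u t = upd (get_row s r) u t.
Proof.
move=> r10 [_ hR]; apply/rowP => j; rewrite !mxE; case: eqVneq => // ju.
by rewrite hR ?(negbTE r10) // eqxx /= val_eqE.
Qed.

Lemma wp_grid_argmax (zr r val arg : nat) (u : 'I_n) s Q : (20 <= zr)%N ->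
  (r == 15%N) || (r == 16%N) -> (val < 6)%N -> (arg < 6)%N -> val != arg ->
  nmem s 10 = u -> nmem s 2 = T ->
  (forall s', grid_frame r val arg u s s' ->
    (exists2 i, (i <= T)%N & rmem s' 10 arg = rmem s zr u * i%:R / T%:R) ->
    rmem s' 10 val = F (upd (get_row s r) u (rmem s' 10 arg)) ->
    (forall i, (i <= T)%N -> F (upd (get_row s r) u (rmem s zr u * i%:R / T%:R)) <= rmem s' 10 val) ->
    Q s') ->
  wp (grid_argmax zr r val arg) Q s.
Proof.
move=> zr20 hr v6 a6 va s10 s2 HQ.
set c := rmem s zr u; set x : 'rV[R]_n := get_row s r.
have r10 : (r == 10%N) = false by case/orP: hr => /eqP ->.
have r10' : (10%N == r) = false by rewrite eq_sym.
have zr10 : (zr == 10%N) = false by apply: gtn_eqF; apply: leq_trans zr20.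
have zrr : (zr == r) = false.
  by apply: gtn_eqF; apply: leq_trans zr20; case/orP: hr => /eqP ->.
have av : (arg == val) = false by rewrite eq_sym (negbTE va).
have va' := negbTE va.
have lt6 q : (q < 6)%N -> [/\ (q == 6%N) = false, (q == 7%N) = false, (6%N == q) = false & (7%N == q) = false].
  by move=> hq; split; lia.
have [v6a v7a v6b v7b] := lt6 _ v6; have [a6a a7a a6b a7b] := lt6 _ a6.
have frn s' k : grid_frame r val arg u s s' -> grid_frame r val arg u s (nset s' 13 k).
  by case=> hN hR; split=> // a ha /=; rewrite (negbTE ha) hN.
pose I k s' := [/\ grid_frame r val arg u s s', nmem s' 13 = k,
  exists2 i, (i <= k)%N & rmem s' 10 arg = c * i%:R / T%:R,
  rmem s' 10 val = F (upd x u (rmem s' 10 arg)) &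
  forall i, (i <= k)%N -> F (upd x u (c * i%:R / T%:R)) <= rmem s' 10 val].
apply/wp_seq/wp_rset/wp_seq/wp_queryF/wp_seq/wp_rset => /=.
rewrite s10 get_row_rset -/x.
apply: (@wp_for _ _ _ _ _ _ _ _ _ T I) => //.
- by move=> k s' [[hN _] h13 _ _ _]; rewrite hN.
- split=> //.
  + split=> [a /negbTE /= -> //|i j /= h1 h2].
    move: h1; rewrite !inE negb_and !negb_or; case: eqP => [->|_] //=.
      by move=> /and4P[/negbTE -> /negbTE -> _ _]; rewrite r10'.
    by rewrite (negbTE h2).
  + by exists 0%N => //=; rewrite eqxx mulr0 mul0r.
  + by rewrite /= !eqxx /= va' .
  + by move=> i; rewrite leqn0 => /eqP ->; rewrite /= !eqxx va' /= mulr0 mul0r.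
- move=> k s' kT [hfr h13 [i0 ik harg] hval hmax].
  have [hN hR] := hfr.
  have zu : rmem s' zr u = c by rewrite hR ?zr10 ?zrr.
  apply/wp_seq/wp_rset/wp_seq/wp_rset/wp_seq/wp_queryF => /=.
  rewrite (hN 10%N) // (hN 2%N) // s10 h13 s2 zu natr1.
  set t := c * _ / _.
  rewrite get_row_rset get_row_rset_neq ?r10 // (grid_frame_upd _ _ hfr) ?r10 // -/x.
  set fx := F (upd x u t).
  set s1 := rset _ 10 7 fx.
  have fr1 : grid_frame r val arg u s s1.
    split=> [a ha|i j h1 h2]; first exact: hN.
    rewrite -(hR i j h1 h2) /= (negbTE h2).
    move: h1; rewrite !inE negb_and !negb_or; case: eqP => [->|_] //=.
    by move=> /and4P[_ _ /negbTE -> /negbTE ->].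
  have e7 : rmem s1 10 7 = fx by [].
  have e6 : rmem s1 10 6 = t by rewrite /= r10' /=.
  have ev : rmem s1 10 val = rmem s' 10 val by rewrite /= v7a v6a r10'.
  have ea : rmem s1 10 arg = rmem s' 10 arg by rewrite /= a7a a6a r10'.
  apply: wp_if => hb; rewrite [beval _ _]/= -/(rmem s1 10 7) -/(rmem s1 10 val) in hb.
    apply: wp_skip; split=> //; split=> //.
    + exact: frn.
    + by exists i0 => //; [exact: leqW|rewrite [LHS]ea].
    + by rewrite [LHS]ev hval; congr (F (upd _ _ _)); rewrite -ea.
    + move=> i; rewrite leq_eqVlt ltnS => /orP[/eqP ->|ik']; first exact: hb.
      by rewrite [leRHS]ev; exact: hmax.
  apply/wp_seq/wp_rset/wp_rset; rewrite -ltNge in hb.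
  have E1 : rmem (rset s1 10 val fx) 10 6 = t by rewrite /= v6b /= r10'.
  have -> : rset s1 (neval s1 (NLit 10)) (neval s1 (NLit val)) (reval s1 (cellR 10 7)) =
    rset s1 10 val fx by [].
  set s2' := rset s1 10 val fx in E1 *.
  have -> : rset s2' (neval s2' (NLit 10)) (neval s2' (NLit arg)) (reval s2' (cellR 10 6)) =
    rset s2' 10 arg t by rewrite -[in RHS]E1.
  split=> //; split=> //.
  + apply: frn; case: fr1 => hN1 hR1; split=> // i j h1 h2.
    rewrite -(hR1 i j h1 h2) /=; move: h1; rewrite !inE negb_and !negb_or.
    case: eqP => [->|_] //= /and4P[/negbTE -> /negbTE -> _ _].
    by [].
  + by exists k.+1 => //=; rewrite eqxx.
  + by rewrite /= !eqxx /= va'.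
  + move=> i; have -> : rmem (nset (rset s2' 10 arg t) 13 k.+1) 10 val = fx.
      by rewrite /= va' eqxx.
    rewrite leq_eqVlt ltnS => /orP[/eqP ->|ik'] //.
    have hb' : rmem s' 10 val < fx by rewrite -ev; exact: hb.
    exact: le_trans (hmax _ ik') (ltW hb').
- move=> s' [hfr _ [i0 iT harg] hval hmax]; apply: HQ => //.
  by exists i0.
Qed.

Lemma wp_double_greedy (zr : nat) s Q : (20 <= zr)%N -> nmem s 0 = n -> nmem s 2 = T ->
  P (get_row s zr) ->
  (forall s', same ls_cells (fun i => 10 <= i < 19)%N s s' -> P (get_row s' 15) ->
     (forall o r, cube o -> 0 <= r ->
       r ^+ 2 * F (get_row s zr) + 2 * r * F (vmul (get_row s zr) o) <=
         (1 + r) ^+ 2 * F (get_row s' 15) + 2 * r * err) -> Q s') ->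
  wp (double_greedy zr) Q s.
Proof.
move=> zr20 s0 s2 Pz HQ.
set z : 'rV[R]_n := get_row s zr in Pz HQ *.
have cz := P_cube Pz.
have zr15 : (zr == 15%N) = false by apply: gtn_eqF; apply: leq_trans zr20.
have zr10 : (zr == 10%N) = false by apply: gtn_eqF; apply: leq_trans zr20.
have zr16 : (zr == 16%N) = false by apply: gtn_eqF; apply: leq_trans zr20.
apply: wp_seq; apply: (@wp_vset _ _ _ _ _ _ B0 _ _ 0) => //.
  by move=> j s1 _ _ _; rewrite mxE.
apply: wp_seq; apply: (@wp_vcopy _ _ _ _ _ _ B0) => //; first by rewrite zr16.
rewrite get_row_nset get_row_set_row_neq ?zr15 // -/z.
set s1 := nset (set_row _ 16 z) 6 n.
pose I k s' := [/\ same ls_cells (fun i => 10 <= i < 19)%N s s', nmem s' 10 = k,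
  double_greedy_state z k (get_row s' 15) (get_row s' 16) &
  forall o r, cube o -> 0 <= r ->
    r ^+ 2 * F z + 2 * r * F (vmul z o) <=
      double_greedy_potential F r z o k (get_row s' 15) (get_row s' 16) +
      2 * r * (L * h ^+ 2 * \sum_(j < n | (j < k)%N) z 0 j ^+ 2)].
apply: (@wp_for _ _ _ _ _ _ _ _ _ n I) => //.
- by move=> k s' [[hN _] h10 _ _]; rewrite hN.
- have e15 : get_row (nset s1 10 0) 15 = (0 : 'rV[R]_n).
    by apply/rowP => j; rewrite mxE /= valK.
  have e16 : get_row (nset s1 10 0) 16 = z by apply/rowP => j; rewrite mxE /= valK.
  split=> //.
  + do 2 apply: same_nset => //; apply: same_set_row => //; apply: same_nset => //.
    exact: same_set_row.
  + by rewrite e15 e16; exact: double_greedy_init.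
  + move=> o r co r0; rewrite e15 e16 big_pred0 // mulr0 mulr0 addr0 /double_greedy_potential.
    have -> : settled 0 0 (vmul z o) = vmul z o by apply/rowP => j; rewrite mxE.
    by have := F_ge0 (@cube0 R n); lra.
- move=> k s' kn [hsame h10 hst hpot].
  have [u uE] : exists u : 'I_n, k = u by exists (Ordinal kn).
  rewrite {k}uE in kn h10 hst hpot *.
  have [hN hR] := hsame.
  have e2 : nmem s' 2 = T by rewrite hN.
  have zE : rmem s' zr u = z 0 u.
    by rewrite hR ?mxE // /=; apply/negP => /andP[_]; rewrite ltnNge (leq_trans _ zr20).
  set x : 'rV[R]_n := get_row s' 15 in hst hpot.
  set y : 'rV[R]_n := get_row s' 16 in hst hpot.
  apply/wp_seq/wp_queryF/wp_seq/wp_queryF.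
  set s2' := rset _ _ _ _.
  have x2 : get_row s2' 15 = x by apply/rowP => j; rewrite !mxE.
  have y2 : get_row s2' 16 = y by apply/rowP => j; rewrite !mxE.
  apply: wp_seq; apply: (wp_grid_argmax (u := u)) => // s3 fr3 [ia iaT aE] aV aM.
  have [N3 R3] := fr3.
  have z3 : rmem s3 zr u = z 0 u.
    by rewrite R3 ?zr10 ?zr15 // -zE /s2' /= zr10.
  have y3 : get_row s3 16 = y by rewrite -y2; apply: get_row_eq => j; rewrite R3.
  apply: wp_seq; apply: (wp_grid_argmax (u := u)) => //; try by rewrite N3.
  move=> s4 fr4 [ib ibT bE] bV bM.
  have [N4 R4] := fr4.
  have x3 : get_row s3 15 = upd x u (rmem s3 15 u).
    apply/rowP => j; rewrite !mxE; case: eqVneq => [-> //|ju].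
    by rewrite R3 //= val_eqE.
  have z4 : rmem s4 zr u = z 0 u by rewrite R4 ?zr10 ?zr16.
  set ta := rmem s3 10 1 in aE aV; set tb := rmem s4 10 3 in bE bV.
  have f1 : rmem s4 10 1 = ta by rewrite R4.
  have f0 : rmem s4 10 0 = F (upd x u ta) by rewrite R4 // aV x2.
  have f4 : rmem s4 10 4 = F x by rewrite R4 // R3.
  have f5 : rmem s4 10 5 = F y.
    by rewrite R4 // R3 // /s2' /= get_row_rset_neq.
  have f2 : rmem s4 10 2 = F (upd y u tb) by rewrite bV y3.
  pose da := F (upd x u ta) - F x; pose db := F (upd y u tb) - F y.
  pose t := (da * ta + db * tb) / (da + db).
  apply/wp_seq/wp_rset; set s5 := rset _ _ _ _.
  have s5E : s5 = rset s4 10 8 t by rewrite /s5 /= f0 f1 f2 f4 f5.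
  have e10 : nmem s4 10 = u by rewrite N4 // N3.
  apply/wp_seq/wp_rset/wp_rset; rewrite s5E /= e10.
  set s6 := rset _ _ _ _.
  have x6 : get_row s6 15 = upd x u t.
    apply/rowP => j; rewrite !mxE /= val_eqE; case: eqVneq => // ju /=.
    by rewrite R4 //= R3 //= ?val_eqE.
  have y6 : get_row s6 16 = upd y u t.
    apply/rowP => j; rewrite !mxE /= val_eqE; case: eqVneq => // ju /=.
    by rewrite R4 //= ?R3 //= ?val_eqE.
  split; first by [].
  have same6 : same ls_cells (fun i => 10 <= i < 19)%N s (nset s6 10 u.+1).
    apply: same_nset => //; do 3 apply: same_rset => //; split=> [a ha|i hi j].
      by rewrite N4 ?N3 ?hN //; apply: contra ha => /eqP ->.
    have h1 : (i == 10%N) = false by apply: contraNF hi => /eqP ->.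
    have h2 : (i == 15%N) = false by apply: contraNF hi => /eqP ->.
    have h3 : (i == 16%N) = false by apply: contraNF hi => /eqP ->.
    by rewrite R4 ?h1 ?h3 // R3 ?h1 ?h2 // /s2' /= h1 /= hR.
  have z2 : rmem s2' zr u = z 0 u by rewrite /s2' /= zr10.
  have ga : exists2 i, (i <= T)%N & ta = z 0 u * i%:R / T%:R by exists ia; rewrite // aE z2.
  have gb : exists2 i, (i <= T)%N & tb = z 0 u * i%:R / T%:R by exists ib; rewrite // bE z3.
  have ma i : (i <= T)%N -> F (upd x u (z 0 u * i%:R / T%:R)) <= F (upd x u ta).
    by move=> iT'; have := aM i iT'; rewrite aV x2 z2.
  have mb i : (i <= T)%N -> F (upd y u (z 0 u * i%:R / T%:R)) <= F (upd y u tb).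
    by move=> iT'; have := bM i iT'; rewrite bV y3 z3.
  have step o r (co : cube o) (r0 : 0 <= r) :=
    @double_greedy_step _ _ F G L F_dr F_grad G_smooth z o x y u T ta tb r cz co T_gt0 r0 hst ga gb ma mb.
  rewrite /I !get_row_nset x6 y6; split=> //.
    by have [] := step _ _ cz (lexx 0).
  move=> o r co r0; have [_ hs] := step o r co r0; apply: le_trans (hpot o r co r0) _.
  have -> : \sum_(j < n | (j < u.+1)%N) z 0 j ^+ 2 =
      z 0 u ^+ 2 + \sum_(j < n | (j < u)%N) z 0 j ^+ 2.
    rewrite (bigD1 u) //=; congr (_ + _); apply: eq_bigl => j.
    by rewrite ltnS [RHS]ltn_neqAle andbC -val_eqE.
  rewrite mulrDr mulrDr addrA lerD2r; apply: le_trans hs _.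
  rewrite lerD2l le_eqVlt; apply/orP; left; apply/eqP; ring.
- move=> s' [hsame _ hst hpot]; have [hx [_ _]] := hst.
  have hfin o r : double_greedy_potential F r z o n (get_row s' 15) (get_row s' 16) =
      (1 + r) ^+ 2 * F (get_row s' 15) by exact: double_greedy_final.
  apply: HQ => //.
    by apply: (P_down Pz) => j; rewrite ?mxE; have /andP[] := hx j; rewrite ?mxE.
  move=> o r co r0; apply: le_trans (hpot o r co r0) _; rewrite hfin lerD2l.
  have [L0 _] := G_smooth.
  have T0 : 0 < T%:R :> R by rewrite ltr0n.
  have h01 : 0 <= h <= 1 by rewrite invr_ge0 (ltW T0) /= invf_le1 // ler1n.
  have -> : \sum_(j < n | (j < n)%N) z 0 j ^+ 2 = norm2 z ^+ 2.
    by rewrite sqr_norm2; apply: eq_bigl => j; rewrite ltn_ord.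
  have nz : norm2 z ^+ 2 <= D ^+ 2.
    by rewrite lerXn2r ?nnegrE ?norm2_ge0 ?(diam_ge0 P_cube P_body P_down P_diam) //
      (body_norm P_cube P_body P_down P_diam).
  rewrite ler_wpM2l ?mulr_ge0 //.
  (* The grid errors [L * (z_j / T)^2] sum to [L h^2 |z|^2], which is below [err] even by a further
     factor [h]. *)
  have h2 : h ^+ 2 * norm2 z ^+ 2 <= h * D ^+ 2.
    have hh : h ^+ 2 <= h by rewrite expr2 ler_piMl //; case/andP: h01.
    by apply: ler_pM => //; rewrite ?sqr_ge0.
  by rewrite -mulrA -[leRHS]mulrA ler_wpM2l // [D ^+ 2 * h]mulrC.
Qed.

End DoubleGreedyProgram.

Definition candidate (r : nat) : cmd :=
  Seq (QueryF (NLit r) (NLit 10) (NLit 0))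
  (Seq (QueryF (NLit 0) (NLit 10) (NLit 1))
    (If (BRle (cellR 10 1) (cellR 10 0)) (vcopy r 0) Skip)).

(** The guessed value can be as low as [- 2 * F o]; the shift by [3 T] units, worth at least
    [3 * F o], lets a natural counter reach it. *)
Definition guess_p (c : nat) : rexp :=
  RMul (RSub (RNat (cellN c)) (RMul (RNat (NLit 3)) (RNat (cellN 2)))) (cellR 1 1).
Definition guess (c : nat) : rexp := RMul (RNat (cellN c)) (cellR 1 1).
Definition room (yr zr : nat) : rexp :=
  RSub (RSub (RNat (NLit 1)) (entry yr)) (RMul (cellR 19 0) (entry zr)).

(** Cell (19, 0) holds [avoid], cell (10, 4) the threshold. The oracle takes upper bounds, so row 11
    stores minus the direction, with right-hand side [F y] minus the threshold. [rec] then searches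
    below the iterate left in row [zt]. *)
Definition greedy_body (yr zr zt cp ca cx ci : nat) (rec : cmd) : cmd :=
  Seq (theta_pow 10 2 (cellN ci))
  (Seq (theta_pow 10 3 (NSub (cellN ci) (cellN 3)))
  (Seq (If (BNle (NAdd (cellN ci) (NLit 1)) (cellN 3))
    (Seq (RSet (NLit 19) (NLit 0) (RNat (NLit 1)))
      (RSet (NLit 10) (NLit 4) (RAdd (guess_p cp) (RMul (cellR 10 2) (guess ca)))))
    (Seq (RSet (NLit 19) (NLit 0) (RNat (NLit 0)))
      (RSet (NLit 10) (NLit 4) (RAdd (RMul (cellR 10 3) (guess cx))
        (RMul (RMul (RDiv (RNat (NSub (cellN ci) (cellN 3))) (RNat (cellN 2))) (cellR 10 2))
          (guess ca))))))
  (Seq (QueryGrad (NLit yr) (NLit 12))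
  (Seq (vset 11 (RSub (RNat (NLit 0)) (RMul (entry 12) (room yr zr))))
  (Seq (QueryF (NLit yr) (NLit 10) (NLit 5))
  (Seq (RSet (NLit 11) (cellN 0) (RSub (cellR 10 5) (cellR 10 4)))
  (Seq (local_search zt)
  (Seq (vset yr (RAdd (entry yr) (RDiv (RMul (entry zt) (room yr zr)) (RNat (cellN 2)))))
    rec)))))))).

Section Search.
Context {R : realType} {n : nat}.
Variables (F : 'rV[R]_n -> R) (G : 'rV[R]_n -> 'rV[R]_n) (L D : R) (P : set 'rV[R]_n).
Variable solve : seq ('rV[R]_n * R) -> 'rV[R]_n -> option 'rV[R]_n.
Variable B : nat -> nat.
Hypothesis F_ge0 : forall x, cube x -> 0 <= F x.
Hypothesis F_dr : dr_submodular F.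
Hypothesis F_grad : gradient_on_cube F G.
Hypothesis G_smooth : smooth L G.
Hypothesis P_cube : P `<=` cube.
Hypothesis P_body : convex_body P.
Hypothesis P_down : down_closed P.
Hypothesis P_diam : has_diameter D P.
Hypothesis P_solve : meta_solver P solve.
Variables (T m q : nat) (o : 'rV[R]_n) (eta : R).
Hypothesis T_gt0 : (0 < T)%N.
Hypothesis m_gt0 : (0 < m)%N.
Hypothesis o_max : maximizer F P o.
Hypothesis B0 : (n <= B 0)%N.
Hypothesis B2 : (T <= B 2)%N.
Hypothesis B4 : (T * m <= B 4)%N.
Hypothesis B5 : (5 * T <= B 5)%N.
Hypothesis B12 : (T <= B 12)%N.
Implicit Types (s : state R) (N M Q : pred nat) (x y z v w : 'rV[R]_n).
Local Notation wp := (wp F G solve B).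
Local Notation h := (T%:R^-1 : R).
Local Notation err := (L * D ^+ 2 * h).
Local Notation O := (F o).
Local Notation eps := (m%:R^-1 : R).
Local Notation sw := (11 * q)%N.
Local Notation best s := (F (get_row s 0)).

Lemma row_entry s r v (j : 'I_n) : get_row s r = v -> rmem s r j = v 0 j.
Proof. by move=> <-; rewrite mxE. Qed.

Definition constants s :=
  [/\ nmem s 0 = n, nmem s 2 = T, nmem s 3 = sw, nmem s 4 = (T * m)%N &
      nmem s 5 = (5 * T)%N /\ rmem s 1 1 = eta].

Definition improves (N Q : pred nat) s s' :=
  [/\ same N Q s s', P (get_row s' 0) & best s <= best s'].

Lemma improves_trans N Q s1 s2 s3 : improves N Q s1 s2 -> improves N Q s2 s3 ->
  improves N Q s1 s3.
Proof.
move=> [a1 _ c1] [a2 b2 c2]; split=> //; last exact: le_trans c1 c2.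
exact: same_trans a1 a2.
Qed.

Lemma improves_sub (N Q N' Q' : pred nat) s s' : (forall a, N a -> N' a) ->
  (forall a, Q a -> Q' a) ->
  improves N Q s s' -> improves N' Q' s s'.
Proof. by move=> h1 h2 [a b c]; split=> //; exact: same_sub h1 h2 a. Qed.

Lemma wp_candidate (r : nat) s (X : state R -> Prop) : nmem s 0 = n -> (10 < r)%N ->
  P (get_row s r) -> P (get_row s 0) ->
  (forall s', improves (fun a => a == 6%N) (fun i => (i == 0%N) || (i == 10%N)) s s' ->
     F (get_row s r) <= best s' -> X s') ->
  wp (candidate r) X s.
Proof.
move=> s0 r10 Pr P0 HX.
have r0 : (r == 0%N) = false by apply: gtn_eqF; apply: ltn_trans r10.
have rn : (r == 10%N) = false by apply: gtn_eqF.
apply/wp_seq/wp_queryF/wp_seq/wp_queryF.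
set s1 := rset _ _ _ _.
have e0 i : i != 10%N -> get_row (n := n) s1 i = get_row s i.
  by move=> hi; apply/rowP => j; rewrite !mxE /= (negbTE hi).
have e1 : rmem s1 10 0 = F (get_row s r) by [].
have e2 : rmem s1 10 1 = best s by rewrite /= get_row_rset_neq.
have same1 : same (fun a => a == 6%N) (fun i => (i == 0%N) || (i == 10%N)) s s1.
  by do 2 apply: same_rset => //.
apply: wp_if => hb.
  have hb' : best s <= F (get_row s r) by rewrite -e1 -e2; exact: hb.
  apply: (@wp_vcopy _ _ _ _ _ _ B0) => //; first by rewrite r0.
  rewrite e0 ?rn //; apply: HX; last by rewrite get_row_nset get_row_set_row.
  split; rewrite ?get_row_nset ?get_row_set_row //.
  by apply: same_nset => //; apply: same_set_row.
have hb' : F (get_row s r) < best s by rewrite ltNge -e1 -e2; exact: hb.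
by apply: wp_skip; apply: HX; [split=> //; rewrite e0|rewrite e0 // ltW].
Qed.

(* [Good] holds the assumptions under which the index [k0] leads to a good candidate. *)
Lemma wp_for_improves (N M : pred nat) (Q : pred nat) (c b K k0 : nat) body s0
    (tgt : R) (Good : Prop) (X : state R -> Prop) :
  (K <= B b)%N -> nmem s0 b = K -> ~~ N b -> N c -> ~~ M c -> (forall a, M a -> N a) ->
  P (get_row s0 0) ->
  (forall k s, (k < K)%N -> nmem s c = k -> improves N Q s0 s ->
     wp body (fun s' => improves M Q s s' /\ (Good -> k = k0 -> tgt <= best s')) s) ->
  (forall s', improves N Q s0 s' -> (Good -> (k0 < K)%N -> tgt <= best s') -> X s') ->
  wp (For c b body) X s0.
Proof.
move=> KB s0b Nb Nc Mc MN P0 Hb HX.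
pose I k s := [/\ nmem s c = k, improves N Q s0 s & Good -> (k0 < k)%N -> tgt <= best s].
apply: (@wp_for _ _ _ _ _ _ _ _ _ K I) => //.
- by move=> k s [hc [[hN _] _ _] _]; rewrite hN.
- split=> //=; first by rewrite eqxx.
  by split=> //; exact: same_nset.
- move=> k s kK [hc imp hg]; apply: wp_mono (Hb k s kK hc imp) => s' [imp' hg'].
  have cE : nmem s' c = k by case: imp' => [[hM _] _ _]; rewrite hM.
  split=> //; split=> /=; first by rewrite eqxx.
    have [a b' c'] := improves_trans imp (improves_sub MN (fun _ => id) imp').
    by split=> //; exact: same_nset.
  move=> good; rewrite ltnS leq_eqVlt => /orP[/eqP kE|kk0].
    exact: hg'.
  by apply: le_trans (hg good kk0) _; case: imp'.
- by move=> s' [_ imp hg]; apply: HX.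
Qed.

(** The promise of the recursive call: a locally optimal iterate whose join with [o] has dropped
    below [kap] leads to the target. *)
Definition greedy_rec_spec (tgt kap : R) (N Q : pred nat) (zt : nat) (rec : cmd) :=
  forall s (X : state R -> Prop), constants s -> P (get_row s 0) -> P (get_row s zt) ->
  (forall s', improves N Q s s' ->
    (F (vadd (get_row s zt) o) + F (vmul (get_row s zt) o) <=
       2 * F (get_row s zt) + (eps * O + 2 * err) ->
     F (vadd (get_row s zt) o) < kap -> tgt <= best s') -> X s') ->
  wp rec X s.

(** That [y] advances by some point of [P] holds for all guesses; everything about values is
    conditional on [o] meeting the threshold, which right guesses ensure. *)
Lemma wp_greedy_body (yr zr zt cp ca cx ci : nat) (rec : cmd) (N Q : pred nat)
    (tgt kap : R) (i : nat) s :
  let z : 'rV[R]_n := get_row s zr in let y : 'rV[R]_n := get_row s yr in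
  let p := ((nmem s cp)%:R - 3%:R * T%:R) * eta in
  let A := (nmem s ca)%:R * eta in let X := (nmem s cx)%:R * eta in
  [/\ (20 <= yr)%N, (20 <= zr)%N, (20 <= zt)%N, yr != zr & zt != yr /\ zt != zr] ->
  [/\ (20 <= cp)%N, (20 <= ca)%N, (20 <= cx)%N & (20 <= ci)%N] ->
  [/\ ~~ Q yr, ~~ N ci, forall a, ls_cells a -> N a &
      forall j, ((10 <= j < 20)%N || (j == zt)) -> Q j] ->
  (forall s, constants s -> forall s', same N (fun j => Q j || (j == yr)) s s' -> constants s') ->
  greedy_rec_spec tgt kap N Q zt rec ->
  constants s -> P (get_row s 0) -> P z -> greedy_shape P z T sw i y -> (i < T)%N ->
  nmem s ci = i ->
  wp (greedy_body yr zr zt cp ca cx ci rec)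
    (fun s' => improves N (fun j => Q j || (j == yr)) s s' /\
      exists2 x, P x & get_row s' yr = advance z T sw i y x /\
        (threshold T sw p A X i - F y <= dot (direction G z sw i y) o ->
         threshold T sw p A X i - F y <= dot (direction G z sw i y) x /\
         (F (vadd x o) < kap -> tgt <= best s'))) s.
Proof.
move=> z y p A X [y20 z20 zt20 yz [zty ztz]] [p20 a20 x20 i20] [Qy Ni NL QL] Hc Hrec.
move=> cs P0 Pz Hy iT hi.
have [s0 s2 s3 s4 [s5 e11]] := cs.
have big a b : (a < 20)%N -> (20 <= b)%N -> (a == b) = false /\ (b == a) = false.
  by move=> ha hb; split; lia.
have QLy j : (10 <= j < 20)%N || (j == zt) -> Q j || (j == yr) by move=> /QL ->.
have NL' a : (6 <= a < 16)%N -> N a := NL a.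
have nlow a b : (a < 20)%N -> (20 <= b)%N -> (b == a) = false by move=> ha /(big _ _ ha) [].
have lown a b : (a < 20)%N -> (20 <= b)%N -> (a == b) = false by move=> ha /(big _ _ ha) [].
have [Po ho] := o_max.
rewrite /greedy_body.
apply: wp_seq; apply: (@wp_theta_pow _ _ _ _ _ _ T) => //=.
  by rewrite hi (leq_trans (ltnW iT)).
rewrite hi.
apply: wp_seq; apply: (@wp_theta_pow _ _ _ _ _ _ T) => //=.
  by rewrite !nlow // hi s3 (leq_trans (leq_subr _ _)) // (leq_trans (ltnW iT)).
rewrite !nlow // hi s3.
set s1 := nset _ 11 (i - sw).
pose low := same (R := R) (fun a => 6 <= a < 16)%N (fun j => 10 <= j < 20)%N.
have low1 : low s s1.
  by do 2! (do 2! (apply: same_nset => //); apply: same_rset => //).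
have lowN s' a : low s s' -> (20 <= a)%N -> nmem s' a = nmem s a.
  by move=> [hN _] ha; rewrite hN //; lia.
have lowR s' r : low s s' -> (20 <= r)%N -> get_row (n := n) s' r = get_row s r.
  by move=> [_ hR] ha; apply: get_row_eq => j; rewrite hR //; lia.
have lowC s' : low s s' -> constants s'.
  by case=> hN hR; split; rewrite ?hN ?hR.
have r102 : rmem s1 10 2 = (1 - h) ^+ i by [].
have r103 : rmem s1 10 3 = (1 - h) ^+ (i - sw) by [].
clearbody s1.
pose J s2 := [/\ low s s2, rmem s2 19 0 = avoid sw i & rmem s2 10 4 = threshold T sw p A X i].
apply: wp_seq; apply: (@wp_mono _ _ _ _ _ _ _ J); last first.
  have ecp : nmem s1 cp = nmem s cp by apply: lowN.
  have eca : nmem s1 ca = nmem s ca by apply: lowN.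
  have ecx : nmem s1 cx = nmem s cx by apply: lowN.
  have eci : nmem s1 ci = i by rewrite lowN.
  have [e0 e2 e3 e4 [e5 e1]] := lowC _ low1.
  apply: wp_if => hb; apply/wp_seq/wp_rset/wp_rset.
    have {}hb : (nmem s1 ci + 1 <= nmem s1 3)%N := hb.
    have iw : (i < sw)%N by rewrite eci e3 addn1 in hb.
    split.
    - by do 2 apply: same_rset => //.
    - by rewrite /avoid iw.
    - by rewrite /threshold iw /= ecp eca e2 e1 r102.
  have iw : (i < sw)%N = false.
    have {}hb : ~~ (nmem s1 ci + 1 <= nmem s1 3)%N := hb.
    by rewrite eci e3 addn1 in hb; exact/negbTE.
  split.
  - by do 2 apply: same_rset => //.
  - by rewrite /avoid iw.
  - by rewrite /threshold iw /= eca ecx eci e2 e3 e1 r102 r103.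
move=> s2' [low2 e19 e104]; set thr := threshold _ _ _ _ _ _ in e104 *.
have [c0 c2 c3 c4 [c5 c1]] := lowC _ low2.
have ry := lowR _ _ low2 y20; have rz := lowR _ _ low2 z20; have r0 : get_row (n := n) s2' 0 = get_row s 0.
  by apply: get_row_eq => j; rewrite (proj2 low2).
rewrite -/y in ry; rewrite -/z in rz.
apply/wp_seq/wp_queryG; rewrite [neval _ _]/= [neval _ _]/= ry.
set s3' := set_row _ _ _.
have low3 : low s s3' by apply: same_set_row.
have g3 : get_row s3' 12 = G y by rewrite get_row_set_row.
have e19' : rmem s3' 19 0 = avoid sw i by [].
have e104' : rmem s3' 10 4 = thr by [].
clearbody s3'; clear s2' low2 e19 e104 c0 c2 c3 c4 c5 c1 ry rz r0 J.
have [c0 c2 c3 c4 [c5 c1]] := lowC _ low3.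
have ry := lowR _ _ low3 y20; have rz := lowR _ _ low3 z20.
rewrite -/y in ry; rewrite -/z in rz.
apply: wp_seq; apply: (@wp_vset _ _ _ _ _ _ B0 _ _ (- direction G z sw i y)) => //.
  move=> j s' hN h6 hR /=; rewrite h6 !hR ?(nlow 11%N yr) ?(nlow 11%N zr) //.
  by rewrite (row_entry _ g3) (row_entry _ ry) (row_entry _ rz) e19' !mxE sub0r.
set s4' := nset _ _ _.
have low4 : low s s4' by apply: same_nset => //; apply: same_set_row.
have g4 : get_row s4' 11 = - direction G z sw i y by rewrite get_row_nset get_row_set_row.
have e19 : rmem s4' 19 0 = avoid sw i by [].
have e104 : rmem s4' 10 4 = thr by [].
clearbody s4'; clear s3' low3 e19' e104' c0 c2 c3 c4 c5 c1 ry rz g3.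
apply/wp_seq/wp_queryF; rewrite [neval _ _]/= [neval _ _]/= [neval _ _]/=.
have ry := lowR _ _ low4 y20; rewrite -/y in ry; rewrite ry.
set s5' := rset _ _ _ _.
have low5 : low s s5' by apply: same_rset.
have g5 : get_row s5' 11 = - direction G z sw i y by rewrite get_row_rset_neq.
have e19' : rmem s5' 19 0 = avoid sw i by [].
have e104' : rmem s5' 10 4 = thr by [].
have e105 : rmem s5' 10 5 = F y by [].
clearbody s5'; clear s4' low4 e19 e104 ry g4.
have [c0 c2 c3 c4 [c5 c1]] := lowC _ low5.
apply/wp_seq/wp_rset; rewrite [neval _ _]/= [reval _ _]/= [neval _ _]/= c0 e104' e105.
set s6' := rset _ _ _ _.
have low6 : low s s6' by apply: same_rset.
have cutE : cut s6' = [:: (- direction G z sw i y, F y - thr)].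
  by rewrite /cut /get_constraints /= get_row_rset_out g5 !eqxx.
have e19 : rmem s6' 19 0 = avoid sw i by [].
clearbody s6'; clear s5' low5 g5 e19' e104' e105 c0 c2 c3 c4 c5 c1.
have inQ v : polyhedron (cut s6') v <-> thr - F y <= dot (direction G z sw i y) v.
  rewrite cutE; split=> [/(_ _ (mem_head _ _)) /=|h' c].
    by rewrite dotNl; lra.
  by rewrite inE => /eqP -> /=; rewrite dotNl; lra.
have [c0 c2 c3 c4 [c5 c1]] := lowC _ low6.
apply: wp_seq; apply: (@wp_local_search _ _ F G L D P solve B F_ge0 F_dr F_grad G_smooth P_cube
  P_body P_diam P_solve T m O T_gt0 m_gt0 ho B0 B4) => // s7 same7 Px hst.
have Q19 : ~~ ls_rows zt 19 by rewrite /ls_rows /= lown.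
have Qyr : ~~ ls_rows zt yr by rewrite /ls_rows negb_or [yr == zt]eq_sym zty andbT; lia.
have Qzr : ~~ ls_rows zt zr by rewrite /ls_rows negb_or [zr == zt]eq_sym ztz andbT; lia.
have Q0 : ~~ ls_rows zt 0 by rewrite /ls_rows /= lown.
pose Q' : pred nat := fun j => Q j || (j == yr).
have sameL s' : low s s' -> same N Q' s s'.
  by apply: same_sub => a ha; [exact: NL|apply: QLy; rewrite ha].
have same67 : same N Q' s6' s7.
  apply: same_sub same7 => a ha; first exact: NL.
  by apply: QLy; move: ha => /orP[/andP[ha _]|->]; [apply/orP; left; lia|rewrite orbT].
have same07 := same_trans (sameL _ low6) same67.
have [d0 d2 d3 d4 [d5 d1]] := Hc _ cs _ same07.
have ry : get_row s7 yr = y.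
  rewrite (_ : y = get_row s6' yr); last by rewrite (lowR _ _ low6 y20).
  by apply: get_row_eq => j; rewrite (proj2 same7).
have rz : get_row s7 zr = z.
  rewrite (_ : z = get_row s6' zr); last by rewrite (lowR _ _ low6 z20).
  by apply: get_row_eq => j; rewrite (proj2 same7).
have r0 : get_row s7 0 = get_row s 0 :> 'rV[R]_n.
  by apply: get_row_eq => j; rewrite (proj2 same7) // (proj2 low6).
have e19' : rmem s7 19 0 = avoid sw i by rewrite (proj2 same7).
set x : 'rV[R]_n := get_row s7 zt in Px hst.
have zry : (zr == yr) = false by rewrite eq_sym (negbTE yz).
apply: wp_seq; apply: (@wp_vset _ _ _ _ _ _ B0 _ _ (advance z T sw i y x)) => //.
  move=> j s' hN h6 hR /=; rewrite h6 !hR ?leqnn ?orbT ?zty ?zry ?(lown 19%N yr) //.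
  by rewrite hN // d2 (row_entry _ ry) (row_entry _ rz) e19' !mxE mulrC.
set s8 := nset _ _ _.
have same8 : same N Q' s s8.
  by apply: same_nset; [exact: NL|apply: same_set_row => //; rewrite /Q' eqxx orbT].
have r80 : get_row s8 0 = get_row s 0 :> 'rV[R]_n.
  by rewrite get_row_nset get_row_set_row_neq ?lown.
have r8x : get_row s8 zt = x by rewrite get_row_nset get_row_set_row_neq.
have r8y : get_row s8 yr = advance z T sw i y x by rewrite get_row_nset get_row_set_row.
clearbody s8.
have cs8 := Hc _ cs _ same8.
apply: Hrec => //; rewrite ?r80 ?r8x // => s9 [same9 P9 b9] h9.
split.
  split=> //; last by rewrite -r80.
  apply: same_trans same8 _; by apply: same_sub same9 => // a; rewrite /Q' => ->.
exists x => //; split; first by rewrite -r8y; apply: get_row_eq => j; rewrite (proj2 same9).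
(* Feasibility of [o] both makes the cut body nonempty and lets stationarity at [x] be tested
   against [o]. *)
move=> hfeas; have Qo : polyhedron (cut s6') o by apply/inQ.
have [|_ Qx hx] := hst; first by exists o.
split; first exact/inQ.
apply: h9; apply: (local_opt_bound F_dr F_grad) => //; try exact: P_cube.
exact: hx.
Qed.

End Search.

(** * The search tree *)

Section Guesses.
Context {R : realType}.

Lemma large_inverse (m : nat) : 1000 * 1000 <= m%:R :> R ->
  (0 < m)%N /\ m%:R^-1 <= 1 / (1000 * 1000) :> R.
Proof.
move=> hm; have c0 : 0 < 1000 * 1000 :> R by clear; lra.
have m0 : 0 < m%:R :> R by apply: lt_le_trans hm.
split; first by rewrite -(ltr0n R).
by rewrite div1r lef_pV2; [exact: hm|exact: m0|exact: c0].
Qed.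

Lemma step_small (h e : R) : 0 <= e -> h <= e / 30 -> e <= 1 / (1000 * 1000) ->
  h <= e /\ h <= 1 / (1000 * 1000) / 4.
Proof. by move=> e0 h1 h2; split; lra. Qed.

Lemma small_optimum (O E : R) : 0 <= O -> O <= E -> 401 / 1000 * O - 10 * E <= 0.
Proof. by move=> h1 h2; lra. Qed.

Lemma grid_below (eta v : R) (K : nat) : 0 < eta -> 0 <= v -> v <= K%:R * eta ->
  exists2 j : nat, (j <= K)%N & j%:R * eta <= v /\ v - eta <= j%:R * eta.
Proof.
move=> e0 v0 vK; exists (Num.truncn (v / eta)).
  have q0 : 0 <= v / eta by rewrite divr_ge0 // ltW.
  have /andP[h1 _] := truncn_itv q0.
  by rewrite -(ler_nat R); apply: (le_trans h1); rewrite ler_pdivrMr.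
have q0 : 0 <= v / eta by rewrite divr_ge0 // ltW.
have /andP[h1 h2] := truncn_itv q0.
split; first by rewrite -ler_pdivlMr.
move: h2; rewrite ltr_pdivrMr // -natr1 mulrDl mul1r => h2.
by rewrite lerBlDr ltW.
Qed.

(** [A] is placed [kap] below [a], so a value below [A] is a drop of more than [kap]; if [a < kap]
    the guess is 0, and no nonnegative value lies below it. The bound on [c] makes [O - c * a]
    nonnegative, as [a <= 2 * O]. *)
Lemma guesses_exist (O a b c eta kap : R) (T : nat) : 0 < eta -> O <= T%:R * eta -> 0 <= O ->
  0 <= kap -> 0 <= a <= 2 * O -> 0 <= b <= O -> 0 <= c <= 1 / 2 -> (0 < T)%N ->
  exists jp jA jX : nat, [/\ (jp < 5 * T)%N, (jA < 5 * T)%N, (jX < 5 * T)%N,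
    let p := (jp%:R - 3%:R * T%:R) * eta in p <= O - a - b /\ O - a - b - eta <= p &
    let A := jA%:R * eta in let X := jX%:R * eta in
    [/\ A <= a, a - kap - eta <= A, 0 < A -> A <= a - kap,
      X <= O - c * a & O - c * a - eta <= X]].
Proof.
move=> e0 OT O0 k0 /andP[a0 a2] /andP[b0 b1] /andP[c0 c1] T0.
have small (j : nat) : (j <= 4 * T)%N -> (j < 5 * T)%N.
  by move=> hj; apply: leq_ltn_trans hj _; rewrite ltn_pmul2r.
have T4 : (4 * T)%:R * eta = 4 * (T%:R * eta) by rewrite natrM mulrA.
have [|| jp hp [p1 p2]] := @grid_below eta (O - a - b + 3 * (T%:R * eta)) (4 * T) e0.
  by lra.
  by rewrite T4; lra.
have ca : c * a <= O by nra.
have ca0 : 0 <= c * a by rewrite mulr_ge0.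
have [|| jX hX [x1 x2]] := @grid_below eta (O - c * a) (4 * T) e0.
  by lra.
  by rewrite T4; lra.
have [jA hA [h1 h2 h3]] : exists2 jA : nat, (jA <= 4 * T)%N & [/\ jA%:R * eta <= a,
    a - kap - eta <= jA%:R * eta & 0 < jA%:R * eta -> jA%:R * eta <= a - kap].
  have [ak|ak] := lerP kap a.
    have [|| jA hA [h1 h2]] := @grid_below eta (a - kap) (4 * T) e0.
      by lra.
      by rewrite T4; lra.
    by exists jA => //; split => //; lra.
  by exists 0%N => //; rewrite mul0r ltxx; split => //; lra.
exists jp, jA, jX; split; rewrite ?small //.
by rewrite /= mulrBl -mulrA; split; lra.
Qed.

(** Bounds the decay over the first phase as the quotient of two powers already enclosed, in place
    of a third numerical enclosure. *)
Lemma half_le_ratio (x y z : R) : 0 <= y -> x <= 530 / 1000 + 820 / (1000 * 1000) ->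
  367 / 1000 + 878 / (1000 * 1000) <= z -> x * y = z -> 1 / 2 <= y.
Proof.
move=> y0 hx hz E; have [//|hy] := lerP (1 / 2) y.
have h1 : x * y <= (530 / 1000 + 820 / (1000 * 1000)) * y by apply: ler_wpM2r.
have h2 : (530 / 1000 + 820 / (1000 * 1000)) * y <= (530 / 1000 + 820 / (1000 * 1000)) * (1 / 2).
  by apply: ler_wpM2l; [clear; lra|exact: ltW].
by move: h1 h2 hz; rewrite E; clear; lra.
Qed.

(** [pow_bounds] loses [2 * h], at most half a unit of the sixth decimal under the assumed bound on
    [h]. *)
Lemma exponent_bounds (q : nat) (h : R) : h = (30 * q)%:R^-1 -> (0 < q)%N ->
  h <= 1 / (1000 * 1000) / 4 ->
  (530 / 1000 + 818 / (1000 * 1000) <= (1 - h) ^+ (19 * q) <= 530 / 1000 + 820 / (1000 * 1000)) /\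
  (367 / 1000 + 878 / (1000 * 1000) <= (1 - h) ^+ (30 * q) <= 367 / 1000 + 880 / (1000 * 1000)).
Proof.
move=> hE q0 hs.
have q0' : 0 < q%:R :> R by rewrite ltr0n.
have h0 : 0 < h by rewrite hE invr_gt0 ltr0n muln_gt0.
have hh : 0 < h <= 2^-1 by rewrite h0; move: hs; clear; lra.
have e1 : (30 * q)%:R * h = 1 by rewrite hE mulfV // pnatr_eq0 muln_eq0 /= -lt0n.
have e2 : (19 * q)%:R * h = 19 / 30.
  have -> : (19 * q)%:R * h = 19 / 30 * ((30 * q)%:R * h) by rewrite !natrM; field.
  by rewrite e1 mulr1.
have b1 : (30 * q)%:R * h <= 1 by rewrite e1.
have b2 : (19 * q)%:R * h <= 1 by rewrite e2; clear; lra.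
have := pow_bounds hh b1; have := pow_bounds hh b2; rewrite e1 e2.
have [c1 c2] := @expR_m19_m30_bounds R.
move: c1 c2 hs; move: (expR _) (expR _) => E1 E2.
move: ((1 - h) ^+ _) ((1 - h) ^+ _) => E3 E4; clear.
move=> /andP[l1 u1] /andP[l2 u2] hs /andP[l3 u3] /andP[l4 u4].
split; apply/andP; split; [move: l1 l3 hs|move: u1 u3|move: l2 l4 hs|move: u2 u4]; clear; lra.
Qed.

End Guesses.

(** * The better of the two candidates at one node *)

Section GreedyOutcome.
Context {R : realType} {n : nat}.
Variables (F : 'rV[R]_n -> R) (P : set 'rV[R]_n) (o z : 'rV[R]_n).
Hypothesis F_ge0 : forall x, cube x -> 0 <= F x.
Hypothesis F_dr : dr_submodular F.
Hypothesis P_cube : P `<=` cube.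
Hypothesis P_down : down_closed P.
Hypothesis o_max : maximizer F P o.
Hypothesis Pz : P z.

Lemma vmul_le : F (vmul z o) <= F o.
Proof.
have [Po ho] := o_max; apply: ho; have cz := P_cube Pz; have co := P_cube Po.
by apply: (P_down Po) => j; rewrite !mxE; have := cz j; have := co j; nra.
Qed.

(** [vadd z o] is [z + v] with [v] below [o], hence [v] in [P]; submodularity from [0] gives
    [F (z + v) <= F z + F v]. *)
Lemma vadd_le : F (vadd z o) <= 2 * F o.
Proof.
have [Po ho] := o_max; have cz := P_cube Pz; have co := P_cube Po.
pose v : 'rV[R]_n := \row_j (o 0 j * (1 - z 0 j)).
have zv : vadd z o = z + v by apply/rowP => j; rewrite !mxE; ring.
have v0 : vle 0 v by move=> j; rewrite !mxE; have := cz j; have := co j; nra.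
have Pv : P v by apply: (P_down Po) => // j; rewrite !mxE; have := cz j; have := co j; nra.
have z0 : vle 0 z by move=> j; rewrite mxE; have /andP[] := cz j.
have := dr_increment F_dr (@cube0 R n) _ z0 v0.
rewrite add0r -zv => /(_ (cube_vadd cz co)).
have := F_ge0 (@cube0 R n); have := ho _ Pz; have := ho _ Pv; lra.
Qed.

Lemma greedy_outcome (q m : nat) (p A X eta E : R) (y w : 'rV[R]_n) :
  let h := (30 * q)%:R^-1 : R in let eps := m%:R^-1 : R in
  let a := F (vadd z o) in let b := F (vmul z o) in
  (0 < q)%N -> h <= 1 / (1000 * 1000) / 4 -> h <= eps -> eps <= 1 / (1000 * 1000) ->
  0 <= E -> 0 <= eta <= eps * F o ->
  (11 / 5) ^+ 2 * F z + 2 * (11 / 5) * b <= (1 + 11 / 5) ^+ 2 * F w + 2 * (11 / 5) * E ->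
  a + b <= 2 * F z + (eps * F o + 2 * E) ->
  F o - a - b - eta <= p -> a - eps * F o - eta <= A ->
  F o - (1 - (1 - h) ^+ (11 * q)) * a - eta <= X ->
  value_phase2 (30 * q) (11 * q) p A X (30 * q - 11 * q) <= F y + E ->
  401 / 1000 * F o - 10 * E <= F w \/ 401 / 1000 * F o - 10 * E <= F y.
Proof.
move=> h eps a b q0 h1 h2 e1 E0 heta hw hz hp hA hX hy.
have [Po ho] := o_max; have cz := P_cube Pz; have co := P_cube Po.
have h0 : 0 <= h by rewrite invr_ge0 ler0n.
have [hal hbe] := @exponent_bounds R q h erefl q0 h1.
have th0 : 0 <= 1 - h by rewrite subr_ge0 invf_le1 ?ltr0n ?ler1n muln_gt0.
(* [al] is the decay over the second phase and [be] over the whole run, close to exp(-19/30) and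
   exp(-1). *)
set al := (1 - h) ^+ (19 * q) in hal; set be := (1 - h) ^+ (30 * q) in hbe.
have alE : al * (1 - h) ^+ (11 * q) = be by rewrite /al /be -exprD -mulnDl.
have al0 : 0 <= al by rewrite exprn_ge0.
have a0 : 0 <= a <= 2 * F o by rewrite vadd_le andbT F_ge0 //; exact: cube_vadd.
have b0 : 0 <= b by rewrite F_ge0 //; exact: cube_vmul.
have h02 : 0 <= h <= eps by rewrite h0.
apply: (@ratio_combination R (F o) a b (F z) (F w) (F y) p A X eta eps h E al be
  (F_ge0 co) a0 b0 E0 h02 e1 hal hbe hw hz heta hp hA).
- have := ler_wpM2l al0 hX.
  have -> : al * (F o - (1 - (1 - h) ^+ (11 * q)) * a - eta) =
     al * F o - (al - al * (1 - h) ^+ (11 * q)) * a - al * eta by ring.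
  by rewrite alE.
- apply: le_trans hy; rewrite /value_phase2 /value_phase1 -/h.
  rewrite -mulnBl -[(30 - 11)%N]/19%N.
  rewrite -mulnDl -[(11 + 19)%N]/30%N -/al -/be.
  have qh : q%:R * h = 1 / 30.
    by rewrite /h natrM; field; rewrite pnatr_eq0 -lt0n.
  have e11 : (11 * q)%:R * h = 11 / 30 by rewrite natrM -mulrA qh; field.
  have e19 : (19 * q)%:R * h = 19 / 30 by rewrite natrM -mulrA qh; field.
  rewrite e11 e19 le_eqVlt; apply/orP; left; apply/eqP.
  have -> : h ^+ 2 * be * A * ((19 * q)%:R * ((19 * q)%:R - 1) / 2) =
    be * A * (((19 * q)%:R * h) * ((19 * q)%:R * h - h) / 2) by field.
  rewrite e19.
  have -> : al * (p * (1 - (1 - h) ^+ (11 * q)) + 11 / 30 * (1 - h) ^+ (11 * q) * A) =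
     p * (al - al * (1 - h) ^+ (11 * q)) + 11 / 30 * (al * (1 - h) ^+ (11 * q)) * A by ring.
  by rewrite alE; field.
Qed.

End GreedyOutcome.

(** * Storage of the levels of the search tree *)

Definition yrow (d : nat) : nat := 20 + 2 * d.
Definition zrow (d : nat) : nat := 21 + 2 * d.
Definition counter (d k : nat) : nat := 20 + 4 * d + k.

(** What [search d] may write. Levels use disjoint storage, growing with [d], so a subtree leaves
    the suspended runs of its ancestors intact. *)
Definition tree_cells (d : nat) : pred nat := fun a => (6 <= a < 24 + 4 * d)%N.
Definition tree_rows (d : nat) : pred nat := fun i => (i == 0%N) || (10 <= i < 21 + 2 * d)%N.
(** One greedy run at level [d] lies inside the three guess loops and must preserve their
    counters. *)
Definition run_cells (d : nat) : pred nat := fun a =>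
  [&& tree_cells d a, a != counter d 0, a != counter d 1 & a != counter d 2].
(** Adds [zrow d] to [tree_rows d]: the local search of the parent run writes that row before the
    subtree reads it. *)
Definition run_rows (d : nat) : pred nat := fun i => (i == 0%N) || (10 <= i < 22 + 2 * d)%N.

Lemma tree_cells_scratch d a : (6 <= a < 16)%N -> tree_cells d a.
Proof. by rewrite /tree_cells; lia. Qed.

Lemma tree_rows_scratch d i : (10 <= i < 20)%N -> tree_rows d i.
Proof. by rewrite /tree_rows; lia. Qed.

Lemma tree_rows_z d : ~~ tree_rows d (zrow d).
Proof. by rewrite /tree_rows /zrow; lia. Qed.

Lemma tree_rows_y d : tree_rows d (yrow d).
Proof. by rewrite /tree_rows /yrow; lia. Qed.

Lemma tree_cells_const d a : (a < 6)%N -> ~~ tree_cells d a.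
Proof. by rewrite /tree_cells; lia. Qed.

Lemma tree_rows_const d : ~~ tree_rows d 1.
Proof. by rewrite /tree_rows; lia. Qed.

Lemma zrow_ge20 d : (20 <= zrow d)%N. Proof. by rewrite /zrow; lia. Qed.
Lemma yrow_ge20 d : (20 <= yrow d)%N. Proof. by rewrite /yrow; lia. Qed.
Lemma counter_ge20 d k : (20 <= counter d k)%N. Proof. by rewrite /counter; lia. Qed.

Lemma tree_cells_counter d k : (k < 4)%N -> tree_cells d (counter d k).
Proof. by rewrite /tree_cells /counter; lia. Qed.

Lemma counter_neq d k l : k != l -> counter d k != counter d l.
Proof. by rewrite /counter; lia. Qed.

Lemma run_cells_scratch d a : (6 <= a < 16)%N -> run_cells d a.
Proof. by rewrite /run_cells /tree_cells /counter; lia. Qed.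

Lemma run_cells_counter3 d : run_cells d (counter d 3).
Proof. by rewrite /run_cells /tree_cells /counter; lia. Qed.

Lemma run_cells_tree d a : tree_cells d a -> run_cells d.+1 a.
Proof. by rewrite /run_cells /tree_cells /counter; lia. Qed.

Lemma run_cells_const d a : (a < 6)%N -> ~~ run_cells d a.
Proof. by rewrite /run_cells /tree_cells; lia. Qed.

Lemma run_cells_counter d k : (k < 3)%N -> ~~ run_cells d (counter d k).
Proof. by rewrite /run_cells /counter; lia. Qed.

Lemma run_rows_tree d i : tree_rows d i -> run_rows d i.
Proof. by rewrite /run_rows /tree_rows; lia. Qed.

Lemma run_rows_next d i : run_rows d i || (i == yrow d.+1) -> tree_rows d.+1 i.
Proof. by rewrite /run_rows /tree_rows /yrow; lia. Qed.

Lemma run_rows_y d : ~~ run_rows d (yrow d.+1).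
Proof. by rewrite /run_rows /yrow; lia. Qed.

Lemma run_rows_child d j : (10 <= j < 20)%N || (j == zrow d) -> run_rows d j.
Proof. by rewrite /run_rows /zrow; lia. Qed.

Lemma counter3_tree d : ~~ tree_cells d (counter d.+1 3).
Proof. by rewrite /tree_cells /counter; lia. Qed.

Lemma rows_distinct d : [/\ yrow d.+1 != zrow d.+1, zrow d != yrow d.+1 & zrow d != zrow d.+1].
Proof. by rewrite /yrow /zrow; split; lia. Qed.

(* Search tree below the candidate [z] in row [zrow d]: every iterate of every greedy run
   becomes the [z] of the next level, until [d] runs out. *)
Fixpoint search (d : nat) : cmd :=
  if d is d'.+1 then
    Seq (double_greedy (zrow d))
    (Seq (candidate 15)
      (For (counter d 0) 5 (For (counter d 1) 5 (For (counter d 2) 5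
        (Seq (vset (yrow d) (RNat (NLit 0)))
        (Seq (For (counter d 3) 2
               (greedy_body (yrow d) (zrow d) (zrow d')
                 (counter d 0) (counter d 1) (counter d 2) (counter d 3) (search d')))
          (candidate (yrow d))))))))
  else Skip.

Section SearchTree.
Context {R : realType} {n : nat}.
Variables (F : 'rV[R]_n -> R) (G : 'rV[R]_n -> 'rV[R]_n) (L D : R) (P : set 'rV[R]_n).
Variable solve : seq ('rV[R]_n * R) -> 'rV[R]_n -> option 'rV[R]_n.
Variable B : nat -> nat.
Hypothesis F_ge0 : forall x, cube x -> 0 <= F x.
Hypothesis F_dr : dr_submodular F.
Hypothesis F_grad : gradient_on_cube F G.
Hypothesis G_smooth : smooth L G.
Hypothesis P_cube : P `<=` cube.
Hypothesis P_body : convex_body P.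
Hypothesis P_down : down_closed P.
Hypothesis P_diam : has_diameter D P.
Hypothesis P_solve : meta_solver P solve.
Variables (m q : nat) (o : 'rV[R]_n) (eta : R).
Local Notation T := (30 * q)%N.
Local Notation sw := (11 * q)%N.
Hypothesis q_gt0 : (0 < q)%N.
Hypothesis m_gt0 : (0 < m)%N.
Hypothesis o_max : maximizer F P o.
Hypothesis B0 : (n <= B 0)%N.
Hypothesis B2 : (T <= B 2)%N.
Hypothesis B4 : (T * m <= B 4)%N.
Hypothesis B5 : (5 * T <= B 5)%N.
Hypothesis B12 : (T <= B 12)%N.
Local Notation h := (T%:R^-1 : R).
Local Notation err := (L * D ^+ 2 * h).
Local Notation eps := (m%:R^-1 : R).
Hypothesis h_small : h <= 1 / (1000 * 1000) / 4.
Hypothesis h_eps : h <= eps.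
Hypothesis eps_small : eps <= 1 / (1000 * 1000).
Implicit Types (s : state R) (N M Q : pred nat) (x y z v w : 'rV[R]_n).
Local Notation wp := (wp F G solve B).
Local Notation O := (F o).
Local Notation best s := (F (get_row s 0)).
Local Notation constants := (@constants R n T m q eta).
Local Notation tgt := (401 / 1000 * O - 10 * err).

(** The unit is small enough for a rounding to cost at most [eps * O], while [T] units cover [O].
    This may fail when [O] is small against the error term, where the claim is trivial. *)
Definition regular := 0 < eta <= eps * O /\ O <= T%:R * eta.

(** The last clause is the potential that pays for the depth: every restart lowers [F (vadd z o)] by
    [eps * O], and at [d = 0] it would be negative. *)
Definition good_node (d : nat) z :=
  [/\ regular, F (vadd z o) + F (vmul z o) <= 2 * F z + (eps * O + 2 * err) &
      F (vadd z o) < d%:R * (eps * O)].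

Let T_gt0 : (0 < T)%N. Proof. by rewrite muln_gt0. Qed.

Let err_ge0 : 0 <= err.
Proof.
have [L0 _] := G_smooth; rewrite mulr_ge0 ?invr_ge0 ?ler0n //.
by rewrite mulr_ge0 ?sqr_ge0.
Qed.

Lemma constants_same N Q s s' : constants s -> same N Q s s' ->
  (forall a, (a < 6)%N -> ~~ N a) -> ~~ Q 1%N -> constants s'.
Proof.
move=> [h0 h2 h3 h4 [h5 h6]] [hN hR] hN' hQ.
by split; rewrite ?hN ?hN' ?hR.
Qed.

Lemma half_le_theta_pow : 0 <= 1 - (1 - h) ^+ sw <= 1 / 2.
Proof.
have /andP[t0 t1] := @theta_pow01 R T T_gt0 sw.
have [/andP[_ h1] /andP[h2 _]] := @exponent_bounds R q h erefl q_gt0 h_small.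
have E : (1 - h) ^+ (19 * q) * (1 - h) ^+ sw = (1 - h) ^+ T by rewrite -exprD -mulnDl.
by have := half_le_ratio t0 h1 h2 E; lra.
Qed.

Lemma run_frame d s s' : constants s -> same (run_cells d.+1) (tree_rows d.+1) s s' ->
  [/\ constants s', get_row s' (zrow d.+1) = get_row s (zrow d.+1) :> 'rV[R]_n &
      forall k, (k < 3)%N -> nmem s' (counter d.+1 k) = nmem s (counter d.+1 k)].
Proof.
move=> cs sm; split.
- exact: constants_same cs sm (@run_cells_const _) (tree_rows_const _).
- by apply: get_row_eq => j; rewrite (proj2 sm) // tree_rows_z.
- by move=> k k3; rewrite (proj1 sm) // run_cells_counter.
Qed.

Definition tree_spec (d : nat) := forall s (X : state R -> Prop), constants s ->
  P (get_row s 0) -> P (get_row s (zrow d)) ->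
  (forall s', improves F P (tree_cells d) (tree_rows d) s s' ->
     (good_node d (get_row s (zrow d)) -> tgt <= best s') -> X s') ->
  wp (search d) X s.

(** [greedy_rec_spec] does not mention [regular]; when it fails, [kap = -1] makes the premise of the
    promise impossible, because [F] is nonnegative. *)
Lemma tree_rec_spec d : tree_spec d ->
  exists2 kap : R, regular -> kap = d%:R * (eps * O) &
    greedy_rec_spec F G L D P solve B T m q o eta tgt kap (tree_cells d) (run_rows d)
      (zrow d) (search d).
Proof.
move=> IH; have [Po ho] := o_max; have [reg|nreg] := pselect regular.
  exists (d%:R * (eps * O)) => // s X cs P0 Pz HX; apply: IH => // s' imp hg; apply: HX.
    by apply: improves_sub imp => //; exact: run_rows_tree.
  by move=> hn hk; apply: hg.
exists (-1) => [/nreg //|s X cs P0 Pz HX]; apply: IH => // s' imp hg; apply: HX.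
  by apply: improves_sub imp => //; exact: run_rows_tree.
move=> _ hk; have : 0 <= F (vadd (get_row s (zrow d)) o).
  by apply/F_ge0/cube_vadd; exact: P_cube.
by move=> h0; have := le_lt_trans h0 hk; rewrite oppr_gt0 ltr10.
Qed.

Definition right_guesses z (p A X : R) :=
  (p <= O - F (vadd z o) - F (vmul z o) /\ O - F (vadd z o) - F (vmul z o) - eta <= p) /\ [/\ A <= F (vadd z o), F (vadd z o) - eps * O - eta <= A,
      0 < A -> A <= F (vadd z o) - eps * O,
      X <= O - (1 - (1 - h) ^+ sw) * F (vadd z o) &
      O - (1 - (1 - h) ^+ sw) * F (vadd z o) - eta <= X].

(** The invariant on values is a disjunction: once an iterate falls below [A], its subtree has
    already reached the target and only the shape of [y] matters from then on. [w] is the double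
    greedy point, no better than the best one stored. *)
Lemma wp_greedy_run d s (w : 'rV[R]_n) (Good : Prop) :
  let z : 'rV[R]_n := get_row s (zrow d.+1) in
  let p := ((nmem s (counter d.+1 0))%:R - 3%:R * T%:R) * eta in
  let A := (nmem s (counter d.+1 1))%:R * eta in
  let X := (nmem s (counter d.+1 2))%:R * eta in
  tree_spec d -> constants s -> P (get_row s 0) -> P z ->
  (11 / 5) ^+ 2 * F z + 2 * (11 / 5) * F (vmul z o) <=
    (1 + 11 / 5) ^+ 2 * F w + 2 * (11 / 5) * err ->
  F w <= best s ->
  (Good -> good_node d.+1 z /\ right_guesses z p A X) ->
  wp (Seq (vset (yrow d.+1) (RNat (NLit 0)))
       (Seq (For (counter d.+1 3) 2
               (greedy_body (yrow d.+1) (zrow d.+1) (zrow d)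
                 (counter d.+1 0) (counter d.+1 1) (counter d.+1 2) (counter d.+1 3)
                 (search d)))
          (candidate (yrow d.+1))))
    (fun s' => improves F P (run_cells d.+1) (tree_rows d.+1) s s' /\
       (Good -> tgt <= best s')) s.
Proof.
move=> z p A X IH cs P0 Pz hw wb HG.
have [Po ho] := o_max.
have [kap kapE Hrec] := tree_rec_spec IH.
have [c0 c2 c3 c4 [c5 c1]] := cs.
have [yz zy zz] := rows_distinct d.
pose N := run_cells d.+1; pose Q := tree_rows d.+1.
apply: wp_seq; apply: (@wp_vset _ _ F G solve B B0 _ _ 0) => //.
  by move=> j s1 _ _ _; rewrite mxE.
set s1 := nset _ _ _.
have same1 : same N Q s s1.
  apply: same_nset; first exact: run_cells_scratch.
  by apply: same_set_row => //; exact: tree_rows_y.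
have r10 : get_row s1 0 = get_row s 0 :> 'rV[R]_n.
  by rewrite get_row_nset get_row_set_row_neq // /yrow.
have r1y : get_row s1 (yrow d.+1) = 0 :> 'rV[R]_n by rewrite get_row_nset get_row_set_row.
clearbody s1.
pose I i s' := [/\ nmem s' (counter d.+1 3) = i, improves F P N Q s s',
  greedy_shape P z T sw i (get_row s' (yrow d.+1)) &
  Good -> tgt <= best s' \/ greedy_value F L D o T sw p A X i (get_row s' (yrow d.+1))].
apply: wp_seq; apply: (@wp_for _ _ _ _ _ _ _ _ _ T I) => //.
- move=> i s' [hi [sm _ _] _ _]; split=> //.
  by have [[_ -> _ _ _] _ _] := run_frame cs sm.
- split; rewrite ?get_row_nset ?r1y ?r10 //.
  + by rewrite /= eqxx.
  + split; rewrite ?get_row_nset ?r10 //; apply: same_nset => //; exact: run_cells_counter3.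
  + exact: greedy_shape0.
  + move=> /HG [_ [_ [_ _ _ hX _]]]; right.
    exact: (greedy_value0 L D F_ge0 p A hX).
- move=> i s' iT [hi imp hs hv].
  have [sm P0' b'] := imp.
  have [cs' z' k'] := run_frame cs sm.
  have Pz' : P (get_row s' (zrow d.+1)) by rewrite z'.
  have hs' : greedy_shape P (get_row s' (zrow d.+1)) T sw i (get_row s' (yrow d.+1)) by rewrite z'.
  have Hc s2 : constants s2 -> forall s3, same (tree_cells d)
      (fun j => run_rows d j || (j == yrow d.+1)) s2 s3 -> constants s3.
    move=> cs2 s3 sm3; apply: (constants_same cs2 sm3) => [a|]; first exact: tree_cells_const.
    by rewrite /run_rows /yrow.
  apply: wp_mono; last first.
    apply: (@wp_greedy_body _ _ F G L D P solve B F_ge0 F_dr F_grad G_smooth P_cube P_body P_diam P_solve T m q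
      o eta T_gt0 m_gt0 o_max B0 B2 B4 B5 B12 (yrow d.+1) (zrow d.+1) (zrow d) (counter d.+1 0) (counter d.+1 1) (counter d.+1 2)
      (counter d.+1 3) (search d) (tree_cells d) (run_rows d) tgt kap i s' _ _ _ Hc Hrec cs' P0' Pz' hs' iT hi).
    + by split=> //; rewrite ?yrow_ge20 ?zrow_ge20.
    + by rewrite !counter_ge20.
    + split; [exact: run_rows_y|exact: counter3_tree|exact: tree_cells_scratch|exact: run_rows_child].
  rewrite z' !k' // -/p -/A -/X -/z => s2 [imp2 [x Px [ry hx]]].
  have imp2' : improves F P N Q s' s2.
    apply: improves_sub imp2; [exact: run_cells_tree|exact: run_rows_next].
  have c3E : nmem s2 (counter d.+1 3) = i.
    by have [[hN _] _ _] := imp2; rewrite hN // counter3_tree.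
  split=> //; split.
  + by rewrite /= eqxx.
  + have [a2 b2 c2'] := improves_trans imp imp2'.
    by split=> //; apply: same_nset => //; exact: run_cells_counter3.
  + by rewrite get_row_nset ry; apply: greedy_shape_next.
  + move=> good; have [[reg nd ad] [[p1 p2] [A1 A2 A3 X1 X2]]] := HG good.
    have [_ _ b2] := imp2.
    have [old|hv'] := hv good; first by left; exact: le_trans old b2.
    have A0 : 0 <= A by have [/andP[e0 _] _] := reg; rewrite mulr_ge0 ?ler0n ?ltW.
    have X0 : 0 <= X by have [/andP[e0 _] _] := reg; rewrite mulr_ge0 ?ler0n ?ltW.
    have feas := greedy_feasible F_ge0 F_dr F_grad P_cube P_down Po Pz T_gt0 p1 A1 iT hs hv'.
    have [hx1 hx2] := hx feas.
    have [Ax|xA] := lerP A (F (vadd x o)).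
      right; rewrite get_row_nset ry.
      exact: (greedy_value_next F_ge0 F_dr F_grad G_smooth P_cube P_body P_down P_diam Po Pz
        T_gt0 A0 X0 X1 iT hs hv' Px hx1 Ax).
    (* [A] is positive because it exceeds a value of [F]; so [A <= a - eps * O], and [a] is below
       [d.+1%:R * (eps * O)]. *)
    left; apply: hx2; apply: (lt_le_trans xA); rewrite kapE //.
    have Ap : 0 < A.
      apply: le_lt_trans xA; apply/F_ge0/cube_vadd; exact: P_cube.
    apply: le_trans (A3 Ap) _; rewrite lerBlDr; apply: le_trans (ltW ad) _.
    by rewrite -natr1 mulrDl mul1r.
move=> s2 [_ imp hs hv].
have [sm P2 b2] := imp.
have [cs2 z2 _] := run_frame cs sm.
have [d0 _ _ _ _] := cs2.
have Py : P (get_row s2 (yrow d.+1)) by exact: (greedy_shape_body P_cube P_down T_gt0 hs (leqnn _)).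
apply: (@wp_candidate _ _ F G P solve B B0 (yrow d.+1) s2 _ d0 _ Py P2) => //.
move=> s3 imp3 hy.
have imp3' : improves F P N Q s2 s3.
  apply: improves_sub imp3 => a; first by move=> /eqP ->; exact: run_cells_scratch.
  by move=> /orP[/eqP ->|/eqP ->] //; exact: tree_rows_scratch.
split; first exact: improves_trans imp imp3'.
move=> good; have [[reg nd ad] [[p1 p2] [A1 A2 A3 X1 X2]]] := HG good.
have [_ _ b3] := imp3'.
have [old|hv'] := hv good; first exact: le_trans old b3.
have e01 : 0 <= eta <= eps * O by have [/andP[e0 e1] _] := reg; rewrite ltW.
have swT : (sw <= T)%N by rewrite leq_mul2r orbT.
have hfin := greedy_final T_gt0 swT hv'.
have [h1|h1] := greedy_outcome F_ge0 F_dr P_cube P_down o_max Pz q_gt0 h_small h_eps eps_small err_ge0 e01 hw nd p2 A2 X2 hfin.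
  by apply: le_trans h1 _; apply: le_trans wb _; exact: le_trans b2 b3.
exact: le_trans h1 hy.
Qed.

Lemma wp_search d : tree_spec d.
Proof.
have [Po ho] := o_max.
elim: d => [|d IH] s X cs P0 Pz HX.
  apply: wp_skip; apply: HX; first by split.
  by move=> [_ _]; rewrite mul0r ltNge F_ge0 //; apply: cube_vadd; exact: P_cube.
rewrite [search _]/=; set zr := zrow d.+1 in Pz HX *.
set z : 'rV[R]_n := get_row s zr in Pz HX.
have [c0 c2 _ _ _] := cs.
pose N := tree_cells d.+1; pose Q := tree_rows d.+1.
have toN s1 s2 : same ls_cells (fun i => 10 <= i < 19)%N s1 s2 -> same N Q s1 s2.
  apply: same_sub => a ha; first exact: tree_cells_scratch.
  by apply: tree_rows_scratch; case/andP: ha => -> /ltnW.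
have keep s1 s2 : constants s1 -> same N Q s1 s2 ->
    constants s2 /\ get_row s2 zr = get_row s1 zr :> 'rV[R]_n.
  move=> cs1 sm; split.
    by apply: constants_same cs1 sm _ (tree_rows_const _) => a; exact: tree_cells_const.
  by apply: get_row_eq => j; rewrite (proj2 sm) // tree_rows_z.
apply: wp_seq; apply: (wp_double_greedy (L := L) (D := D) (P := P) solve F_ge0 F_dr F_grad G_smooth
  P_cube P_body P_down P_diam T_gt0 B0 B2 (zrow_ge20 _) c0 c2 Pz) => s1 same1 Pw hw.
have r1 : get_row s1 0 = get_row s 0 :> 'rV[R]_n.
  by apply: get_row_eq => j; rewrite (proj2 same1).
have [cs1 z1] := keep _ _ cs (toN _ _ same1).
have [s10 _ _ _ _] := cs1.
set w : 'rV[R]_n := get_row s1 15 in Pw hw.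
have P01 : P (get_row s1 0) by rewrite r1.
apply: wp_seq; apply: (@wp_candidate _ _ F G P solve B B0 15 s1 _ s10 isT Pw P01) => s2 imp2 wb.
have imp12 : improves F P N Q s1 s2.
  apply: improves_sub imp2 => a; first by move=> /eqP ->; exact: tree_cells_scratch.
  by move=> /orP[/eqP ->|/eqP ->] //; exact: tree_rows_scratch.
have imp02 : improves F P N Q s s2.
  have [a b c] := imp12; split=> //; last by rewrite -r1.
  exact: same_trans (toN _ _ same1) a.
have [sm12 P02 _] := imp12.
have [cs2 z2] := keep _ _ cs1 sm12; rewrite z1 -/z in z2.
have hw' := hw o (11 / 5) (P_cube Po) _.
have {}hw' : (11 / 5) ^+ 2 * F z + 2 * (11 / 5) * F (vmul z o) <=
    (1 + 11 / 5) ^+ 2 * F w + 2 * (11 / 5) * err by apply: hw'; lra.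
(* The right indices are fixed before the loops; a node that is not good receives arbitrary ones. *)
have [jp [jA [jX Hj]]] : exists jp jA jX : nat, good_node d.+1 z ->
    [/\ (jp < 5 * T)%N, (jA < 5 * T)%N, (jX < 5 * T)%N &
      right_guesses z ((jp%:R - 3%:R * T%:R) * eta) (jA%:R * eta) (jX%:R * eta)].
  have [gd|ngd] := pselect (good_node d.+1 z); last by exists 0%N, 0%N, 0%N.
  have [[/andP[e0 e1] OT] _ _] := gd.
  have O0 : 0 <= O by apply: F_ge0; exact: P_cube.
  have eO : 0 <= eps * O by rewrite mulr_ge0 ?invr_ge0 ?ler0n.
  have a0 : 0 <= F (vadd z o) <= 2 * O.
    rewrite F_ge0 ?(vadd_le F_ge0 F_dr P_cube P_down o_max Pz) //.
    by apply: cube_vadd; exact: P_cube.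
  have b0 : 0 <= F (vmul z o) <= O.
    rewrite F_ge0 ?(vmul_le P_cube P_down o_max Pz) //.
    by apply: cube_vmul; exact: P_cube.
  have [jp [jA [jX [h1 h2 h3 h4 h5]]]] := guesses_exist e0 OT O0 eO a0 b0 half_le_theta_pow T_gt0.
  by exists jp, jA, jX => _; split.
(* Each nested loop must also preserve the counters of the loops around it: [M1], [M2] and
   [run_cells] are the successive frames. *)
pose M1 : pred nat := fun a => N a && (a != counter d.+1 0).
pose M2 : pred nat := fun a => M1 a && (a != counter d.+1 1).
have M1N a : M1 a -> N a by case/andP.
have M2M a : M2 a -> M1 a by case/andP.
have M3M a : run_cells d.+1 a -> M2 a by case/and4P=> h1 h2 h3 _; rewrite /M2 /M1 /N h1 h2 h3.
have M3N a : run_cells d.+1 a -> N a by move=> /M3M /M2M /M1N.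
have nc k l : k != l -> (counter d.+1 k == counter d.+1 l) = false.
  by move=> /counter_neq /negbTE.
have low5 : ~~ N 5 by exact: tree_cells_const.
have cellN5 s' : constants s' -> nmem s' 5 = (5 * T)%N by case=> _ _ _ _ [].
apply: (@wp_for_improves _ _ F G P solve B N M1 Q (counter d.+1 0) 5 (5 * T) jp _ s2 tgt
  (good_node d.+1 z)) => //; [exact: cellN5|exact: tree_cells_counter|by rewrite /M1 eqxx andbF| |]; last first.
  move=> s' imp hg; apply: HX; first exact: improves_trans imp02 imp.
  by move=> gd; apply: hg => //; have [] := Hj gd.
move=> k1 s3 k1T hc1 imp23.
have [sm23 P03 b23] := imp23; have [cs3 z3] := keep _ _ cs2 sm23; rewrite z2 in z3.
apply: (@wp_for_improves _ _ F G P solve B M1 M2 Q (counter d.+1 1) 5 (5 * T) jA _ s3 tgt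
  (good_node d.+1 z /\ k1 = jp)) => //; [exact: cellN5| |by rewrite /M2 eqxx andbF| |]; last first.
- move=> s' imp hg; split=> // gd kE; apply: hg => //; by have [] := Hj gd.
- move=> k2 s4 k2T hc2 imp34.
  have [sm34 P04 b34] := imp34.
  have imp24 : improves F P N Q s2 s4.
    by apply: improves_trans imp23 _; exact: improves_sub imp34.
  have [sm24 _ b24] := imp24; have [cs4 z4] := keep _ _ cs2 sm24; rewrite z2 in z4.
  have hc1' : nmem s4 (counter d.+1 0) = k1 by rewrite (proj1 sm34) // /M1 eqxx andbF.
  apply: (@wp_for_improves _ _ F G P solve B M2 (run_cells d.+1) Q (counter d.+1 2) 5 (5 * T) jX _ s4 tgt
    ((good_node d.+1 z /\ k1 = jp) /\ k2 = jA)) => //;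
    [exact: cellN5| |exact: run_cells_counter| |]; last first.
  + by move=> s' imp hg; split=> // gd kE; apply: hg => //; have [] := Hj (proj1 gd).
  + move=> k3 s5 k3T hc3 imp45.
    have [sm45 P05 b45] := imp45.
    have imp25 : improves F P N Q s2 s5.
      by apply: improves_trans imp24 _; apply: improves_sub imp45 => // a /M2M /M1N.
    have [sm25 _ b25] := imp25; have [cs5 z5] := keep _ _ cs2 sm25; rewrite z2 in z5.
    have hc1'' : nmem s5 (counter d.+1 0) = k1.
      by rewrite (proj1 sm45) // /M2 /M1 eqxx andbF.
    have hc2'' : nmem s5 (counter d.+1 1) = k2 by rewrite (proj1 sm45) // /M2 eqxx andbF.
    have Pz5 : P (get_row s5 zr) by rewrite z5.
    have wb5 : F w <= best s5 by exact: le_trans wb b25.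
    have hw5 := hw'; rewrite -z5 in hw5.
    apply: wp_mono; last first.
      apply: (@wp_greedy_run d s5 w (((good_node d.+1 z /\ k1 = jp) /\ k2 = jA) /\ k3 = jX)
        IH cs5 P05 Pz5 hw5 wb5).
      rewrite hc1'' hc2'' hc3 z5 => -[[[gd ->] ->] ->].
      by have [_ _ _ rg] := Hj gd.
    by move=> s6 [imp56 hg]; split=> // gd kE; apply: hg.
  + rewrite /M2 /M1 /N tree_cells_counter // nc // nc //.
- by rewrite /M1 /N tree_cells_counter // nc.
Qed.

End SearchTree.

(* With [N] the first integer at least [1 / delta], the loop counts [T = 30 m N] greedy steps,
   [11 m N] of them in the first phase.  The guesses use the unit
   [(F 0 + max <gradient at 0, x>) / T]. *)
Definition setup (m : nat) : cmd :=
  Seq (RSet (NLit 1) (NLit 0) (cellR 0 0))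
  (Seq (RSet (NLit 0) (NLit 0) (RNat (NLit 0)))
  (Seq (While (BNot (BRle (RNat (NLit 1)) (RMul (RNat (cellN 1)) (cellR 1 0))))
    (Seq (NSet (NLit 1) (NAdd (cellN 1) (NLit 1)))
    (Seq (NSet (NLit 2) (NAdd (cellN 2) (NLit (30 * m))))
    (Seq (NSet (NLit 3) (NAdd (cellN 3) (NLit (11 * m))))
    (Seq (NSet (NLit 4) (NAdd (cellN 4) (NLit (30 * m * m))))
         (NSet (NLit 5) (NAdd (cellN 5) (NLit (5 * (30 * m))))))))))
  (Seq (QueryF (NLit 0) (NLit 1) (NLit 2))
  (Seq (QueryGrad (NLit 0) (NLit 12))
  (Seq (Solve (NLit 11) (NLit 0) (NLit 12) (NLit 13) (NLit 7))
  (Seq (vsum 10 0 (RMul (entry 12) (entry 13)))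
       (RSet (NLit 1) (NLit 1) (RDiv (RAdd (cellR 1 2) (cellR 10 0)) (RNat (cellN 2)))))))))).

Definition main (m : nat) : cmd :=
  Seq (setup m) (Seq (local_search (zrow (2 * m).+1)) (search (2 * m).+1)).

(** * Initialization, root of the tree and final estimate *)

Section Main.
Context {R : realType} {n : nat}.
Variables (F : 'rV[R]_n -> R) (G : 'rV[R]_n -> 'rV[R]_n) (L D : R) (P : set 'rV[R]_n).
Variable solve : seq ('rV[R]_n * R) -> 'rV[R]_n -> option 'rV[R]_n.
Hypothesis F_ge0 : forall x, cube x -> 0 <= F x.
Hypothesis F_dr : dr_submodular F.
Hypothesis F_grad : gradient_on_cube F G.
Hypothesis G_smooth : smooth L G.
Hypothesis P_cube : P `<=` cube.
Hypothesis P_body : convex_body P.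
Hypothesis P_down : down_closed P.
Hypothesis P_diam : has_diameter D P.
Hypothesis P_solve : meta_solver P solve.
Variables (m : nat) (delta : R) (o : 'rV[R]_n).
Hypothesis delta01 : 0 < delta < 1.
Hypothesis o_max : maximizer F P o.
Implicit Types (s : state R) (x y z v w : 'rV[R]_n).

Definition steps : nat := (Num.truncn delta^-1).+1.
(** Entry 1 is what [cost] charges a loop with a real guard, here the search in [setup]; the last
    case covers cells 2, 5 and 12 together. *)
Definition loop_bound (a : nat) : nat :=
  if a == 0%N then n else if a == 1%N then steps
  else if a == 4%N then (30 * (m * steps) * m)%N else (5 * (30 * (m * steps)))%N.

Local Notation wp := (wp F G solve loop_bound).

Let delta_gt0 : 0 < delta. Proof. by case/andP: delta01. Qed.

Definition setup_state (eta : R) (k : nat) s :=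
  [/\ (0 < k <= steps)%N /\ 1 <= k%:R * delta,
      constants (n := n) (30 * (m * k)) m (m * k) eta s,
      get_row s 0 = 0 :> 'rV[R]_n, get_row s 11 = 0 :> 'rV[R]_n & rmem s 11 n = 0].

(** The machine neither multiplies naturals nor rounds reals, so the multiples of the first [k] with
    [1 <= k * delta] are accumulated while [k] is searched for. Row 0 is cleared to become the point
    [0] of [P]. *)
Lemma wp_setup (X : state R -> Prop) :
  (forall v k s, maximizer (dot (G 0)) P v ->
     setup_state ((F 0 + dot (G 0) v) / (30 * (m * k))%:R) k s -> X s) ->
  wp (setup m) X (init_state n delta).
Proof.
move=> HX.
apply/wp_seq/wp_rset/wp_seq/wp_rset.
pose I k s := [/\ [/\ nmem s 0 = n, nmem s 1 = k, nmem s 2 = (30 * (m * k))%N,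
    nmem s 3 = (11 * (m * k))%N & nmem s 4 = (30 * (m * k) * m)%N /\ nmem s 5 = (5 * (30 * (m * k)))%N] &
  forall i j, rmem s i j = if (i == 1%N) && (j == 0%N) then delta else 0].
apply: wp_seq; apply: (@wp_while _ _ _ _ _ _ _ _ steps I) => //.
- split; first by rewrite /= !muln0.
  by move=> [|[|i]] [|j].
- move=> k s kK [[h0 h1 h2 h3 [h4 h5]] hr] _.
  do 4! apply/wp_seq/wp_nset; apply: wp_nset; split=> //.
  by rewrite /= h0 h1 h2 h3 h4 h5; split; lia.
- move=> s [[h0 h1 h2 h3 [h4 h5]] hr]; rewrite /= negbK h1 hr /=.
  rewrite -ler_pdivrMr // div1r ltW //.
  have d0 : 0 <= delta^-1 by rewrite invr_ge0 ltW.
  by have /andP[_] := truncn_itv d0.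
move=> k s kK [[h0 h1 h2 h3 [h4 h5]] hr]; rewrite /= negbK h1 hr /= => kd.
have k0 : (0 < k)%N.
  by rewrite lt0n; apply/negP => /eqP E; move: kd; rewrite E mul0r ler10.
have r0 : get_row s 0 = 0 :> 'rV[R]_n by apply/rowP => j; rewrite !mxE hr.
apply/wp_seq/wp_queryF; rewrite [neval _ _]/= [neval _ _]/= [neval _ _]/= r0.
apply/wp_seq/wp_queryG; rewrite [neval _ _]/= [neval _ _]/= get_row_rset_neq // r0.
apply/wp_seq/wp_solve => //.
set s1 := set_row _ _ _.
have -> : do_solve solve s1 (neval s1 (NLit 11)) (neval s1 (NLit 0)) (neval s1 (NLit 12))
      (neval s1 (NLit 13)) (neval s1 (NLit 7)) =
    if solve [::] (G 0) is Some v then nset (set_row s1 13 v) 7 1 else nset s1 7 0.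
  by rewrite /do_solve get_row_set_row.
have := P_solve [::] (G 0).
case: (solve [::] (G 0)) => [v [[Pv _] hv]|he]; last first.
  have [[x Px] _ _] := P_body; have : (P `&` polyhedron [::]) x by [].
  by rewrite he.
have vmax : maximizer (dot (G 0)) P v by split=> // x Px; apply: hv.
apply: wp_seq; apply: (@wp_vsum _ _ F G solve loop_bound (leqnn _) _ _ _ (fun j => G 0 0 j * v 0 j)) => //.
  by move=> j s' hN h6 hR; rewrite /= h6 !hR //= ?valK.
rewrite -/(dot (G 0) v); apply: wp_rset; rewrite [neval _ _]/= [reval _ _]/= h2.
apply: (HX v k) => //; split=> //.
- by split=> //; rewrite k0.
- by apply/rowP => j; rewrite !mxE /= hr.
- by rewrite /= hr.
Qed.

Hypothesis mp : (0 < m)%N.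
Hypothesis me : m%:R^-1 <= 1 / (1000 * 1000) :> R.

Lemma wp_main :
  wp (main m) (fun s => P (output n s) /\
    401%:R / 1000%:R * F o - 10 * (delta * D ^+ 2 * L) <= F (output n s)) (init_state n delta).
Proof.
have [Po ho] := o_max; have [L0 _] := G_smooth.
apply: wp_seq; apply: wp_setup => v k s [Pv hv] [[/andP[k0 kK] kd] cs r0 r11 e11].
set q := (m * k)%N in cs; set eta := _ / _ in cs.
have P00 : P (get_row s 0) by rewrite r0; exact: body0.
have F00 : 0 <= F 0 by apply/F_ge0/cube0.
have q0 : (0 < q)%N by rewrite muln_gt0 mp.
have [c0 c2 _ c4 _] := cs.
set T := (30 * q)%N in c2 c4 cs.
have T_gt0 : (0 < T)%N by rewrite muln_gt0.
have T0 : 0 < T%:R :> R by rewrite ltr0n.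
have k0' : 0 < k%:R :> R by rewrite ltr0n.
have m0' : 0 < m%:R :> R by rewrite ltr0n.
set h := T%:R^-1 : R; set err := L * D ^+ 2 * h.
have hm : h <= m%:R^-1 / 30.
  rewrite /h /T /q !natrM !invfM mulrC ler_pM2r ?invr_gt0 ?ltr0n //.
  by rewrite ler_piMr ?invr_ge0 ?(ltW m0') // invf_le1 // ler1n.
have [h_eps h_small] : h <= m%:R^-1 /\ h <= 1 / (1000 * 1000) / 4.
  by apply: step_small me; [rewrite invr_ge0 ltW|exact: hm].
have kinv : k%:R^-1 <= delta.
  by rewrite -[leLHS]mul1r ler_pdivrMr // mulrC.
have hd : h <= delta.
  apply: le_trans kinv; rewrite lef_pV2 ?posrE // ler_nat /T /q.
  by apply: leq_trans (leq_pmull _ mp) _; exact: leq_pmull.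
have LD0 : 0 <= L * D ^+ 2 by rewrite mulr_ge0 ?sqr_ge0.
have errd : err <= delta * D ^+ 2 * L.
  rewrite /err [leRHS](_ : _ = L * D ^+ 2 * delta); last by ring.
  exact: ler_wpM2l.
have B0 : (n <= loop_bound 0)%N by [].
have kst : (m * k <= m * steps)%N by rewrite leq_mul2l kK orbT.
have kst30 : (T <= 30 * (m * steps))%N by rewrite leq_mul2l.
have B2 : (T <= loop_bound 2)%N by apply: leq_trans kst30 _; exact: leq_pmull.
have B4 : (T * m <= loop_bound 4)%N by rewrite leq_mul2r kst30 orbT.
have B5 : (5 * T <= loop_bound 5)%N by rewrite leq_mul2l kst30.
have B12 : (T <= loop_bound 12)%N by apply: leq_trans kst30 _; exact: leq_pmull.
apply: wp_seq; apply: (@wp_local_search _ _ F G L D P solve loop_bound F_ge0 F_dr F_grad G_smooth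
  P_cube P_body P_diam P_solve T m (F o) T_gt0 mp ho B0 B4 _ _ _ (zrow_ge20 _) c0 c2 c4) => s1 same1 Pz hz.
set z : 'rV[R]_n := get_row s1 (zrow _) in Pz hz.
have zr0 : (zrow (2 * m).+1 == 0%N) = false by [].
have zr1 : (zrow (2 * m).+1 == 1%N) = false by [].
have cs1 : constants (n := n) T m q eta s1.
  by apply: (constants_same cs same1) => // a ha; rewrite /ls_cells [(6 <= a)%N]leqNgt ha.
have r10 : get_row s1 0 = 0 :> 'rV[R]_n.
  by rewrite -r0; apply: get_row_eq => j; rewrite (proj2 same1).
have P10 : P (get_row s1 0) by rewrite r10; exact: body0.
apply: (wp_search F_ge0 F_dr F_grad G_smooth P_cube P_body P_down P_diam P_solve q0 mp o_max
  B0 B2 B4 B5 B12 h_small h_eps me cs1 P10 Pz) => s2 [_ P20 _] good.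
split=> //; rewrite /output.
have F2 : 0 <= F (get_row s2 0) by apply/F_ge0/P_cube.
have O0 : 0 <= F o by apply/F_ge0/P_cube.
(* If [F o] is at most the error term, the bound is nonpositive and every point will do; otherwise
   the guessing unit is small enough. *)
have [small|large] := lerP (F o) (delta * D ^+ 2 * L).
  exact: le_trans (small_optimum O0 small) F2.
have op : 0 < F o.
  apply: le_lt_trans large; apply: mulr_ge0 => //; apply: mulr_ge0; last exact: sqr_ge0.
  exact: ltW.
apply: (@le_trans _ _ (401 / 1000 * F o - 10 * err)).
  by rewrite lerD2l lerN2; apply: ler_wpM2l errd; exact: ler0n.
apply: good; rewrite -/z.
pose S := F 0 + dot (G 0) v.
have etaE : eta = S / T%:R by [].
have OS : F o <= S.
  have v0 : vle 0 o by move=> j; rewrite mxE; have /andP[] := P_cube Po j.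
  have := @grad_up _ _ F G F_dr F_grad 0 o (@cube0 R n); rewrite add0r => /(_ (P_cube Po) v0).
  by rewrite lerBlDl => hg; apply: le_trans hg _; rewrite lerD2l; exact: hv.
(* The point [v / k] of [P] shows it: its value exceeds [(F 0 + dot (G 0) v) / k] up to a smoothness
   error, at most [F o] since [k^-1 <= delta] and [F o] is large. *)
have SO : S / k%:R <= F o + F o.
  pose t := k%:R^-1 : R.
  have t01 : 0 <= t <= 1 by rewrite invr_ge0 (ltW k0') /= invf_le1 // ler1n.
  have /andP[t0 t1] := t01.
  have vi j : 0 <= v 0 j by have /andP[] := P_cube Pv j.
  have tv0 : vle 0 (t *: v) by move=> j; rewrite !mxE mulr_ge0.
  have Ptv : P (t *: v).
    by apply: (P_down Pv) => // j; rewrite !mxE ler_piMl.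
  have := @smooth_up _ _ F G L F_dr F_grad G_smooth 0 (t *: v) (@cube0 R n).
  rewrite add0r => /(_ (P_cube Ptv) tv0); rewrite dotZr norm2Z ger0_norm // exprMn => hs.
  have nv : norm2 v ^+ 2 <= D ^+ 2.
    rewrite lerXn2r ?nnegrE ?norm2_ge0 ?(diam_ge0 P_cube P_body P_down P_diam) //.
    exact: (body_norm P_cube P_body P_down P_diam).
  have q1 : t ^+ 2 * norm2 v ^+ 2 <= delta * D ^+ 2.
    apply: ler_pM => //; rewrite ?sqr_ge0 //.
    by apply: le_trans kinv; rewrite expr2 ler_piMl.
  have q2 : L * (t ^+ 2 * norm2 v ^+ 2) <= F o.
    apply: le_trans (ltW large); rewrite mulrC [leRHS]mulrC.
    by rewrite [leRHS]mulrC; exact: ler_wpM2r.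
  have q3 : t * F 0 <= F 0 by rewrite ler_piMl.
  have q4 := ho _ Ptv.
  have -> : S / k%:R = t * F 0 + t * dot (G 0) v by rewrite /S -/t mulrC mulrDr.
  move: hs q2 q3 q4; set a1 := t * dot _ _; set a2 := L * _; set a3 := t * F 0 => hs q2 q3 q4.
  rewrite lerBlDr in hs.
  apply: (@le_trans _ _ (F 0 + (F (t *: v) - F 0 + a2))); first exact: lerD.
  by rewrite addrA addrCA subrr addr0; exact: lerD.
have Sp : 0 < S by exact: lt_le_trans OS.
split.
- split; last by rewrite etaE mulrC divfK // gt_eqF.
  rewrite etaE divr_gt0 //=.
  have -> : S / T%:R = S / k%:R / (30 * m%:R).
    rewrite /T /q !natrM; field.
    by rewrite !gt_eqF // ?ltr0n.
  rewrite ler_pdivrMr; last by rewrite mulr_gt0 // ltr0n.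
  apply: (le_trans SO).
  have -> : m%:R^-1 * F o * (30 * m%:R) = F o *+ 30 by rewrite -mulr_natl; field; exact: lt0r_neq0.
  by rewrite -mulr2n; exact: ler_wpMn2l.
(* Row 11 is still zero, so the first local search runs under the void constraint [0 <= 0]. *)
- have cutE : cut s = [:: (0 : 'rV[R]_n, 0)] by rewrite /cut /get_constraints /= r11 e11.
  have all_in (x : 'rV[R]_n) : polyhedron (cut s) x.
    move=> c; rewrite cutE inE => /eqP -> /=.
    by rewrite /dot big1 // => i _; rewrite mxE mul0r.
  have [|_ _ hst] := hz; first by exists o; split.
  apply: (local_opt_bound F_dr F_grad); [exact: P_cube|exact: P_cube|].
  exact: hst.
(* The root satisfies the potential bound: [2 * F o] is less than [2 * m + 1] portions of
   [F o / m]. *)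
- apply: le_lt_trans (vadd_le F_ge0 F_dr P_cube P_down o_max Pz) _.
  have -> : (2 * m).+1%:R * (m%:R^-1 * F o) = 2 * F o + m%:R^-1 * F o :> R.
    by rewrite -(@natr1 R (2 * m)%N) natrM; field; exact: lt0r_neq0.
  by rewrite ltrDl mulr_gt0 ?invr_gt0.
Qed.

End Main.

Lemma loop_bound_poly {R : realType} (n m : nat) (delta : R) : (0 < m)%N -> 0 < delta < 1 ->
  exists M : nat, [/\ forall b, (loop_bound (n := n) m delta b <= M)%N, (n < M)%N &
    M%:R <= (1 + 300 * m * m)%:R * (n%:R + delta^-1)].
Proof.
move=> mp /andP[d0 d1].
have di : 1 <= delta^-1 by rewrite invf_ge1 // ltW.
have st : (steps delta)%:R <= delta^-1 + delta^-1.
  have /andP[ht _] := truncn_itv (le_trans ler01 di).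
  by rewrite /steps -natr1; exact: lerD.
have sp : (0 < steps delta)%N by [].
exists (n.+1 + 150 * (m * m * steps delta))%N; split.
- move=> b; rewrite /loop_bound; move: (steps delta) sp => k k0.
  have h1 : (m * k <= m * m * k)%N by rewrite leq_mul2r leq_pmulr // orbT.
  have h2 : (k <= m * k)%N by exact: leq_pmull.
  have -> : (30 * (m * k) * m = 30 * (m * m * k))%N by rewrite -!mulnA [(k * m)%N]mulnC.
  move: h1 h2; move: (m * m * k)%N (m * k)%N => x y h1 h2.
  by case: ifP => _; [|case: ifP => _; [|case: ifP => _]]; lia.
- by rewrite addSn ltnS leq_addr.
- move: st; move: (steps delta) => k st.
  rewrite natrD [in leRHS]natrD [leRHS]mulrDl mul1r; apply: lerD.
    by rewrite -natr1 lerD2l.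
  have -> : (150 * (m * m * k))%:R = (150 * (m * m))%:R * k%:R :> R by rewrite -natrM mulnA.
  have -> : (300 * m * m)%:R = (150 * (m * m))%:R * 2%:R :> R.
    by rewrite -natrM; congr (_%:R); lia.
  rewrite -mulrA; apply: ler_wpM2l => //.
  apply: (le_trans st); rewrite mulr_natl mulr2n.
  by apply: lerD; rewrite lerDr.
Qed.

Theorem theorem1p1 (R : realType) :
  exists (alg : cmd) (c : R) (A k : nat), 0 < c /\
  forall (n : nat) (F : 'rV[R]_n -> R) (gradF : 'rV[R]_n -> 'rV[R]_n)
    (P : set 'rV[R]_n)
    (solve : seq ('rV[R]_n * R) -> 'rV[R]_n -> option 'rV[R]_n)
    (L D delta : R),
  (forall x, cube x -> 0 <= F x) ->
  dr_submodular F ->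
  gradient_on_cube F gradF ->
  smooth L gradF ->
  P `<=` cube ->
  convex_body P ->
  down_closed P ->
  has_diameter D P ->
  meta_solver P solve ->
  0 < delta < 1 ->
  exists (t : nat) (s : state R),
    [/\ exec F gradF solve alg (init_state n delta) t s,
        t%:R <= A%:R * (n%:R + delta^-1) ^+ k,
        P (output n s) &
        exists2 xopt, maximizer F P xopt &
          F (output n s) >= 401%:R / 1000%:R * F xopt - c * (delta * D ^+ 2 * L)].
Proof.
(* [m] is fixed before any instance is given, so the program, its depth and the degree [k] are
   absolute. *)
pose m := Num.bound (1000 * 1000 : R).
have hm : 1000 * 1000 <= m%:R :> R.
  by apply: ltW; apply: archi_boundP; apply: mulr_ge0; exact: ler0n.
have [mp me] := large_inverse hm; clearbody m.
have [A [k hcost]] := cost_poly (main m).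
pose M0 := (1 + 300 * m * m)%N.
exists (main m), 10, (A * M0 ^ k)%N, k; split; first exact: ltr0Sn.
move=> n F G P solve L D delta F_ge0 F_dr F_grad G_smooth P_cube P_body P_down P_diam P_solve d01.
have [P0 Pc _] := P_body.
have [xo xo_max] := maximizer_exists F_grad P_cube P0 Pc.
have [t [s [he ht [hP hF]]]] := wp_main F_ge0 F_dr F_grad G_smooth P_cube P_body P_down P_diam
  P_solve d01 xo_max mp me.
exists t, s; split=> //; last by exists xo.
have [M [hM nM M_le]] := loop_bound_poly n mp d01.
rewrite natrM natrX -mulrA -exprMn; apply: (@le_trans _ _ (A * M ^ k)%:R).
  by rewrite ler_nat; apply: leq_trans ht _; exact: hcost.
rewrite natrM natrX; apply: ler_wpM2l => //.
apply: lerXn2r; rewrite ?nnegrE; [exact: ler0n| |exact: M_le].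
exact: le_trans (ler0n _ _) M_le.
Qed.
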